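(* Let $K\subset\hat{\mathbb{C}}$ be a compactum and let $f:\hat{\mathbb{C}}\rightarrow\hat{\mathbb{C}}$ be a rational function. Then $f(d)\in\mathcal{D}_K^{PS}$ for each $d\in \mathcal{D}_{f^{-1}(K)}^{PS}$. Consequently, $f^{-1}\left(\mathcal{D}_K^{PS}\right)=\mathcal{D}_{f^{-1}(K)}^{PS}$, where $f^{-1}\left(\mathcal{D}_K^{PS}\right)$ denotes the collection of all components of $f^{-1}(d)$ as $d$ runs through $\mathcal{D}_K^{PS}$.
   Context: A compactum is a compact metric space. A Peano space is a compactum having at most countably many non-degenerate components, each of which is locally connected, such that for every $C>0$ at most finitely many of them have diameter greater than $C$. A monotone decomposition of a compactum $K$ is an (upper semicontinuous) partition of $K$ into subcontinua, regarded as a hyperspace with the quotient topology. For a compactum $K\subset\hat{\mathbb{C}}$ it is known that among all monotone decompositions of $K$ whose hyperspace is a Peano space there is a unique one that is finer than all the others; it is denoted $\mathcal{D}_K^{PS}$ and called the core decomposition of $K$ with Peano hyperspace.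
   Formalization: The rational function f is assumed to be non-constant (degree at least 1); for a constant f with value in K the preimage is the whole sphere, whose core decomposition consists of points, so the claimed equality fails. *)

(* Defs.v *)
From HB Require Import structures.
From mathcomp Require Import all_boot all_order all_algebra.
From mathcomp Require Import all_classical all_reals all_analysis.
From mathcomp Require Import complex.

Set Implicit Arguments.
Unset Strict Implicit.
Unset Printing Implicit Defensive.

Import Order.TTheory GRing.Theory Num.Theory.
Local Open Scope classical_set_scope.
Local Open Scope ring_scope.

Definition CC (R : realType) : Type := (R[i])^o.

(** The Riemann sphere \hat{C} = C ∪ {∞}; [Some z] is z, [None] is ∞. *)
Definition Chat (R : realType) : topologicalType :=
  one_point_compactification (CC R).

Definition rational_map (R : realType) (f : Chat R -> Chat R) : Prop :=
  exists p q : {poly R[i]},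
    [/\ coprimep p q,
        (1 < maxn (size p) (size q))%N,
        (forall z : R[i],
           f (Some z) = if q.[z] == 0 then None else Some (p.[z] / q.[z]))
      & f None = if (size q < size p)%N then None
                 else if (size p < size q)%N then Some 0
                 else Some (lead_coef p / lead_coef q)].

Section MetricOnSet.
Variables (R : realType) (X : Type) (S : set X) (dist : X -> X -> R).

Definition metric_on : Prop :=
  [/\ (forall x y, S x -> S y -> 0 <= dist x y),
      (forall x y, S x -> S y -> (dist x y = 0 <-> x = y)),
      (forall x y, S x -> S y -> dist x y = dist y x)
    & (forall x y z, S x -> S y -> S z -> dist x z <= dist x y + dist y z)].

Definition mball (x : X) (r : R) : set X := [set y | S y /\ dist x y < r].

Definition mopen (A : set X) : Prop :=
  A `<=` S /\ forall x, A x -> exists2 r : R, 0 < r & mball x r `<=` A.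

Definition mopen_in (Y A : set X) : Prop :=
  exists U, mopen U /\ A = U `&` Y.

Definition mconnected (A : set X) : Prop :=
  A `<=` S /\
  ~ (exists U V, [/\ mopen U /\ mopen V, A `&` U !=set0, A `&` V !=set0,
                     A `<=` U `|` V & A `&` U `&` V = set0]).

Definition mcomponent (C : set X) : Prop :=
  [/\ C !=set0, mconnected C & forall B, mconnected B -> C `<=` B -> B = C].

Definition mcompact : Prop :=
  forall UU : set (set X), (forall U, UU U -> mopen U) ->
    S `<=` \bigcup_(U in UU) U ->
    exists2 VV : set (set X), finite_set VV /\ VV `<=` UU &
      S `<=` \bigcup_(U in VV) U.

Definition mlocally_connected (C : set X) : Prop :=
  forall x U, C x -> mopen_in C U -> U x ->
    exists V, [/\ mopen_in C V, V x, V `<=` U & mconnected V].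

Definition nondegenerate (A : set X) : Prop :=
  exists x y, [/\ A x, A y & x <> y].

Definition diam_gt (A : set X) (c : R) : Prop :=
  exists x y, [/\ A x, A y & c < dist x y].

Definition peano_metric : Prop :=
  [/\ mcompact,
      countable [set C | mcomponent C /\ nondegenerate C],
      (forall C, mcomponent C -> nondegenerate C -> mlocally_connected C)
    & forall c : R, 0 < c ->
        finite_set [set C | [/\ mcomponent C, nondegenerate C & diam_gt C c]]].

End MetricOnSet.

Section Decompositions.
Variable R : realType.
Local Notation T := (Chat R).

Definition monotone_decomposition (K : set T) (D : set (set T)) : Prop :=
  [/\ (forall d, D d -> [/\ d !=set0, d `<=` K, compact d & connected d]),
      (forall x, K x -> exists2 d, D d & d x),
      (forall d1 d2, D d1 -> D d2 -> d1 `&` d2 !=set0 -> d1 = d2)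
    & (forall d U, D d -> open U -> d `<=` U ->
         exists V, [/\ open V, d `<=` V &
           forall d', D d' -> d' `&` V !=set0 -> d' `<=` U])].

(** open sets of the hyperspace D (quotient topology of K) *)
Definition hyper_open (K : set T) (D : set (set T)) (W : set (set T)) : Prop :=
  W `<=` D /\ exists V : set T, open V /\ \bigcup_(d in W) d = V `&` K.

Definition peano_hyperspace (K : set T) (D : set (set T)) : Prop :=
  exists dist : set T -> set T -> R,
    [/\ metric_on D dist,
        (forall W, hyper_open K D W <-> mopen D dist W)
      & peano_metric D dist].

Definition finer (D1 D2 : set (set T)) : Prop :=
  forall d1, D1 d1 -> exists2 d2, D2 d2 & d1 `<=` d2.

Definition core_decomposition_PS (K : set T) (D : set (set T)) : Prop :=
  [/\ monotone_decomposition K D, peano_hyperspace K D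
    & forall D', monotone_decomposition K D' -> peano_hyperspace K D' ->
        finer D D'].

Definition preimage_decomposition (f : T -> T) (D : set (set T)) :
    set (set T) :=
  [set c | exists d x, [/\ D d, (f @^-1` d) x &
                          c = connected_component (f @^-1` d) x]].

End Decompositions.

(* Main.v *)
Require Import Defs.
From HB Require Import structures.
From mathcomp Require Import all_boot all_order all_algebra.
From mathcomp Require Import all_classical all_reals all_analysis.
From mathcomp Require Import complex.
From mathcomp Require Import ring lra finmap zify.
Set Implicit Arguments.
Unset Strict Implicit.
Unset Printing Implicit Defensive.
Import Order.TTheory GRing.Theory Num.Theory numFieldNormedType.Exports.
Local Open Scope classical_set_scope.

(** Both inclusions of partitions come from minimality of a core decomposition.  Convergence is
    along ultrafilters, [ulim U H] being the limit of the sets [H i]; a hyperspace is Peano iff,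
    near each limit point of connected sets whose limit is not inside one element, those sets
    eventually lie in one connected neighbourhood ([nicely_connected]).  This passes from [DK]
    to the components of the preimages of its elements, because a component of the preimage of
    a continuum is clopen in that preimage and maps onto the continuum; so [DfK] is finer
    than [preimage_decomposition f DK].  Conversely call two points of [K] equivalent when the same
    elements of [DfK] meet their fibres, and let [G] consist of the components of the classes.
    If the hyperspace of [G] were not Peano, some continuum of convergence in [K] would lift to
    pairwise separated continua whose limit meets several elements of [DfK]; three of the
    connected sets that the Peano property of [DfK] attaches to them cross the same
    side of a box in a linked order, which is impossible in the plane ([planar_collapse]).  So
    [DK] is finer than [G], and a component of the preimage of an element of [DK] meets only
    finitely many elements of [DfK], hence lies in one. *)

(** * Ultrafilters and continua in compact spaces *)

(** The Peano axioms speak of a metric on the hyperspace that is only asserted to exist, whereas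
    both constructions live on the sphere; hence the detour through [nicely_connected], which
    mentions no metric and can be moved along [f]. Ultrafilters suit this: every family of continua
    has a limit, upper and lower limits agree, and a choice among finitely many values becomes
    constant, so no subsequence is ever extracted. Of the rational map three facts are used: it is
    continuous, it is open, and its fibres are enumerated by finitely many maps [e k], with
    repetitions and without continuity. The pushforward is the hard direction, since the images of
    elements of [DfK] might overlap before the theorem is known; recording which elements occur
    above a point yields an equivalence relation instead, and the finiteness of the fibres makes it
    closed. Planarity enters only through [planar_collapse], whose limit has to avoid infinity,
    where coordinates fail; this is why the construction looks for a point whose element does not
    contain infinity. *)

Section Ultrafilters.
Variables (I : Type) (U : set_system I).
Hypothesis uU : UltraFilter U.

Lemma ultra_dec (P : set I) : U P \/ U (~` P).
Proof. exact: in_ultra_setVsetC. Qed.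

Lemma ultra_notP (P : set I) : ~ U P -> U (~` P).
Proof. by move=> nP; case: (ultra_dec P). Qed.

Lemma ultraI (P Q : set I) : U P -> U Q -> U (P `&` Q).
Proof. exact: filterI. Qed.

Lemma ultra_ex (P : set I) : U P -> exists i, P i.
Proof. exact: filter_ex. Qed.

Lemma ultra_map (J : Type) (h : I -> J) : UltraFilter (h @ U).
Proof.
split=> [|G GF sUG]; first exact: fmap_proper_filter.
rewrite predeqE => A; split; last exact: sUG.
move=> GA; case: (ultra_dec (h @^-1` A)) => // nA.
have GnA : G (~` A) by apply: sUG.
by have /filter_ex [x []] : G (A `&` ~` A) by apply: filterI.
Qed.

Lemma ultra_compact (T : topologicalType) (h : I -> T) (A : set T) :
  compact A -> U [set i | A (h i)] -> exists2 x, A x & h @ U --> x.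
Proof.
rewrite compact_ultra => cA UA.
by have [x [Ax xU]] := cA _ (ultra_map h) UA; exists x.
Qed.

Lemma ultra_cvg_closed (T : topologicalType) (h : I -> T) (A : set T) x :
  closed A -> h @ U --> x -> U [set i | A (h i)] -> A x.
Proof.
move=> cA hx UA; apply: contrapT => nA.
have /hx : nbhs x (~` A) by apply: open_nbhs_nbhs; split => //; exact: closed_openC.
by move=> /(filterI UA) /filter_ex [i []].
Qed.

(** The pigeonhole principle along an ultrafilter; it replaces every passage to a subsequence. *)
Lemma ultra_finite (T : choiceType) (A : set T) (h : I -> T) :
  finite_set A -> U [set i | A (h i)] -> exists2 a, A a & U [set i | h i = a].
Proof.
move=> /finite_seqP [s ->]; elim: s => [|b s IH] UA.
  by case/filter_ex: UA => i.
case: (ultra_dec [set i | h i = b]) => Ub.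
  by exists b => //=; rewrite mem_head.
have [|a /= sa Ua] := IH.
  apply: filterS (filterI UA Ub) => i [] /=; rewrite inE => /orP [/eqP //|//].
by exists a => //=; rewrite inE sa orbT.
Qed.
End Ultrafilters.

Lemma cvg_open (I : Type) (U : set_system I) (T : topologicalType) (h : I -> T)
    (x : T) (V : set T) : h @ U --> x -> open V -> V x -> U [set i | V (h i)].
Proof. by move=> hx oV Vx; apply: hx; exact: open_nbhs_nbhs. Qed.

Section Connected.
Variable T : topologicalType.
Implicit Types A B S : set T.

Lemma connected_closed2 A S S' : connected A -> closed S -> closed S' ->
  A `<=` S `|` S' -> A `&` S `&` S' = set0 -> A `&` S !=set0 -> A `<=` S.
Proof.
move=> cA cS cS' AS dis AS0; suff <- : A `&` S = A by apply: subIsetr.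
apply: cA => //; last by exists S.
exists (~` S'); first exact: closed_openC.
apply/seteqP; split => x [Ax Sx]; split => //.
  by move=> S'x; have : (A `&` S `&` S') x by []; rewrite dis.
by case: (AS _ Ax).
Qed.

Lemma connected_open2 A S S' : connected A -> open S -> open S' ->
  A `<=` S `|` S' -> A `&` S `&` S' = set0 -> A `&` S !=set0 -> A `<=` S.
Proof.
move=> cA cS cS' AS dis AS0; suff <- : A `&` S = A by apply: subIsetr.
apply: cA => //; first by exists S.
exists (~` S'); first exact: open_closedC.
apply/seteqP; split => x [Ax Sx]; split => //.
  by move=> S'x; have : (A `&` S `&` S') x by []; rewrite dis.
by case: (AS _ Ax).
Qed.

Lemma not_connected A : ~ connected A -> exists S O, [/\ closed S, open O,
  A `&` S = A `&` O, A `&` S !=set0 & A `\` S !=set0].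
Proof.
move=> /existsNP [B] /not_implyP [B0] /not_implyP [] [ O oO BO].
move=> /not_implyP [] [S cS BS] nBA; exists S, O; rewrite -BS -BO; split => //.
apply: contrapT => /nonemptyPn AS; apply: nBA; rewrite BS; apply/seteqP.
split => [x []//|x Ax]; split => //.
by apply: contrapT => nS; have : (A `\` S) x by []; rewrite AS.
Qed.

Lemma connected_component_ext A B x :
  connected A -> B `<=` A -> A x -> A `<=` B -> connected_component B x = A.
Proof.
move=> cA BA Ax AB; have -> : B = A by apply/seteqP.
exact: connected_component_id.
Qed.

Lemma subset_component A B x : connected B -> B `<=` A ->
  B `&` connected_component A x !=set0 -> B `<=` connected_component A x.
Proof.
move=> cB BA [y [By Cy]] z Bz; apply: (connected_component_trans Cy).
by apply: (connected_component_max By).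
Qed.
End Connected.

Section CompactHausdorff.
Variable T : topologicalType.
Hypotheses (hT : hausdorff_space T) (cT : compact [set: T]).
Implicit Types A B C S K O : set T.

Lemma closed_cpt A : closed A -> compact A.
Proof. by move=> cA; apply: (subclosed_compact cA cT). Qed.

Lemma cpt_closed A : compact A -> closed A.
Proof. exact: compact_closed. Qed.

Lemma ultra_lim (I : Type) (U : set_system I) (h : I -> T) : UltraFilter U ->
  exists x : T, h @ U --> x.
Proof.
by move=> uU; have [|x _ hx] := ultra_compact uU (h := h) cT; [exact: filterT|exists x].
Qed.

Lemma open_shrink A O : closed A -> open O -> A `<=` O ->
  exists C, [/\ open C, A `<=` C & closure C `<=` O].
Proof.
move=> cA oO AO; have [|V] := compact_normal hT cT cA (t := O).
  by apply/set_nbhsP; exists O; split.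
move=> /set_nbhsP [C [oC AC CV]] VO; exists C; split => //.
exact: subset_trans (closureS CV) VO.
Qed.

Lemma normal_sep A B : closed A -> closed B -> A `&` B = set0 ->
  exists O O', [/\ open O, open O', A `<=` O, B `<=` O' & O `&` O' = set0].
Proof.
move=> cA cB AB; have [] := @open_shrink A (~` B) cA.
- exact: closed_openC.
- by apply/disjoints_subset.
move=> C [oC AC CB]; exists C, (~` closure C); split => //.
- exact/closed_openC/closed_closure.
- by apply: subsetCr.
- by apply/disjoints_subset; rewrite setCK; exact: subset_closure.
Qed.

(** Compactness in the form used below: the traces on [C] of a family stable under intersection
    generate a filter, and a cluster point of it lies in every member, these being closed. *)
Lemma directed_closed (F : set (set T)) C : F !=set0 ->
  (forall S, F S -> closed S) -> (forall S S', F S -> F S' -> F (S `&` S')) ->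
  closed C -> (forall S, F S -> S `&` C !=set0) ->
  exists2 x, C x & forall S, F S -> S x.
Proof.
move=> F0 cF IF cC FC; pose G := filter_from F (fun S => S `&` C).
have GP : ProperFilter G.
  apply: filter_from_proper; last by [].
  apply: filter_from_filter => // S S' FS FS'; exists (S `&` S'); first exact: IF.
  by move=> x [[]].
have GC : G C.
  by case: F0 => S FS; exists S => // x [].
have [x [Cx Gx]] := closed_cpt cC GP GC; exists x => // S FS.
have GS : G S by exists S => // y [].
move: (Gx); rewrite clusterE => /(_ S GS).
by rewrite -(closure_id S).1 //; exact: cF.
Qed.

(** In a compact Hausdorff space the component of [x] is the intersection [Q] of the clopen parts
    containing [x]: disjoint open sets splitting [Q] would, by compactness, already split one of
    these parts, and the half around [x] would be a clopen part not containing all of [Q].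
    Compactness once more puts a single part inside [O]. *)
Lemma component_clopen K x O : closed K -> K x -> open O ->
  connected_component K x `<=` O -> exists S, [/\ closed S, closed (K `\` S),
    S `<=` K `&` O & S x].
Proof.
move=> cK Kx oO KO.
pose F := [set S | [/\ closed S, closed (K `\` S), S `<=` K & S x]].
have FK : F K by split => //; rewrite setDv; exact: closed0.
have F0 : F !=set0 by exists K.
have cF S : F S -> closed S by case.
have IF S S' : F S -> F S' -> F (S `&` S').
  move=> [c1 c2 c3 c4] [d1 d2 d3 d4]; split => //; first exact: closedI.
    by rewrite setDIr; exact: closedU.
  by move=> y [/c3].
pose Q := [set y | forall S, F S -> S y].
have cQ : closed Q.
  rewrite (_ : Q = \bigcap_(S in F) S); last by apply/seteqP; split.
  exact: closed_bigI.
have conQ : connected Q.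
  apply: contrapT => /not_connected [S [ O1 [cS oO1 SO [y [Qy Sy]] [z [Qz nSz]]]]].
  have QE : Q `\` S = Q `&` ~` O1.
    apply/seteqP; split => u [Qu H]; split => // K1; apply: H.
      by have : (Q `&` O1) u by []; rewrite -SO => -[].
    by have : (Q `&` S) u by []; rewrite SO => -[].
  have [|||A [B [oA oB QA QB AB]]] := @normal_sep (Q `&` S) (Q `\` S).
  - exact: closedI.
  - by rewrite QE; apply: closedI => //; exact: open_closedC.
  - by rewrite setDE setIACA setICr setI0.
  have [S0 FS0 S0AB] : exists2 S0, F S0 & S0 `<=` A `|` B.
    apply: contrapT => nex.
    have [||u nu Fu] := @directed_closed F (~` (A `|` B)) F0 cF IF.
    - by apply: open_closedC; exact: openU.
    - move=> S1 FS1; apply: contrapT => H; apply: nex; exists S1 => // u S1u.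
      by apply: contrapT => nAB; apply: H; exists u.
    apply: nu; have Qu : Q u by [].
    by case: (pselect (S u)) => Su; [left; apply: QA|right; apply: QB].
  (* Stated for an arbitrary ordered pair, since [x] may lie in [A] or in [B]. *)
  have key A1 B1 : open A1 -> open B1 -> A1 `&` B1 = set0 -> S0 `<=` A1 `|` B1 ->
      A1 x -> Q `<=` A1.
    move=> oA1 oB1 AB1 SAB A1x; case: FS0 => a1 a2 a3 a4.
    suff FA : F (S0 `&` A1) by move=> u Qu; case: (Qu _ FA).
    have E : S0 `&` A1 = S0 `\` B1.
      apply/seteqP; split => u [S0u H]; split => //.
        by move=> B1u; have : (A1 `&` B1) u by []; rewrite AB1.
      by case: (SAB _ S0u).
    split => //.
    - by rewrite E setDE; apply: closedI => //; exact: open_closedC.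
    - by rewrite setDIr; apply: closedU => //; rewrite setDE; apply: closedI => //;
      exact: open_closedC.
    - by move=> u [/a3].
  have Qx : Q x by move=> S1 [].
  case: (pselect (S x)) => Sx.
    have := key A B oA oB AB S0AB (QA _ (conj Qx Sx)) z Qz.
    by have := QB _ (conj Qz nSz) => ? ?; have : (A `&` B) z by []; rewrite AB.
  have := key B A oB oA _ _ (QB _ (conj Qx Sx)) y Qy.
  rewrite setIC setUC => /(_ AB S0AB) By.
  by have := QA _ (conj Qy Sy) => ?; have : (A `&` B) y by []; rewrite AB.
have QO : Q `<=` O.
  apply: subset_trans KO => y Qy; apply: (@connected_component_max _ _ Q) => //.
    by move=> S [].
  by move=> u Qu; exact: Qu.
apply: contrapT => nex.
have [||u nu Fu] := @directed_closed F (~` O) F0 cF IF.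
- exact: open_closedC.
- move=> S [c1 c2 c3 c4]; apply: contrapT => H; apply: nex; exists S; split => //.
  by move=> u Su; split; [exact: c3|apply: contrapT => nO; apply: H; exists u].
by apply: nu; apply: QO.
Qed.

(** If the component stayed off [closure W], so would a clopen part of the difference of [N] and [W]
    around it; that part would be clopen in the connected set [N], which also meets [W]. *)
Lemma boundary_bumping N W w : closed N -> connected N -> open W -> N `&` W !=set0 ->
  N w -> ~ W w ->
  (connected_component (N `\` W) w `&` closure W : set T) !=set0.
Proof.
move=> cN conN oW [y [Ny Wy]] Nw nWw; apply: contrapT => H.
have cNW : closed (N `\` W) by rewrite setDE; apply: closedI => //; exact: open_closedC.
have [||||S [cS cKS SK Sw]] := @component_clopen (N `\` W) w (~` closure W) => //.
- exact/closed_openC/closed_closure.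
- by move=> u Cu cWu; apply: H; exists u.
have SN : N `<=` S.
  apply: (@connected_closed2 _ N S ((N `\` W `\` S) `|` closure W)) => //.
  - by apply: closedU => //; exact: closed_closure.
  - move=> u Nu; case: (pselect (W u)) => Wu; first by right; right; exact: subset_closure.
    by case: (pselect (S u)) => Su; [left|right; left].
  - apply/seteqP; split => // u [[Nu Su]] [[_ //]|]; by case: (SK _ Su).
  - by exists w.
by case: (SK _ (SN _ Ny)) => -[].
Qed.

End CompactHausdorff.

(** Along an ultrafilter the upper and lower limits of a family of sets coincide, so every family
    has this set as its limit. *)
Definition ulim (T : topologicalType) (I : Type) (U : set_system I) (H : I -> set T) : set T :=
  [set x | forall V, open V -> V x -> U [set i | H i `&` V !=set0]].

Section UltraLimits.
Variable T : topologicalType.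
Hypotheses (hT : hausdorff_space T) (cT : compact [set: T]).
Variables (I : Type) (U : set_system I).
Hypothesis uU : UltraFilter U.
Implicit Types (H : I -> set T) (A O : set T).

Lemma closed_ulim H : closed (ulim U H).
Proof.
rewrite -openC openE => x /existsNP [V] /not_implyP [oV] /not_implyP [Vx nU].
rewrite /interior nbhsE; exists V => //; by move=> y Vy /(_ V oV Vy).
Qed.

Lemma ulim_mem H (h : I -> T) (x : T) : h @ U --> x -> U [set i | H i (h i)] -> ulim U H x.
Proof.
move=> hx UH V oV Vx; apply: filterS (filterI UH (cvg_open hx oV Vx)) => i [] ? ?.
by exists (h i).
Qed.

Lemma ulim_closed H A : closed A -> U [set i | H i `<=` A] -> ulim U H `<=` A.
Proof.
move=> cA UA x Hx; apply: contrapT => nA.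
have := Hx _ (closed_openC cA) nA => /(filterI UA) /filter_ex [i [HA [y [Hy]]]].
by apply; apply: HA.
Qed.

Lemma ulim_subset H H' : U [set i | H i `<=` H' i] -> ulim U H `<=` ulim U H'.
Proof.
move=> UH x Hx V oV Vx; apply: filterS (filterI UH (Hx V oV Vx)) => i [] HH [y [Hy Vy]].
by exists y; split => //; apply: HH.
Qed.

(** Points of the [H i] outside [O] would converge, by compactness, to a point of the limit outside
    [O]. *)
Lemma ulim_open H O : open O -> ulim U H `<=` O -> U [set i | H i `<=` O].
Proof.
move=> oO HO; apply: contrapT => /(ultra_notP uU) UN.
have /choice [h hP] : forall i, exists x, ~ H i `<=` O -> (H i x /\ ~ O x).
  move=> i; case: (pselect (H i `<=` O)) => [|/existsNP [x] /not_implyP [Hx nO]].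
    by have /filter_ex [j /existsNP [x _]] := UN; exists x.
  by exists x.
have [x hx] := ultra_lim cT h uU.
have nO : (~` O) x.
  apply: (ultra_cvg_closed uU _ hx); first exact: open_closedC.
  by apply: filterS UN => i /hP [].
by apply: nO; apply: HO; apply: (ulim_mem hx); apply: filterS UN => i /hP [].
Qed.

Lemma ulim_connected H : U [set i | connected (H i)] -> connected (ulim U H).
Proof.
move=> Uc; apply: contrapT => /not_connected [S [ O [cS oO SO [x [Hx Sx]] [y [Hy nSy]]]]].
have cH := @closed_ulim H.
have QE : ulim U H `\` S = ulim U H `&` ~` O.
  apply/seteqP; split => u [Qu K]; split => // K1; apply: K.
    by have : (ulim U H `&` O) u by []; rewrite -SO => -[].
  by have : (ulim U H `&` S) u by []; rewrite SO => -[].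
have [|||A [B [oA oB QA QB AB]]] := @normal_sep _ hT cT (ulim U H `&` S) (ulim U H `\` S).
- exact: closedI.
- by rewrite QE; apply: closedI => //; exact: open_closedC.
- by rewrite setDE setIACA setICr setI0.
have UAB : U [set i | H i `<=` A `|` B].
  apply: ulim_open; first exact: openU.
  by move=> u Hu; case: (pselect (S u)) => Su; [left; apply: QA|right; apply: QB].
have UA := Hx _ oA (QA _ (conj Hx Sx)); have UB := Hy _ oB (QB _ (conj Hy nSy)).
have /(ultra_ex uU) [i [[ci iAB] [iA [z [Hz Bz]]]]] :=
  ultraI uU (ultraI uU Uc UAB) (ultraI uU UA UB).
have := @connected_open2 _ (H i) A B ci oA oB iAB _ iA z Hz.
rewrite -setIA AB setI0 => /(_ erefl) Az.
by have : (A `&` B) z by []; rewrite AB.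
Qed.

(** The index set is enlarged to [I * T], so that an index carries its point. The sets [B] generate
    a filter; the first projection of a finer ultrafilter contains [U], hence equals it by
    maximality. *)
Lemma ulim_select H (x : T) : ulim U H x ->
  exists (J : Type) (V : set_system J) (phi : J -> I) (w : J -> T),
    [/\ UltraFilter V, phi @ V = U, V [set j | H (phi j) (w j)] & w @ V --> x].
Proof.
move=> Hx; pose B (PO : set I * set T) :=
  [set iy : I * T | [/\ PO.1 iy.1, H iy.1 iy.2 & PO.2 iy.2]].
pose D := [set PO : set I * set T | [/\ U PO.1, open PO.2 & PO.2 x]].
have GP : ProperFilter (filter_from D B).
  apply: filter_from_proper.
    apply: filter_from_filter.
      by exists (setT, setT); split; [exact: filterT|exact: openT|].
    move=> [P O] [P' O'] [/= p1 p2 p3] [/= q1 q2 q3].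
    exists (P `&` P', O `&` O'); first by split; [exact: filterI|exact: openI|].
    by move=> [i y] [/= [? ?] ? [? ?]]; split; split.
  move=> [P O] [/= p1 p2 p3].
  have /filter_ex [i [Pi [y [Hy Oy]]]] :
    U (P `&` [set i | H i `&` O !=set0]) by apply: filterI p1 (Hx _ p2 p3).
  by exists (i, y).
have [V [uV GV]] := ultraFilterLemma GP.
exists (I * T)%type, V, fst, snd; split => //.
- apply: (max_filter (UltraFilter := uU)).
  move=> P UP; apply: GV; exists (P, setT) => [|[i y] []//].
  by split => //; exact: openT.
- apply: GV; exists (setT, setT) => [|[i y] []//].
  by split; [exact: filterT|exact: openT|].
- move=> O; rewrite nbhsE => - [ O' [oO' O'x] OO']; apply: GV.
  by exists (setT, O') => [|[i y] [] /= ? ? /OO' //]; split => //; exact: filterT.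
Qed.

End UltraLimits.

Lemma ulim_map (T : topologicalType) (I J : Type) (U : set_system I) (V : set_system J)
  (phi : J -> I) (H : I -> set T) : phi @ V = U -> ulim V (H \o phi) = ulim U H.
Proof. by move=> <-. Qed.

Section Shrink.
Variable T : topologicalType.
Hypotheses (hT : hausdorff_space T) (cT : compact [set: T]).

(* Passing to the components inside a neighbourhood of [d] keeps the limit from
   being absorbed by [d], by boundary bumping. *)
Lemma ulim_shrink (I : Type) (U : set_system I) (H : I -> set T) (w : I -> T) (z : T)
    (d A : set T) : UltraFilter U ->
  U [set i | [/\ closed (H i), connected (H i) & H i (w i)]] -> w @ U --> z -> d z ->
  ~ (ulim U H `<=` d) -> closed A -> d `<=` A° ->
  let H' i := connected_component (H i `&` A) (w i) in
  [/\ U [set i | H' i (w i)], ulim U H' z & ~ (ulim U H' `<=` d)].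
Proof.
move=> uU UH wz dz nd cA dA H'.
have Uw : U [set i | A° (w i)] by apply: (cvg_open wz); [exact: open_interior|exact: dA].
have UH' : U [set i | H' i (w i)].
  apply: filterS (filterI UH Uw) => i [[_ _ Hw] Aw]; apply: connected_component_refl.
  by split => //; exact: interior_subset.
split => //; first exact: (ulim_mem _ wz).
case: (ultra_dec uU [set i | H i `<=` A]) => UA.
  move=> H'd; apply: nd; apply: subset_trans H'd; apply: ulim_subset.
  apply: filterS (filterI UH UA) => i [[cH conH Hw] HA] y Hy.
  by rewrite /H' (connected_component_ext (A := H i)) // => u Hu; split => //; apply: HA.
(* Where [H i] leaves [A], bumping gives the component a point in the closure of the complement of
   [A]; a limit of such points is not interior to [A], hence not in [d]. *)
have /choice [h hP] : forall i, exists y, [/\ closed (H i), connected (H i) & H i (w i)] ->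
    A° (w i) -> ~ (H i `<=` A) -> H' i y /\ closure (~` A) y.
  move=> i; case: (pselect ([/\ closed (H i), connected (H i) & H i (w i)])) => [[c1 c2 c3]|?];
    last by exists z.
  case: (pselect (A° (w i))) => [c4|?]; last by exists z.
  case: (pselect (H i `<=` A)) => [?|/existsNP [y] /not_implyP [Hy nA]]; first by exists z.
  have [||||y' [Cy' By']] := @boundary_bumping T hT cT (H i) (~` A) (w i) c1 c2.
  - exact: closed_openC.
  - by exists y.
  - exact: c3.
  - by apply; exact: interior_subset.
  by exists y' => _ _ _; split => //; move: Cy'; rewrite /H' setDE setCK.
have Uh : U [set i | H' i (h i) /\ closure (~` A) (h i)].
  by apply: filterS (filterI UH (filterI Uw UA)) => i [a [b c]]; exact: hP.
have [y hy] := ultra_lim cT h uU.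
move=> H'd; have dy : d y by apply: H'd; apply: (ulim_mem _ hy); apply: filterS Uh => i [].
have : closure (~` A) y.
  by apply: (ultra_cvg_closed uU (@closed_closure _ _) hy); apply: filterS Uh => i [].
move: (dA _ dy); rewrite -{1}(setCK A) interiorC; exact.
Qed.
End Shrink.

(** * The Riemann sphere *)

Section SphereTopology.
Variable R : realType.
Local Open Scope ring_scope.
Local Open Scope complex_scope.
Local Notation Re := (@complex.Re R).
Local Notation Im := (@complex.Im R).

Lemma normc_Im (z : R[i]) : `|Im z|%:C <= `|z|.
Proof.
have <- : `|z * 'i%C| = `|z| by rewrite normrM complexiE normCi mulr1.
by rewrite -normrN -ReiNIm; exact: normc_ge_Re.
Qed.

Lemma normc_ReIm (z : R[i]) : `|z| <= (`|Re z| + `|Im z|)%:C.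
Proof.
rewrite {1}(complexE z) (le_trans (ler_normD _ _)) // normrM complexiE normCi mul1r.
rewrite !normc_def /= !expr0n /= !addr0 !sqrtr_sqr.
by rewrite -rmorphD.
Qed.

Lemma nbhs_CC (z : CC R) (P : set (CC R)) : nbhs z P <->
  exists2 e : R, 0 < e & forall w : R[i], `|Re w - Re z| < e -> `|Im w - Im z| < e -> P w.
Proof.
have ReB (w : R[i]) : Re (z - w) = Re z - Re w by case: (z) w => ? ? [].
have ImB (w : R[i]) : Im (z - w) = Im z - Im w by case: (z) w => ? ? [].
rewrite -nbhs_ballE; split => [[e /= e0 eP]|[e e0 eP]].
  (* The radius of a ball of [CC R] is an element of [R[i]]; positivity makes it real. *)
  have [k ke] : exists k : R, e = k%:C by apply/complex_realP; exact: gtr0_real.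
  move: e0; rewrite ke ltcR => k0.
  exists (k / 2); first by rewrite divr_gt0.
  move=> w h1 h2; apply: eP; rewrite -ball_normE /= ke.
  apply: (le_lt_trans (normc_ReIm _)); rewrite ltcR ReB ImB.
  by rewrite (distrC (Re z)) (distrC (Im z)) [ltRHS]splitr ltrD.
exists e%:C; first by rewrite /= ltcR.
move=> w; rewrite -ball_normE /= => zw.
apply: eP; rewrite distrC -?ReB -?ImB -ltcR; apply: le_lt_trans zw.
  exact: normc_ge_Re.
exact: normc_Im.
Qed.

Lemma hausdorff_CC : hausdorff_space (CC R).
Proof. exact: norm_hausdorff. Qed.

Lemma continuous_complex : continuous (fun xy : R * R => (xy.1 +i* xy.2 : CC R)).
Proof.
move=> [x y] P /nbhs_CC [e e0 eP].
exists (ball x e, ball y e) => /=; first by split; exact: nbhsx_ballx.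
move=> [x' y'] [/=]; rewrite -!ball_normE /= => xx' yy'; apply: eP => /=; by rewrite distrC.
Qed.

Lemma compact_CC_box (z : CC R) (e : R) :
  compact [set w : CC R | `|Re w - Re z| <= e /\ `|Im w - Im z| <= e].
Proof.
have -> : [set w : CC R | `|Re w - Re z| <= e /\ `|Im w - Im z| <= e] =
  (fun xy : R * R => (xy.1 +i* xy.2 : CC R)) @`
  (`[Re z - e, Re z + e] `*` `[Im z - e, Im z + e]).
  apply/seteqP; split => [[x y] /= [h1 h2]|w [[x y] [/= h1 h2] <-]] /=.
    by exists (x, y) => //; split; rewrite /= in_itv -ler_distl.
  by move: h1 h2; rewrite !in_itv /= -!ler_distl.
apply: continuous_compact; first exact/continuous_subspaceT/continuous_complex.
by apply: compact_setX; exact: segment_compact.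
Qed.

Lemma locally_compact_CC : locally_compact [set: CC R].
Proof.
move=> z _; rewrite withinET.
pose B : set (CC R) := [set w : CC R | `|Re w - Re z| <= 1 /\ `|Im w - Im z| <= 1].
have cB : compact B by exact: compact_CC_box.
exists B; last by split => //; apply: compact_closed => //; exact: hausdorff_CC.
by apply/nbhs_CC; exists 1 => // w h1 h2; split; apply: ltW.
Qed.

Lemma hausdorff_Chat : hausdorff_space (Chat R).
Proof.
apply: one_point_compactification_hausdorff; first exact: locally_compact_CC.
exact: hausdorff_CC.
Qed.

Lemma compact_Chat : compact [set: Chat R].
Proof. exact: one_point_compactification_compact. Qed.

Lemma nbhs_some (z : R[i]) (P : set (Chat R)) : nbhs (Some z : Chat R) P <->
  exists2 e : R, 0 < e &
    forall w : R[i], `|Re w - Re z| < e -> `|Im w - Im z| < e -> P (Some w).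
Proof. exact: (nbhs_CC z (Some @^-1` P)). Qed.

(** Compact sets of the plane are bounded: points of [B] with a coordinate beyond every [n] would
    have a limit along an ultrafilter finer than the cofinal one. *)
Lemma nbhs_none (P : set (Chat R)) : nbhs (None : Chat R) P <->
  P None /\ exists r : R, forall w : R[i], r < `|Re w| \/ r < `|Im w| -> P (Some w).
Proof.
split=> [[B [cB _] BP]|[PN [r rP]]].
  split; first by apply: BP; right.
  apply: contrapT => /forallNP nB.
  have /choice [h hP] : forall n : nat, exists w : CC R, B w /\
      (n%:R < `|Re w| \/ n%:R < `|Im w|).
    move=> n; have /existsNP [w /not_implyP [hw nP]] := nB n%:R.
    exists w; split => //; apply: contrapT => nBw.
    by apply: nP; apply: BP; left; exists w.
  have [U [uU ooU]] := ultraFilterLemma eventually_filter.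
  have [|z _ hz] := ultra_compact uU (h := h) cB.
    by apply: filterS filterT => n _; case: (hP n).
  pose m := (Num.truncn (`|Re z| + `|Im z| + 1)).+1.
  have Um : U [set n | (m <= n)%N] by apply: ooU; exists m.
  have Uz : U [set n | `|Re (h n) - Re z| < 1 /\ `|Im (h n) - Im z| < 1].
    have /hz : nbhs z [set w : CC R | `|Re w - Re z| < 1 /\ `|Im w - Im z| < 1].
      by apply/nbhs_CC; exists 1.
    exact.
  have [n [/= mn [h1 h2]]] := ultra_ex uU (ultraI uU Um Uz).
  have mz : `|Re z| + `|Im z| + 1 < m%:R by exact: truncnS_gt.
  have {}mz : `|Re z| + `|Im z| + 1 < n%:R by apply: (lt_le_trans mz); rewrite ler_nat.
  have a1 := ler_distD (Re z) (Re (h n)) 0; have a2 := ler_distD (Im z) (Im (h n)) 0.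
  move: a1 a2; rewrite !subr0 => a1 a2.
  have := normr_ge0 (Re z); have := normr_ge0 (Im z).
  by case: (hP n) => _ [?|?]; lra.
exists [set w : CC R | `|Re w - Re (0 : R[i])| <= r /\ `|Im w - Im (0 : R[i])| <= r].
  have cb := @compact_CC_box (0 : CC R) r.
  by split => //; apply: compact_closed => //; exact: hausdorff_CC.
move=> _ [[w /= nw <-]|->] //; apply: rP.
case: (ltP r `|Re w|) => h1; first by left.
case: (ltP r `|Im w|) => h2; first by right.
by case: nw; rewrite !subr0.
Qed.
End SphereTopology.

(** * Peano hyperspaces are nicely connected *)

Section MetricConnectedness.
Variables (R : realType) (X : Type) (S : set X) (dist : X -> X -> R).
Implicit Types (A B C U V : set X).

Lemma mconnectedP A : mconnected S dist A <-> A `<=` S /\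
  (forall U V, mopen S dist U -> mopen S dist V -> A `<=` U `|` V ->
     A `&` U `&` V = set0 -> A `&` U !=set0 -> A `<=` U).
Proof.
split=> [[AS nA]|[AS nA]]; split => //.
  move=> U V oU oV AUV dis AU x Ax; case: (AUV x Ax) => // Vx.
  by exfalso; apply: nA; exists U, V; split => //; exists x.
move=> [U [V [[oU oV] AU [x [Ax Vx]] AUV dis]]].
have Ux := nA _ _ oU oV AUV dis AU x Ax.
by have : (A `&` U `&` V) x by []; rewrite dis.
Qed.

Lemma mconnected_bigcup (F : set (set X)) x : (forall B, F B -> mconnected S dist B /\ B x) ->
  mconnected S dist (\bigcup_(B in F) B).
Proof.
move=> FB; apply/mconnectedP; split.
  by move=> y [B FBB By]; have [[BS _] _] := FB _ FBB; exact: BS.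
move=> U V oU oV AUV dis [y [[B FBB By] Uy]] z [C FC Cz].
have key E W W' : F E -> mopen S dist W -> mopen S dist W' -> E `<=` W `|` W' ->
  E `&` W `&` W' = set0 -> E `&` W !=set0 -> E `<=` W.
  by move=> FE; case: (FB _ FE) => /mconnectedP [_ H] _; exact: H.
have sub E : F E -> E `<=` U `|` V by move=> FE u Eu; apply: AUV; exists E.
have dis1 E : F E -> E `&` U `&` V = set0.
  move=> FE; apply/seteqP; split => // u [[Eu Uu] Vu].
  have : (\bigcup_(B in F) B `&` U `&` V) u by split => //; split => //; exists E.
  by rewrite dis.
have Ux : U x.
  by apply: (key B U V) => //; [exact: sub|exact: dis1|exists y|case: (FB _ FBB)].
by apply: (key C U V) => //; [exact: sub|exact: dis1|exists x; split => //; case: (FB _ FC)].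
Qed.

Lemma mcomponent_ex A : A !=set0 -> mconnected S dist A ->
  exists2 C, mcomponent S dist C & A `<=` C.
Proof.
move=> [x Ax] cA.
pose F := [set B | mconnected S dist B /\ B x].
have FA : F A by [].
exists (\bigcup_(B in F) B); last by move=> y Ay; exists A.
split; first by exists x, A.
  by apply: (@mconnected_bigcup F x) => B [].
move=> B cB sB; apply/seteqP; split => // y By; exists B => //; split => //.
by apply: sB; exists A.
Qed.

Lemma mconnectedU1 C d : S d -> mconnected S dist C ->
  (forall U, mopen S dist U -> U d -> C `&` U !=set0) -> mconnected S dist (C `|` [set d]).
Proof.
move=> Sd /mconnectedP [CS cC] lim; apply/mconnectedP; split.
  by move=> x [/CS //|->].
move=> U V oU oV sub dis [x [Cx Ux]].
have subC : C `<=` U `|` V by move=> y Cy; apply: sub; left.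
have disC W : W `<=` C `|` [set d] -> W `&` U `&` V = set0.
  move=> WC; apply/seteqP; split => // y [[Wy Uy] Vy].
  rewrite -dis; split => //; split => //; exact: WC.
have CU : C `&` U !=set0.
  by case: Cx => [Cx|xd]; [exists x|apply: lim => //; rewrite -xd].
have CsU : C `<=` U by apply: (cC U V) => //; apply: disC; exact: subsetUl.
move=> y [/CsU //|->]; case: (sub d); [by right|by []|] => Vd.
have [u [Cu Vu]] := lim V oV Vd.
have : (C `&` U `&` V) u by split => //; split => //; exact: CsU.
by rewrite disC //; exact: subsetUl.
Qed.

Lemma mconnectedU B B' : mconnected S dist B -> mconnected S dist B' ->
  B `&` B' !=set0 -> mconnected S dist (B `|` B').
Proof.
move=> cB cB' [x [Bx B'x]].
have -> : B `|` B' = \bigcup_(A in [set B; B']) A.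
  apply/seteqP; split => [y [?|?]|y [A [->|->]]].
  - by exists B => //; left.
  - by exists B' => //; right.
  - by left.
  - by right.
by apply: (@mconnected_bigcup _ x) => A [->|->].
Qed.

Lemma mcomponent_sub B E : mcomponent S dist B -> mconnected S dist E ->
  B `&` E !=set0 -> E `<=` B.
Proof.
move=> [_ cB mB] cE BE.
by rewrite -(mB _ (mconnectedU cB cE BE)) => ? ?; [right|left].
Qed.

Lemma mcomponent_eq B C E : mcomponent S dist B -> mcomponent S dist C -> mconnected S dist E ->
  B `&` E !=set0 -> C `&` E !=set0 -> B = C.
Proof.
move=> mB mC cE BE CE.
have EB := mcomponent_sub mB cE BE; have EC := mcomponent_sub mC cE CE.
have BC : B `&` C !=set0 by case: BE => x [Bx Ex]; exists x; split => //; exact: EC.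
have [_ cB _] := mB; have [_ cC _] := mC.
apply/seteqP; split; first by apply: (mcomponent_sub mC) => //; rewrite setIC.
exact: (mcomponent_sub mB).
Qed.

Lemma mopen_mball x r : metric_on S dist -> S x -> mopen S dist (mball S dist x r).
Proof.
move=> [_ _ _ tri] Sx; split=> [y []//|y [Sy xy]].
exists (r - dist x y)%R; first by rewrite subr_gt0.
move=> z [Sz yz]; split => //.
apply: le_lt_trans (tri _ _ _ Sx Sy Sz) _.
by rewrite -ltrBrDl.
Qed.
End MetricConnectedness.

Section Decomposition.
Variable R : realType.
Local Notation T := (Chat R).
Let hT := @hausdorff_Chat R.
Let cT := @compact_Chat R.
Implicit Types (K d O A N V : set T) (D W : set (set T)).

(* Connectedness im kleinen of the hyperspace along nondegenerate continua of
   convergence, phrased in the ambient space. *)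
Definition nicely_connected K D := forall (I : Type) (U : set_system I) (H : I -> set T)
    (z : T) d O, UltraFilter U -> (forall i, H i `<=` K) -> (forall i, connected (H i)) ->
  ulim U H z -> D d -> d z -> ~ (ulim U H `<=` d) -> open O -> d `<=` O ->
  exists N V, [/\ connected N, N `<=` K `&` O, N z, open V & V z] /\
    U [set i | H i `&` V `<=` N].

(** For [A] inside [K] this is the image of [A] under the quotient map. *)
Definition meeting D A : set (set T) := [set e | D e /\ e `&` A !=set0].

Section Monotone.
Variables (K : set T) (D : set (set T)).
Hypotheses (cK : compact K) (mD : monotone_decomposition K D).

Lemma mono_subset d : D d -> d `<=` K.
Proof. by case: mD => H _ _ _ /H []. Qed.

Lemma mono_closed d : D d -> closed d.
Proof. by case: mD => H _ _ _ /H [_ _ + _]; apply: cpt_closed. Qed.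

Lemma mono_connected d : D d -> connected d.
Proof. by case: mD => H _ _ _ /H []. Qed.

Lemma mono_nonempty d : D d -> d !=set0.
Proof. by case: mD => H _ _ _ /H []. Qed.

Lemma mono_cover (x : T) : K x -> exists2 d, D d & d x.
Proof. by case: mD => _ H _ _; exact: H. Qed.

Lemma mono_eq d d' (x : T) : D d -> D d' -> d x -> d' x -> d = d'.
Proof. by case: mD => _ _ H _ Dd Dd' dx d'x; apply: H => //; exists x. Qed.

Lemma mono_usc d O : D d -> open O -> d `<=` O -> exists V, [/\ open V, d `<=` V &
  forall e, D e -> e `&` V !=set0 -> e `<=` O].
Proof. by case: mD => _ _ _; exact. Qed.

(** Upper semicontinuity says that lying in the same element is a closed relation: elements passing
    close to [d] stay in a neighbourhood of [d] that can be chosen away from [y]. *)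
Lemma mono_limit (I : Type) (U : set_system I) (a b : I -> T) (x y : T) d :
  UltraFilter U -> U [set i | exists2 e, D e & e (a i) /\ e (b i)] ->
  a @ U --> x -> b @ U --> y -> D d -> d x -> d y.
Proof.
move=> uU Uab ax bx Dd dx; apply: contrapT => ndy.
have cy : closed [set y] by exact: accessible_closed_set1 (hausdorff_accessible hT) y.
have [|O [ O' [oO oO' dO yO' OO']]] := normal_sep hT cT (mono_closed Dd) cy.
  by apply/seteqP; split => // u [du uy]; case: ndy; rewrite -uy.
have [V [oV dV VO]] := mono_usc Dd oO dO.
have Ua := cvg_open ax oV (dV _ dx).
have Ub := cvg_open bx oO' (yO' y erefl).
have [i [[e De [ea eb]] [Va Ob]]] := ultra_ex uU (ultraI uU Uab (ultraI uU Ua Ub)).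
have eO : e `<=` O by apply: VO => //; exists (a i).
by rewrite -[False]/(set0 (b i)) -OO'; split => //; exact: eO.
Qed.

Lemma hyper_open_subset O : open O -> hyper_open K D [set d | D d /\ d `<=` O].
Proof.
move=> oO; split; first by move=> d [].
exists (\bigcup_(V in [set V | open V /\ forall e, D e -> e `&` V !=set0 -> e `<=` O]) V).
split; first by apply: bigcup_open => V [].
apply/seteqP; split => [x [d [Dd dO] dx]|x [[V [oV VO] Vx] Kx]].
  split; last exact: mono_subset Dd _ dx.
  by have [V [oV dV VO]] := mono_usc Dd oO dO; exists V => //; exact: dV.
have [d Dd dx] := mono_cover Kx; exists d => //; split => //.
by apply: VO => //; exists x.
Qed.

Section WithMetric.
Variable dist : set T -> set T -> R.
Hypothesis hopen : forall W, hyper_open K D W <-> mopen D dist W.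

Lemma mopen_trace W : mopen D dist W -> exists2 V, open V & \bigcup_(d in W) d = V `&` K.
Proof. by move=> /hopen [_ [V [oV VE]]]; exists V. Qed.

Lemma mopen_mem W V d (x : T) : W `<=` D -> \bigcup_(d in W) d = V `&` K -> D d -> d x -> V x ->
  W d.
Proof.
move=> WD WV Dd dx Vx.
have : (V `&` K) x by split => //; exact: mono_subset Dd _ dx.
by rewrite -WV => -[e We ex]; rewrite (mono_eq Dd (WD _ We) dx ex).
Qed.

Lemma mconnected_meeting A : A `<=` K -> connected A -> mconnected D dist (meeting D A).
Proof.
move=> AK cA; apply/mconnectedP; split; first by move=> e [].
move=> U V oU oV sub dis [e [[De [x [ex Ax]]] Ue]] e' [De' [x' [ex' Ax']]].
have [U' oU' UE] := mopen_trace oU; have [V' oV' VE] := mopen_trace oV.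
have UD : U `<=` D by case: oU.
have VD : V `<=` D by case: oV.
have U'x' : U' x'.
  apply: (@connected_open2 _ A U' V' cA oU' oV') => //.
  - move=> y Ay; have [g Dg gy] := mono_cover (AK _ Ay).
    case: (sub g) => [|Ug|Vg]; first by split => //; exists y.
      by left; have [] : (U' `&` K) y by rewrite -UE; exists g.
    by right; have [] : (V' `&` K) y by rewrite -VE; exists g.
  - apply/seteqP; split => // y [[Ay U'y] V'y].
    have [g Dg gy] := mono_cover (AK _ Ay).
    suff : (meeting D A `&` U `&` V) g by rewrite dis.
    split; last exact: mopen_mem VE Dg gy V'y.
    by split; [split => //; exists y|exact: mopen_mem UE Dg gy U'y].
  - by exists x; split => //; have [] : (U' `&` K) x by rewrite -UE; exists e.
exact: mopen_mem UE De' ex' U'x'.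
Qed.

(** The elements being connected, a separation of their union cuts none of them; it is therefore
    induced by a separation of [W], whose two parts are open by [hyper_open_subset]. *)
Lemma connected_mconnected W : mconnected D dist W -> connected (\bigcup_(d in W) d).
Proof.
move=> /mconnectedP [WD cW]; apply: contrapT.
move=> /not_connected [S [ O [cS oO SO [x [[d Wd dx] Sx]] [y [[e We ey] nSy]]]]].
set N := \bigcup_(d in W) d in SO.
have dN g : W g -> g `<=` N by move=> Wg u gu; exists g.
have alt g : W g -> g `<=` O \/ g `<=` ~` S.
  move=> Wg; case: (pselect (g `&` O !=set0)) => [g0|].
    left; apply: (@connected_open2 _ g O (~` S)) => //.
    - exact: mono_connected (WD _ Wg).
    - exact: closed_openC.
    - move=> u gu; case: (pselect (S u)) => Su; last by right.
      by left; have [] : (N `&` O) u by rewrite -SO; split => //; exact: dN gu.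
    - apply/seteqP; split => // u [[gu Ou]]; apply.
      by have [] : (N `&` S) u by rewrite SO; split => //; exact: dN gu.
  move=> g0; right => u gu Su; apply: g0; exists u; split => //.
  by have [] : (N `&` O) u by rewrite -SO; split => //; exact: dN gu.
have o1 := (hopen _).1 (hyper_open_subset oO).
have o2 := (hopen _).1 (hyper_open_subset (closed_openC cS)).
have := cW _ _ o1 o2 _ _ _ e We; case.
- by move=> g Wg; case: (alt g Wg) => ?; [left|right]; split => //; exact: WD.
- apply/seteqP; split => // g [[Wg [Dg gO]] [_ gS]].
  have [u gu] := mono_nonempty Dg.
  by apply: (gS u gu); have [] : (N `&` S) u by rewrite SO; split; [exact: dN gu|exact: gO].
- exists d; split => //; split; first exact: WD.
  by case: (alt d Wd) => // /(_ x dx).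
- move=> _ eO; apply: nSy.
  by have [] : (N `&` S) y by rewrite SO; split; [exact: dN ey|exact: eO].
Qed.

(** The limit meets [d] and a second element [d'], so the images of almost all [H i] have diameter
    bounded below and, by finiteness, lie in one component [E0] of the hyperspace. [E0] contains its
    limit point [d] and is locally connected there; a connected neighbourhood of [d] in [E0] unfolds
    to the connected set [N]. *)
Lemma peano_nicely_connected : metric_on D dist -> peano_metric D dist -> nicely_connected K D.
Proof.
move=> metD [_ _ lcD finD] I U H z d O uU HK cH Hz Dd dz nHd oO dO.
have clK : closed K by exact: cpt_closed.
have [z' /not_implyP [Hz' ndz']] : exists x, ~ (ulim U H x -> d x) by apply/existsNP.
have Kz' : K z' by apply: (ulim_closed uU clK _ Hz'); apply: filterS filterT => i _; exact: HK.
have [d' Dd' dz'] := mono_cover Kz'.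
have [m1 m2 m3 m4] := metD.
pose r := dist d d'.
have r0 : (0 < r)%R.
  rewrite lt0r m1 // andbT; apply/eqP => /(m2 _ _ Dd Dd').1 dd'.
  by apply: ndz'; rewrite dd'.
have r3 : (0 < r / 3)%R by rewrite divr_gt0.
have dd0 e : D e -> dist e e = 0%R by move=> De; apply/m2.
have ball_near g (y : T) : D g -> g y -> ulim U H y ->
    U [set i | exists2 e, meeting D (H i) e & (dist g e < r / 3)%R].
  move=> Dg gy Hy; have [V oV VE] := mopen_trace (mopen_mball (r / 3) metD Dg).
  have [Vy _] : (V `&` K) y.
    by rewrite -VE; exists g => //; split => //; rewrite dd0.
  apply: filterS (Hy V oV Vy) => i [u [Hu Vu]].
  have Ku := HK _ _ Hu.
  have : (V `&` K) u by [].
  by rewrite -VE => -[e [De ge] eu]; exists e => //; split => //; exists u.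
have near2 := ultraI uU (ball_near _ _ Dd dz Hz) (ball_near _ _ Dd' dz' Hz').
(* Elements within [r / 3] of [d] and of [d'] respectively are more than [r / 3] apart. *)
pose good E := [/\ mcomponent D dist E, Defs.nondegenerate E & diam_gt dist E (r / 3)].
have /choice [E EP] : forall i, exists E, (exists2 e, meeting D (H i) e & (dist d e < r / 3)%R) ->
    (exists2 e, meeting D (H i) e & (dist d' e < r / 3)%R) -> good E /\ meeting D (H i) `<=` E.
  move=> i; case: (pselect (exists2 e, meeting D (H i) e & (dist d e < r / 3)%R)) => [[e Me de]|?];
    last by exists set0.
  case: (pselect (exists2 e, meeting D (H i) e & (dist d' e < r / 3)%R)) => [[e' Me' de']|?];
    last by exists set0.
  have [|C compC MC] := @mcomponent_ex R _ D dist (meeting D (H i)) _ (mconnected_meeting (HK i)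
    (cH i)).
    by exists e.
  exists C => _ _; split => //.
  have De : D e by case: Me.
  have De' : D e' by case: Me'.
  have ee' : (r / 3 < dist e e')%R.
    have t1 := m4 _ _ _ Dd De Dd'; have t2 := m4 _ _ _ De De' Dd'.
    by move: de' t1 t2; rewrite (m3 d') // -/r; lra.
  split => //; exists e, e'; split; try exact: MC; last exact: ee'.
  by move=> eqe; move: ee'; rewrite eqe dd0 //; lra.
have [E0 [comp0 nd0 _] UE] : exists2 E0, good E0 & U [set i | E i = E0].
  apply: (@ultra_finite _ _ uU _ [set E | good E] E); first exact: finD.
  by apply: filterS near2 => i [/= h1 h2]; case: (EP i h1 h2).
have ME : U [set i | meeting D (H i) `<=` E0].
  by apply: filterS (ultraI uU near2 UE) => i [[h1 h2] /= <-]; case: (EP i h1 h2).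
have E0d : E0 d.
  have [c1 c2 c3] := comp0.
  have <- : E0 `|` [set d] = E0; last by right.
  apply: c3 => //; apply: mconnectedU1 => // W oW Wd.
  have [V oV VE] := mopen_trace oW.
  have [Vz _] : (V `&` K) z by rewrite -VE; exists d.
  have [i [MEi [u [Hu Vu]]]] := ultra_ex uU (ultraI uU ME (Hz V oV Vz)).
  have : (V `&` K) u by split => //; exact: HK Hu.
  rewrite -VE => -[e We eu]; exists e; split => //; apply: MEi.
  by split; [case: oW => WD _; exact: WD|exists u].
have oOD := (hopen _).1 (hyper_open_subset oO).
have [||V1 [[U1 [oU1 V1E]] V1d V1U cV1]] :=
    lcD _ comp0 nd0 d ([set e | D e /\ e `<=` O] `&` E0) E0d.
- by exists [set e | D e /\ e `<=` O]; split; first exact: oOD.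
- by split.
move: V1d V1U cV1; rewrite V1E => -[U1d _] V1U cV1.
have [V2 oV2 VE2] := mopen_trace oU1.
exists (\bigcup_(e in U1 `&` E0) e), V2; split.
  split => //.
  - exact: connected_mconnected.
  - move=> u [e eU eu]; have [[De eO] _] := V1U _ eU.
    by split; [exact: mono_subset De _ eu|exact: eO].
  - by exists d.
  - by have [] : (V2 `&` K) z by rewrite -VE2; exists d.
apply: filterS ME => i ME u [Hu Vu].
have : (V2 `&` K) u by split => //; exact: HK Hu.
rewrite -VE2 => -[e Ue eu]; exists e => //; split => //; apply: ME.
by split; [case: oU1 => UD _; exact: UD|exists u].
Qed.
End WithMetric.
End Monotone.
End Decomposition.

(** * Nicely connected decompositions have Peano hyperspaces *)

Section NicelyConnectedPeano.
Variable R : realType.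
Local Notation T := (Chat R).
Let hT := @hausdorff_Chat R.
Let cT := @compact_Chat R.
Variables (K : set T) (D : set (set T)) (dist : set T -> set T -> R).
Hypotheses (cK : compact K) (mD : monotone_decomposition K D).
Hypotheses (hopen : forall W, hyper_open K D W <-> mopen D dist W).
Hypotheses (metD : metric_on D dist) (nc : nicely_connected K D).

Lemma dist_self d : D d -> dist d d = 0%R.
Proof. by case: metD => _ m2 _ _ Dd; apply/m2. Qed.

Lemma dist_near (I : Type) (U : set_system I) (w : I -> T) (e : I -> set T) z d (c : R) :
  UltraFilter U -> w @ U --> z -> D d -> d z -> U [set i | D (e i) /\ e i (w i)] ->
  (0 < c)%R -> U [set i | (dist d (e i) < c)%R].
Proof.
move=> uU wz Dd dz Ue c0; have [V oV VE] := mopen_trace hopen (mopen_mball c metD Dd).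
have [Vz _] : (V `&` K) z by rewrite -VE; exists d => //; split => //; rewrite dist_self.
apply: filterS (ultraI uU Ue (cvg_open wz oV Vz)) => i [[De ew] Vw].
have : mball D dist d c (e i) by apply: (mopen_mem mD _ VE De ew Vw) => g [].
by case.
Qed.

Lemma hyper_mcompact : mcompact D dist.
Proof.
move=> UU oUU cov.
have /choice [V VP] : forall W, exists V : set T, UU W -> open V /\ \bigcup_(d in W) d = V `&` K.
  move=> W; case: (pselect (UU W)) => [/oUU/(mopen_trace hopen) [V oV VE]|?]; last by exists set0.
  by exists V.
have cov' : K `<=` \bigcup_(W in UU) V W.
  move=> x Kx; have [d Dd dx] := mono_cover mD Kx; have [W UW Wd] := cov d Dd.
  exists W => //; have [] : (V W `&` K) x => //.
  by rewrite -(VP _ UW).2; exists d.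
have := cK; rewrite compact_cover => /(_ _ UU V) [W UW|//|F FU KF].
  by have [] := VP _ UW.
exists [set` F].
  by split; [exact: finite_fset|move=> W FW; exact/set_mem/FU].
move=> d Dd; have [x dx] := mono_nonempty mD Dd.
have [W FW Vx] := KF x (mono_subset mD Dd dx).
have UW : UU W by exact/set_mem/FU.
exists W => //; apply: (mopen_mem mD _ (VP _ UW).2 Dd dx Vx).
by case: (oUU _ UW).
Qed.

(** Infinitely many large components carry an ultrafilter finer than the cofinite filter [G]. The
    unions of their elements have a limit meeting two elements, so [nc] yields one connected set [N]
    that meets the unions of two different components, and its image joins these. *)
Lemma hyper_finite (c : R) : (0 < c)%R ->
  finite_set [set C | [/\ mcomponent D dist C, Defs.nondegenerate C & diam_gt dist C c]].
Proof.
move=> c0; set S := [set C | _]; apply: contrapT => infS.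
pose G : set_system (set (set T)) := [set A | finite_set (S `\` A)].
have GP : ProperFilter G.
  split; first by rewrite /G /= setD0.
  split.
  - by rewrite /G /= setDT; exact: finite_set0.
  - by move=> A B GA GB; rewrite /G /= setDIr finite_setU.
  - move=> A B AB; apply: sub_finite_set => C [SC nB]; split => // AC; apply: nB; exact: AB.
have [U [uU GU]] := ultraFilterLemma GP.
have US : U S by apply: GU; rewrite /G /= setDv; exact: finite_set0.
have Uneq C : U [set C' | C' <> C].
  apply: GU; apply: (@sub_finite_set _ _ [set C]); last exact: finite_set1.
  by move=> C' [_] /= /contrapT.
have /choice [p pP] : forall C, exists p : (set T * set T) * (T * T), S C ->
    [/\ C p.1.1, C p.1.2, (c < dist p.1.1 p.1.2)%R, p.1.1 p.2.1 & p.1.2 p.2.2].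
  move=> C; case: (pselect (S C)) => [SC|?]; last by exists ((set0, set0), (None, None)).
  have [[_ [CD _] _] _ [e [e' [Ce Ce' cd]]]] := SC.
  have [w ew] := mono_nonempty mD (CD _ Ce); have [w' ew'] := mono_nonempty mD (CD _ Ce').
  by exists ((e, e'), (w, w')).
have SD C : S C -> C `<=` D by move=> [[_ []]].
have [z wz] := ultra_lim cT (fun C => (p C).2.1) uU.
have [z' wz'] := ultra_lim cT (fun C => (p C).2.2) uU.
have UK : U [set C | K (p C).2.1 /\ K (p C).2.2].
  apply: filterS US => C SC; have [h1 h2 h3 h4 h5] := pP C SC.
  by split; [apply: (mono_subset mD (SD C SC _ h1))|apply: (mono_subset mD (SD C SC _ h2))].
have clK : closed K by exact: cpt_closed.
have [d Dd dz] : exists2 d, D d & d z.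
  apply: (mono_cover mD); apply: (ultra_cvg_closed uU clK wz).
  by apply: filterS UK => C [].
have [d' Dd' dz'] : exists2 d, D d & d z'.
  apply: (mono_cover mD); apply: (ultra_cvg_closed uU clK wz').
  by apply: filterS UK => C [].
have c2 : (0 < c / 2)%R by rewrite divr_gt0.
have dd' : d <> d'.
  move=> E; rewrite -{}E in Dd' dz'.
  have n1 : U [set C | (dist d (p C).1.1 < c / 2)%R].
    apply: (dist_near uU wz) => //; apply: filterS US => C SC; have [h1 _ _ h4 _] := pP C SC.
    by split => //; exact: SD h1.
  have n2 : U [set C | (dist d (p C).1.2 < c / 2)%R].
    apply: (dist_near uU wz') => //; apply: filterS US => C SC; have [_ h2 _ _ h5] := pP C SC.
    by split => //; exact: SD h2.
  have [C [SC [/= l1 l2]]] := ultra_ex uU (ultraI uU US (ultraI uU n1 n2)).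
  have [h1 h2 h3 _ _] := pP C SC; have [_ _ sy tri] := metD.
  have := tri _ _ _ (SD C SC _ h1) Dd (SD C SC _ h2).
  by rewrite (sy _ d (SD C SC _ h1)) //; lra.
pose H C := \bigcup_(e in [set e | S C /\ C e]) e.
have HS C : S C -> H C = \bigcup_(e in C) e.
  by move=> SC; apply/seteqP; split => x [e]; [move=> [_ Ce]; exists e|move=> Ce; exists e].
have cH C : connected (H C).
  case: (pselect (S C)) => SC.
    by rewrite HS //; apply: (connected_mconnected mD hopen); case: SC => -[].
  rewrite (_ : H C = set0); first exact: connected0.
  by apply/seteqP; split => // x [e [/SC]].
have HK C : H C `<=` K.
  by move=> x [e [SC Ce] ex]; apply: (mono_subset mD (SD C SC _ Ce) ex).
have Hz : ulim U H z.
  apply: (ulim_mem uU wz); apply: filterS US => C SC; have [h1 _ _ h4 _] := pP C SC.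
  by exists (p C).1.1.
have Hz' : ulim U H z'.
  apply: (ulim_mem uU wz'); apply: filterS US => C SC; have [_ h2 _ _ h5] := pP C SC.
  by exists (p C).1.2.
have nHd : ~ (ulim U H `<=` d).
  by move=> /(_ _ Hz') dz1; apply: dd'; apply: (mono_eq mD Dd Dd' dz1).
have [N [V [[cN NK Nz oV Vz] UN]]] := nc uU HK cH Hz Dd dz nHd (@openT _) (@subsetT _ _).
have Uw : U [set C | S C /\ N (p C).2.1].
  apply: filterS (ultraI uU US (ultraI uU UN (cvg_open wz oV Vz))) => C [SC [HN Vw]].
  split => //; apply: HN; split => //; have [h1 _ _ h4 _] := pP C SC.
  by exists (p C).1.1.
have [C1 [S1 N1]] := ultra_ex uU Uw.
have [C2 [[S2 N2] ]] := ultra_ex uU (ultraI uU Uw (Uneq C1)).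
apply; have NK1 : N `<=` K by move=> x /NK [].
have meet C : S C -> N (p C).2.1 -> C `&` meeting D N !=set0.
  move=> SC NC; have [h1 _ _ h4 _] := pP C SC; exists (p C).1.1; split => //.
  by split; [exact: SD h1|exists (p C).2.1].
have [m1 _ _] := S1; have [m2 _ _] := S2.
apply: (mcomponent_eq m2 m1 (mconnected_meeting mD hopen NK1 cN)); exact: meet.
Qed.

(** Here [nc] is applied to a constant family, the union [H] of the component [C], along a principal
    ultrafilter; nondegeneracy keeps [H] out of a single element. The neighbourhood [V] is the
    component of [x] in the given open set, and the work is to see that it is open. *)
Lemma hyper_locally_connected C : mcomponent D dist C -> Defs.nondegenerate C ->
  mlocally_connected D dist C.
Proof.
move=> mC [c1 [c2 [Cc1 Cc2 c12]]] x U Cx [U0 [oU0 ->]] [U0x _].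
have [_ cC _] := mC; have CD : C `<=` D by case: cC.
pose F := [set B | [/\ mconnected D dist B, B `<=` U0 `&` C & B x]].
pose V := \bigcup_(B in F) B.
have Vsub : V `<=` U0 `&` C by move=> y [B [_ BU _] By]; exact: BU.
have U0D : U0 `<=` D by case: oU0.
have cV : mconnected D dist V by apply: (@mconnected_bigcup _ _ _ _ F x) => B [].
have [V0 oV0 VE] := mopen_trace hopen oU0.
have D1 : mconnected D dist [set x].
  apply/mconnectedP; split => [y ->|A B _ _ _ _ [y [-> Ax]] z ->] //.
  exact: CD.
have Vx : V x by exists [set x] => //; split => // y ->.
exists V; split => //.
have nbh v : V v -> exists2 W, mopen D dist W & W v /\ W `&` C `<=` V.
  move=> Vv; have [U0v Cv] := Vsub v Vv; have Dv := CD _ Cv.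
  have vV0 : v `<=` V0 by move=> z vz; have [] : (V0 `&` K) z by rewrite -VE; exists v.
  pose H := \bigcup_(e in C) e.
  have cH : connected H by apply: (connected_mconnected mD hopen).
  have HK : H `<=` K by move=> z [e Ce ez]; apply: (mono_subset mD (CD _ Ce) ez).
  have uP := @principal_filter_ultra unit tt.
  have sub : H `<=` ulim (principal_filter tt) (fun _ : unit => H).
    by move=> z Hz O oO Oz; apply/principal_filterP; exists z.
  have nsub : ~ (ulim (principal_filter tt) (fun _ : unit => H) `<=` v).
    move=> Hv; have [c Cc cv] : exists2 c, C c & c <> v.
      by case: (pselect (c1 = v)) => [c1v|?]; [exists c2 => // c2v; apply: c12;
        rewrite c1v|exists c1].
    have [y cy] := mono_nonempty mD (CD _ Cc).
    apply: cv; apply: (mono_eq mD (CD _ Cc) Dv cy); apply: Hv; apply: sub.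
    by exists c.
  (* One application of [nc] per point of [v]: the open sets obtained cover [v], and every element
     of [C] inside their union is joined to [v] by the image of one of the connected sets. *)
  have /choice [p pP] : forall z, exists NV : set T * set T, v z ->
      [/\ connected NV.1, NV.1 `<=` K `&` V0, NV.1 z, open NV.2 & NV.2 z] /\ H `&` NV.2 `<=` NV.1.
    move=> z; case: (pselect (v z)) => [vz|?]; last by exists (set0, set0).
    have [|N [V' [P1 P2]]] := nc uP (fun=> HK) (fun=> cH) _ Dv vz nsub oV0 vV0.
      by apply: sub; exists v.
    by exists (N, V') => _; split => //; move/principal_filterP: P2.
  pose O := \bigcup_(z in v) (p z).2.
  have oO : open O by apply: bigcup_open => z /pP [[]].
  have vO : v `<=` O by move=> z vz; exists z => //; case: (pP z vz) => -[].
  exists [set e | D e /\ e `<=` O]; first exact/hopen/(hyper_open_subset mD).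
  split => // e [[De eO] Ce].
  have [y ey] := mono_nonempty mD De; have [z vz Vzy] := eO _ ey.
  have [[cN NK Nz _ _] HN] := pP z vz.
  have Ny : (p z).1 y by apply: HN; split => //; exists e.
  have NK1 : (p z).1 `<=` K by move=> u /NK [].
  have cB := mconnected_meeting mD hopen NK1 cN.
  set B := meeting D (p z).1 in cB.
  have Bv : B v by split => //; exists z.
  have BC : B `<=` C by apply: (mcomponent_sub mC cB); exists v.
  have BU : B `<=` U0.
    by move=> g [Dg [u [gu Nu]]]; apply: (mopen_mem mD U0D VE Dg gu); case: (NK u Nu).
  exists (V `|` B); last by right; split => //; exists y.
  split; [|by move=> g [/Vsub //|Bg]; split; [exact: BU|exact: BC]|by left].
  by apply: mconnectedU => //; exists v.
exists (\bigcup_(W in [set W | mopen D dist W /\ W `&` C `<=` V]) W); split.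
  split; first by move=> g [W [[WD _] _] Wg]; exact: WD.
  move=> g [W [oW WC] Wg]; have [r r0 rW] := oW.2 g Wg; exists r => // u /rW Wu.
  by exists W.
apply/seteqP; split => [v Vv|v [[W [_ WV] Wv] Cv]]; last exact: WV.
have [W oW [Wv WC]] := nbh v Vv; split; last by case: (Vsub v Vv).
by exists W.
Qed.

Lemma nicely_connected_peano : peano_metric D dist.
Proof.
split; [exact: hyper_mcompact| |exact: hyper_locally_connected|exact: hyper_finite].
(* A nondegenerate component has positive diameter, hence is counted at some scale [1 / (n + 1)]. *)
pose F n := [set C | [/\ mcomponent D dist C, Defs.nondegenerate C & diam_gt dist C
  (n.+1%:R^-1)%R]].
apply: (@sub_countable _ _ _ (\bigcup_n F n)); last first.
  apply: bigcup_countable => // n _; apply: finite_set_countable; apply: hyper_finite.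
  by rewrite invr_gt0.
apply: subset_card_le => C [mC [x [y [Cx Cy xy]]]].
have [_ [CD _] _] := mC; have [m1 m2 m3 m4] := metD.
have dxy : (0 < dist x y)%R.
  by rewrite lt0r m1 ?andbT; [|exact: CD|exact: CD]; apply/eqP => /m2; auto.
exists (Num.truncn (dist x y)^-1) => //; split => //; first by exists x, y.
exists x, y; split => //; rewrite invf_plt ?posrE //; exact: truncnS_gt.
Qed.
End NicelyConnectedPeano.

(** * Components of the classes of a closed equivalence relation *)

Section ClosedRelation.
Variable R : realType.
Local Notation T := (Chat R).
Let hT := @hausdorff_Chat R.
Let cT := @compact_Chat R.

Lemma ultra_closed (A : set T) :
  (forall (U : set_system T) x, UltraFilter U -> U A -> U --> x -> A x) -> closed A.
Proof.
move=> HA x clx; have PF := within_nbhs_proper clx.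
have [U [uU sU]] := ultraFilterLemma PF.
apply: (HA U x uU); first by apply: sU; exact: withinT.
by move=> V nV; apply: sU; apply: filterS nV => y Vy _.
Qed.

Variables (K : set T) (e : T -> T -> Prop).
Hypotheses (cK : compact K) (e_refl : forall x, K x -> e x x)
  (e_sym : forall x y, K x -> K y -> e x y -> e y x)
  (e_trans : forall x y z, K x -> K y -> K z -> e x y -> e y z -> e x z).
Hypothesis eclosed : forall (I : Type) (U : set_system I) (a b : I -> T) (x y : T),
  UltraFilter U -> U [set i | [/\ K (a i), K (b i) & e (a i) (b i)]] ->
  a @ U --> x -> b @ U --> y -> e x y.

Definition fiber_component (x : T) : set T :=
  connected_component [set y | K y /\ e x y] x.

Lemma fiber_component_refl x : K x -> fiber_component x x.
Proof. by move=> Kx; apply: connected_component_refl; split => //; exact: e_refl. Qed.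

Lemma fiber_component_eq x y : K x -> fiber_component x y -> fiber_component y = fiber_component x.
Proof.
move=> Kx xy; have [Ky exy] := connected_component_sub xy.
have E : [set z | K z /\ e y z] = [set z | K z /\ e x z].
  apply/seteqP; split => z [Kz ez]; split => //.
    exact: (e_trans Kx Ky).
  by apply: (e_trans Ky Kx) => //; exact: e_sym.
rewrite /fiber_component E; apply/esym; exact: same_connected_component.
Qed.

Lemma closed_fiber_component x : K x -> closed (fiber_component x).
Proof.
move=> Kx; apply: component_closed; apply: ultra_closed => U y uU UA Uy.
have clK : closed K by exact: cpt_closed.
split; first by apply: (ultra_cvg_closed uU (h := id) clK) => //; apply: filterS UA => z [].
apply: (eclosed uU (a := fun=> x) (b := id)) => //; last exact: cvg_cst.
by apply: filterS UA => z [Kz ez].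
Qed.

(** Upper semicontinuity is the point. If components not inside [O] accumulated at [y], their limit
    would be connected, contain [y], and lie in the class of [y] because the relation is closed; so
    it would lie in the component of [y], hence in [O], although it has a point outside [O]. *)
Lemma component_decomposition :
  monotone_decomposition K [set c | exists2 x, K x & c = fiber_component x].
Proof.
have clK : closed K by exact: cpt_closed.
split.
- move=> _ [x Kx ->]; split.
  + by exists x; exact: fiber_component_refl.
  + by move=> y /connected_component_sub [].
  + by apply: (closed_cpt cT); exact: closed_fiber_component.
  + exact: component_connected.
- by move=> x Kx; exists (fiber_component x); [exists x|exact: fiber_component_refl].
- move=> _ _ [x Kx ->] [y Ky ->] [z [xz yz]].
  by rewrite -(fiber_component_eq Kx xz) (fiber_component_eq Ky yz).
move=> _ O [x Kx ->] oO xO.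
pose Bad := [set y | K y /\ ~ (fiber_component y `<=` O)].
exists (~` closure Bad); split.
- exact/closed_openC/closed_closure.
- move=> y xy clB; have PF := within_nbhs_proper clB.
  have [U [uU sU]] := ultraFilterLemma PF.
  have UB : U Bad by apply: sU; exact: withinT.
  have Uy : id @ U --> y by move=> V nV; apply: sU; apply: filterS nV => u Vu _.
  have Ky : K y by have [] := connected_component_sub xy.
  have /choice [h hP] : forall b, exists v : T, Bad b -> fiber_component b v /\ ~ O v.
    move=> b; case: (pselect (Bad b)) => [[_ /existsNP [v /not_implyP []]]|?]; last by exists b.
    by exists v.
  have [u hu] := ultra_lim cT h uU.
  pose Q := ulim U fiber_component.
  have Qu : Q u by apply: (ulim_mem uU hu); apply: filterS UB => b /hP [].
  have Qy : Q y.
    by apply: (ulim_mem uU Uy); apply: filterS UB => b [Kb _]; exact: fiber_component_refl.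
  have cQ : connected Q.
    by apply: (ulim_connected hT cT uU); apply: filterS filterT => b _; exact: component_connected.
  have Qcl : Q `<=` [set z | K z /\ e y z].
    move=> v /(ulim_select uU) [J [V [phi [w [uV phiV Vw wv]]]]].
    have VB : V [set j | Bad (phi j)] by move: UB; rewrite -phiV.
    have phiy : phi @ V --> y by rewrite phiV.
    have Vw2 : V [set j | [/\ K (phi j), K (w j) & e (phi j) (w j)]].
      apply: filterS (ultraI uV Vw VB) => j [/connected_component_sub [Kw ew] [Kp _]].
      by split.
    split; last exact: (eclosed uV Vw2).
    by apply: (ultra_cvg_closed uV clK wv); apply: filterS Vw2 => j [].
  have Qy' : Q `<=` fiber_component y by exact: connected_component_max.
  have nOu : (~` O) u.
    apply: (ultra_cvg_closed uU (open_closedC oO) hu).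
    by apply: filterS UB => b /hP [].
  by apply: nOu; apply: xO; rewrite -(fiber_component_eq Kx xy); exact: Qy'.
- move=> _ [y Ky ->] [z [yz nz]]; rewrite -(fiber_component_eq Ky yz).
  apply: contrapT => nO; apply: nz; apply: subset_closure; split => //.
  by have [] := connected_component_sub yz.
Qed.
End ClosedRelation.

(** * The crossing lemma *)

Section Crossing.
Local Open Scope ring_scope.
Variable R : realFieldType.
Implicit Types (p q c : R * R) (l m : seq (R * R)).

Definition near_points (e : R) p q := (`|p.1 - q.1| < e) && (`|p.2 - q.2| < e).

Lemma near_pointsP e p q : reflect
  [/\ p.1 - e < q.1, q.1 < p.1 + e, p.2 - e < q.2 & q.2 < p.2 + e] (near_points e p q).
Proof.
apply: (iffP andP); rewrite !ltr_distl.
  by move=> [/andP[? ?] /andP[? ?]]; split; lra.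
by move=> [? ? ? ?]; split; apply/andP; split; lra.
Qed.

(** Parity of the crossings of the chain [c :: l] with the ray going down from [p]. The height of
    the starting point alone decides whether a step counts, which is harmless when [p] is far from
    the chain. *)
Fixpoint below p c l : bool :=
  if l is c' :: l' then
    (((p.1 < c.1) (+) (p.1 < c'.1)) && (c.2 <= p.2)) (+) below p c' l'
  else false.

(** The dual count, for the ray going up from [q]. In both counts the horizontal test asks whether
    the point of the second chain is strictly to the left of that of the first, so ties are broken
    alike. *)
Fixpoint above q (y : R * R) m : bool :=
  if m is y' :: m' then
    (((y.1 < q.1) (+) (y'.1 < q.1)) && (q.2 < y.2)) (+) above q y' m'
  else false.

Definition far e p l := all (fun q => ~~ near_points (4%:R * e) p q) l.

Lemma addb_glue (u v a b w : bool) : u = v (+) a -> w = a (+) b -> u (+) w = v (+) b.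
Proof. by move=> -> ->; case: v; case: a; case: b. Qed.

Lemma addb_side (g g' h h' l l' : bool) : (g' (+) h' -> l = l') ->
  ((g (+) g') && l) (+) ((h (+) h') && l) = ((g (+) h) && l) (+) ((g' (+) h') && l').
Proof.
by case: g; case: g'; case: h; case: h'; case: l; case: l' => // /(_ isT).
Qed.

Lemma addb_mid (b1 b2 b3 : bool) : b1 (+) b3 = (b1 (+) b2) (+) (b2 (+) b3).
Proof. by case: b1; case: b2; case: b3. Qed.

(** A short move of the point changes the parity only through the ends of the chain, an end counting
    when the move passes over it. In [key], either [c] is within [2 e] of [p] horizontally and then
    at least [4 e] away vertically, so that all vertical comparisons agree, or [c] and [c'] are on
    the same side of both [p] and [p'] horizontally. *)
Lemma below_step e p p' c l : near_points e p p' -> path (near_points e) c l ->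
  far e p (c :: l) -> far e p' (c :: l) ->
  let d q := ((p.1 < q.1) (+) (p'.1 < q.1)) && (q.2 < p.2) in
  below p c l (+) below p' c l = d c (+) d (last c l).
Proof.
move=> pp'; elim: l c => [|c' l IH] c /=; first by rewrite addbb.
move=> /andP[cc' cl] /and3P[f1 f2 f3] /and3P[g1 g2 g3].
move: (IH c' cl (introT andP (conj f2 f3)) (introT andP (conj g2 g3))) => /= {}IH.
set A := _ && _ in IH; set B := _ && _ in IH.
rewrite -/B.
move/near_pointsP: pp' => [u1 u2 u3 u4]; move/near_pointsP: cc' => [v1 v2 v3 v4].
have key : (((p.1 < c.1) (+) (p.1 < c'.1)) && (c.2 <= p.2)) (+)
    (((p'.1 < c.1) (+) (p'.1 < c'.1)) && (c.2 <= p'.2)) =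
    (((p.1 < c.1) (+) (p'.1 < c.1)) && (c.2 < p.2)) (+) A.
  have [h|h] := boolP ((p.1 - 2%:R * e < c.1) && (c.1 < p.1 + 2%:R * e)).
    case/andP: h => h1 h2.
    have [h3|h3] := lerP c.2 (p.2 - 4%:R * e).
      have -> : c.2 <= p.2 by lra.
      have -> : c.2 <= p'.2 by lra.
      have -> : c.2 < p.2 by lra.
      have -> : A = (p.1 < c'.1) (+) (p'.1 < c'.1) by rewrite /A (_ : c'.2 < p.2) ?andbT //; lra.
      by rewrite !andbT addbACA.
    have h4 : p.2 + 4%:R * e <= c.2.
      rewrite leNgt; apply/negP => h4; move/negP: f1; apply; apply/near_pointsP; split; lra.
    have -> : (c.2 <= p.2) = false by apply/negbTE; rewrite -ltNge; lra.
    have -> : (c.2 <= p'.2) = false by apply/negbTE; rewrite -ltNge; lra.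
    have -> : (c.2 < p.2) = false by apply/negbTE; rewrite -leNgt; lra.
    rewrite /A (_ : (c'.2 < p.2) = false) ?andbF //; apply/negbTE; rewrite -leNgt; lra.
  have [h1|h1] := lerP c.1 (p.1 - 2%:R * e).
    have E1 : (p.1 < c.1) = false by apply/negbTE; rewrite -leNgt; lra.
    have E2 : (p.1 < c'.1) = false by apply/negbTE; rewrite -leNgt; lra.
    have E3 : (p'.1 < c.1) = false by apply/negbTE; rewrite -leNgt; lra.
    have E4 : (p'.1 < c'.1) = false by apply/negbTE; rewrite -leNgt; lra.
    by rewrite /A E1 E2 E3 E4.
  have h2 : p.1 + 2%:R * e <= c.1 by rewrite h1 /= -leNgt in h.
  have E1 : (p.1 < c.1) by lra.
  have E2 : (p.1 < c'.1) by lra.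
  have E3 : (p'.1 < c.1) by lra.
  have E4 : (p'.1 < c'.1) by lra.
  by rewrite /A E1 E2 E3 E4.
by rewrite addbACA; exact: addb_glue key IH.
Qed.

(** A discrete invariance of the intersection parity: [below_step] is summed over the second chain,
    and the contributions of the two ends of the first chain add up to the two values of [above]. *)
Lemma below_path e c l (y : R * R) m : path (near_points e) c l -> path (near_points e) y m ->
  {in y :: m, forall p, far e p (c :: l)} ->
  below y c l (+) below (last y m) c l = above c y m (+) above (last c l) y m.
Proof.
move=> cl; elim: m y => [|y' m IH] y /=; first by rewrite addbb.
move=> /andP[yy' ym] fm.
have IH' : below y' c l (+) below (last y' m) c l = above c y' m (+) above (last c l) y' m.
  by apply: IH => // p pm; apply: fm; rewrite inE pm orbT.
have S := below_step yy' cl (fm y (mem_head _ _)) (fm y' _).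
rewrite (addb_mid _ (below y' c l)).
rewrite IH' S /=; last by rewrite !inE eqxx orbT.
by rewrite addbACA.
Qed.

(** The chain stays out of the open box standing on the segment at level [b]; steps shorter than [h]
    then cannot jump from one side of the box to the other. *)
Definition admissible (a a' b h : R) l :=
  {in l, forall q, a < q.1 -> q.1 < a' -> q.2 <= b \/ b + h <= q.2}.

(** The counterpart of [below_step] for a long move along the side of the box: between [y] and [y']
    a step of the chain cannot change sides of the level [b], because of the box in the interior and
    because of [far] at the two end points. *)
Lemma below_side e a a' b h y y' c l : e <= h -> a <= y -> y' <= a' -> y < y' ->
  path (near_points e) c l -> admissible a a' b h (c :: l) ->
  far e (y, b) (c :: l) -> far e (y', b) (c :: l) ->
  let d q := ((y < q.1) (+) (y' < q.1)) && (q.2 <= b) in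
  below (y, b) c l (+) below (y', b) c l = d c (+) d (last c l).
Proof.
move=> eh ay ya yy'; elim: l c => [|c' l IH] c /=; first by rewrite addbb.
move=> /andP[cc' cl] adm /and3P[f1 f2 f3] /and3P[g1 g2 g3].
have adm' : admissible a a' b h (c' :: l).
  by move=> q ql; apply: adm; rewrite inE ql orbT.
move: (IH c' cl adm' (introT andP (conj f2 f3)) (introT andP (conj g2 g3))) => /= {}IH.
set A := _ && _ in IH; set B := _ && _ in IH.
rewrite -/B.
move/near_pointsP: cc' => [v1 v2 v3 v4].
have key : (y < c'.1) (+) (y' < c'.1) -> (c.2 <= b) = (c'.2 <= b).
  have [y'c|y'c] := ltrP y' c'.1.
    by have -> : y < c'.1 by lra.
  rewrite addbF => yc.
  have fc' : c'.1 = y' -> c'.2 <= b - 4%:R * e \/ b + 4%:R * e <= c'.2.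
    move=> E; have [?|h1] := lerP c'.2 (b - 4%:R * e); first by left.
    have [?|h2] := lerP (b + 4%:R * e) c'.2; first by right.
    move/negP: g2; case; apply/near_pointsP => /=; rewrite E; split; lra.
  have [c'b|c'b] := lerP c'.2 b.
  - apply/idP; rewrite leNgt; apply/negP => cb.
    have [E|ne] := eqVneq c'.1 y'; first by case: (fc' E); lra.
    have c'y : c'.1 < y' by rewrite lt_neqAle ne.
    have [cy|cy] := lerP c.1 y.
      move/negP: f1; case; apply/near_pointsP => /=; split; lra.
    have [cy'|cy'] := lerP y' c.1.
      move/negP: g1; case; apply/near_pointsP => /=; split; lra.
    have := adm c (mem_head _ _); case; lra.
  - apply/negbTE/negP => cb.
    have [E|ne] := eqVneq c'.1 y'; first by case: (fc' E); lra.
    have c'y : c'.1 < y' by rewrite lt_neqAle ne.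
    have := adm c'; rewrite !inE eqxx orbT => /(_ isT); case; lra.
by rewrite addbACA; exact: addb_glue (addb_side _ _ key) IH.
Qed.

Lemma above_side e a a' b h x x' c l : e <= h -> a <= x -> x' <= a' -> x < x' ->
  path (near_points e) c l -> admissible a a' b h (c :: l) ->
  far e (x, b) (c :: l) -> far e (x', b) (c :: l) ->
  let d q := ((q.1 < x) (+) (q.1 < x')) && (b < q.2) in
  above (x, b) c l (+) above (x', b) c l = d c (+) d (last c l).
Proof.
move=> eh ay ya yy'; elim: l c => [|c' l IH] c /=; first by rewrite addbb.
move=> /andP[cc' cl] adm /and3P[f1 f2 f3] /and3P[g1 g2 g3].
have adm' : admissible a a' b h (c' :: l).
  by move=> q ql; apply: adm; rewrite inE ql orbT.
move: (IH c' cl adm' (introT andP (conj f2 f3)) (introT andP (conj g2 g3))) => /= {}IH.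
set A := _ && _ in IH; set B := _ && _ in IH.
rewrite -/B.
move/near_pointsP: cc' => [v1 v2 v3 v4].
have key : (c'.1 < x) (+) (c'.1 < x') -> (b < c.2) = (b < c'.2).
  have [xc|xc] := ltrP c'.1 x.
    by have -> : c'.1 < x' by lra.
  rewrite addFb => xc'.
  have fc' : c'.1 = x -> c'.2 <= b - 4%:R * e \/ b + 4%:R * e <= c'.2.
    move=> E; have [?|h1] := lerP c'.2 (b - 4%:R * e); first by left.
    have [?|h2] := lerP (b + 4%:R * e) c'.2; first by right.
    move/negP: f2; case; apply/near_pointsP => /=; rewrite E; split; lra.
  have [c'b|c'b] := lerP c'.2 b.
  - apply/negbTE/negP => cb.
    have [E|ne] := eqVneq c'.1 x; first by case: (fc' E); lra.
    have c'y : x < c'.1 by rewrite lt_neqAle eq_sym ne.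
    have [cy|cy] := lerP c.1 x.
      move/negP: f1; case; apply/near_pointsP => /=; split; lra.
    have [cy'|cy'] := lerP x' c.1.
      move/negP: g1; case; apply/near_pointsP => /=; split; lra.
    have := adm c (mem_head _ _); case; lra.
  - apply/idP; rewrite ltNge; apply/negP => cb.
    have [E|ne] := eqVneq c'.1 x; first by case: (fc' E); lra.
    have c'y : x < c'.1 by rewrite lt_neqAle eq_sym ne.
    have := adm c'; rewrite !inE eqxx orbT => /(_ isT); case; lra.
by rewrite addbACA; exact: addb_glue (addb_side _ _ key) IH.
Qed.

(* Two chains outside a box whose ends are linked on one side of the box come
   close to each other: the parity of the crossings of the first chain below the
   points of the second one would otherwise be inconsistent. *)
Lemma linked_chains e a a' b h x y x' y' l m : 0 < e -> e <= h ->
  a <= x -> x < y -> y < x' -> x' < y' -> y' <= a' ->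
  path (near_points e) (x, b) l -> path (near_points e) (y, b) m ->
  last (x, b) l = (x', b) -> last (y, b) m = (y', b) ->
  admissible a a' b h ((x, b) :: l) -> admissible a a' b h ((y, b) :: m) ->
  exists c p, [/\ c \in (x, b) :: l, p \in (y, b) :: m & near_points (4%:R * e) p c].
Proof.
move=> e0 eh ax xy yx x'y' y'a pl pm ll lm al am; apply: contrapT => H.
have fc : {in (y, b) :: m, forall p, far e p ((x, b) :: l)}.
  move=> p pm1; apply/allP => c cl; apply/negP => nc; apply: H; by exists c, p.
have fp : {in (x, b) :: l, forall c, far e c ((y, b) :: m)}.
  move=> c cl; apply/allP => p pm1; apply/negP => /near_pointsP nc; apply: H; exists c, p.
  by split => //; apply/near_pointsP; case: nc => *; split; lra.
have E := below_path pl pm fc.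
rewrite lm ll in E.
have mlast : (y', b) \in (y, b) :: m by rewrite -lm mem_last.
have llast : (x', b) \in (x, b) :: l by rewrite -ll mem_last.
have ay : a <= y by lra.
have x'a : x' <= a' by lra.
have xx' : x < x' by lra.
have yy' : y < y' by lra.
have := below_side eh ay y'a yy' pl al (fc _ (mem_head _ _)) (fc _ mlast).
have := above_side eh ax x'a xx' pm am (fp _ (mem_head _ _)) (fp _ llast).
rewrite E => -> /=.
rewrite ll lm /= !lexx !ltxx !andbF !andbT.
have -> : (y < x) = false by apply/negbTE; rewrite -leNgt ltW.
have -> : (y' < x) = false by apply/negbTE; rewrite -leNgt; lra.
have -> : (y' < x') = false by apply/negbTE; rewrite -leNgt ltW.
by rewrite yx.
Qed.
End Crossing.

(** * Linked continua across a side of a box *)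

Section Boxes.
Local Open Scope ring_scope.
Variable R : realType.
Local Notation T := (Chat R).
Local Notation Re := (@complex.Re R).
Local Notation Im := (@complex.Im R).
Let hT := @hausdorff_Chat R.
Let cT := @compact_Chat R.

(** The value [0] at infinity is a placeholder; the geometric arguments keep away from infinity. *)
Definition affix (x : T) : R[i] := odflt 0 x.

Lemma affixK (x : T) : x <> None -> x = Some (affix x).
Proof. by case: x. Qed.

Lemma cvg_near (I : Type) (U : set_system I) (h : I -> T) (x : T) (e : R) :
  h @ U --> x -> x <> None -> 0 < e -> U [set i | [/\ h i <> None,
    `|Re (affix (h i)) - Re (affix x)| < e & `|Im (affix (h i)) - Im (affix x)| < e]].
Proof.
case: x => // z hx _ e0; have : nbhs (Some z : T) [set y : T | [/\ y <> None,
    `|Re (affix y) - Re z| < e & `|Im (affix y) - Im z| < e]].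
  by apply/nbhs_some; exists e.
by move/hx.
Qed.

Lemma open_box (a a' b b' : R) :
  open [set x : T | exists2 z : R[i], x = Some z & [/\ a < Re z, Re z < a', b < Im z & Im z < b']].
Proof.
rewrite openE => _ [z -> [h1 h2 h3 h4]]; apply/nbhs_some.
exists (Num.min (Num.min (Re z - a) (a' - Re z)) (Num.min (Im z - b) (b' - Im z))).
  by rewrite !lt_min !subr_gt0 h1 h2 h3 h4.
move=> w; rewrite !lt_min !ltr_distl =>
  /andP[/andP[p1 p2] /andP[p3 p4]] /andP[/andP[q1 q2] /andP[q3 q4]].
by exists w => //; split; lra.
Qed.

(** A neighbourhood of infinity: the condition is vacuous at [None]. *)
Definition outer_box (r : R) : set T :=
  [set x | forall z : R[i], x = Some z -> r < `|Re z| \/ r < `|Im z|].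

Lemma open_outer_box (r : R) : open (outer_box r).
Proof.
rewrite openE => -[z|] hz.
  apply/nbhs_some; case: (hz z erefl) => hr.
    exists (`|Re z| - r); first by rewrite subr_gt0.
    move=> w h1 _ _ [<-]; left; have := ler_distD (Re w) (Re z) 0.
    by rewrite !subr0 distrC; lra.
  exists (`|Im z| - r); first by rewrite subr_gt0.
  move=> w _ h1 _ [<-]; right; have := ler_distD (Im w) (Im z) 0.
  by rewrite !subr0 distrC; lra.
by apply/nbhs_none; split => //; exists r => w h z [<-].
Qed.

(* [((sw, sg), (a, a'), (b, h))] encodes the segment [a <= u <= a', v = b] lying on
   the boundary of the box [a < u < a', b < v < b + h]; the bits [sw] and [sg] say
   whether the coordinates [u, v] are the real and imaginary parts exchanged, and
   whether [v] is negated. *)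
Definition side : Type := ((bool * bool) * (R * R) * (R * R))%type.

Definition coord (s : side) (x : T) : R * R :=
  let z := affix x in let v := if s.1.1.1 then Re z else Im z in
  (if s.1.1.1 then Im z else Re z, if s.1.1.2 then - v else v).

Lemma near_coord (e : R) (s : side) (x y : T) : near_points e (coord s x) (coord s y) =
  (`|Re (affix x) - Re (affix y)| < e) && (`|Im (affix x) - Im (affix y)| < e).
Proof.
by rewrite /near_points /coord; case: s => -[[[] []] ? ?] /=; rewrite -?opprD ?normrN // andbC.
Qed.

Definition on_side (s : side) (x : T) :=
  [/\ s.1.2.1 <= (coord s x).1, (coord s x).1 <= s.1.2.2 & (coord s x).2 = s.2.1].

Definition off_box (s : side) (x : T) :=
  s.1.2.1 < (coord s x).1 -> (coord s x).1 < s.1.2.2 ->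
  (coord s x).2 <= s.2.1 \/ s.2.1 + s.2.2 <= (coord s x).2.

(** The clauses speak of points outside [B] only, so that they pass to finite unions: a point
    outside the union is outside every cap, hence off every box. *)
Definition cap (B : set T) (l : seq side) := [/\ open B,
  forall x, x <> None -> closure B x -> ~ B x -> exists2 s, s \in l & on_side s x &
  forall s x, s \in l -> x <> None -> ~ B x -> 0 < s.2.2 /\ off_box s x].

Definition box_sides (a a' b b' : R) : seq side :=
  [:: ((false, false), (a, a'), (b, b' - b)); ((false, true), (a, a'), (- b', b' - b));
      ((true, false), (b, b'), (a, a' - a)); ((true, true), (b, b'), (- a', a' - a))].

Lemma cap_box (a a' b b' : R) : a < a' -> b < b' ->
  cap [set x : T | exists2 z : R[i], x = Some z & [/\ a < Re z, Re z < a', b < Im z & Im z < b']]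
      (box_sides a a' b b').
Proof.
move=> aa bb; set B := [set x | _]; split; first exact: open_box.
- move=> [z|//] _ clB nB.
  have H (P : R[i] -> Prop) : (exists2 e : R, 0 < e & forall w :
    R[i], `|Re w - Re z| < e -> `|Im w - Im z| < e -> P w) ->
      exists2 w, P w & [/\ a < Re w, Re w < a', b < Im w & Im w < b'].
    move=> he; have /clB [_ [[w -> hw] [y Py [yw]]]] : nbhs (Some z : T) (Some @` [set w | P w]).
      by apply/nbhs_some; case: he => e e0 eP; exists e => // w h1 h2; exists w => //; exact: eP.
    by exists w => //; rewrite -yw.
  have za : a <= Re z.
    rewrite leNgt; apply/negP => lt; case: (H (fun w => Re w < a)); last by move=> w ? []; lra.
    by exists (a - Re z); [lra|move=> w; rewrite ltr_distl => /andP[]; lra].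
  have za' : Re z <= a'.
    rewrite leNgt; apply/negP => lt; case: (H (fun w => a' < Re w)); last by move=> w ? []; lra.
    by exists (Re z - a'); [lra|move=> w; rewrite ltr_distl => /andP[]; lra].
  have zb : b <= Im z.
    rewrite leNgt; apply/negP => lt; case: (H (fun w => Im w < b)); last by move=> w ? []; lra.
    by exists (b - Im z); [lra|move=> w _; rewrite ltr_distl => /andP[]; lra].
  have zb' : Im z <= b'.
    rewrite leNgt; apply/negP => lt; case: (H (fun w => b' < Im w)); last by move=> w ? []; lra.
    by exists (Im z - b'); [lra|move=> w _; rewrite ltr_distl => /andP[]; lra].
  have [E|n1] := eqVneq (Re z) a.
    exists ((true, false), (b, b'), (a, a' - a)); first by rewrite !inE eqxx !orbT.
    by split.
  have [E|n2] := eqVneq (Re z) a'.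
    exists ((true, true), (b, b'), (- a', a' - a)); first by rewrite !inE eqxx !orbT.
    by split => //; rewrite /coord /= E.
  have [E|n3] := eqVneq (Im z) b.
    by exists ((false, false), (a, a'), (b, b' - b)); first by rewrite !inE eqxx.
  have [E|n4] := eqVneq (Im z) b'.
    exists ((false, true), (a, a'), (- b', b' - b)); first by rewrite !inE eqxx !orbT.
    by split => //; rewrite /coord /= E.
  by case: nB; exists z => //; split; rewrite lt_neqAle ?n2 ?n4 // eq_sym ?n1 ?n3.
- move=> s [z|//] + _ nB; have {}nB : ~ [/\ a < Re z, Re z < a', b < Im z & Im z < b'].
    by move=> h; apply: nB; exists z.
  rewrite !inE => /or4P[] /eqP -> /=; (split; first by rewrite subr_gt0);
    rewrite /off_box /coord /= => h1 h2.
  + case: (lerP (Im z) b) => h3; [by left|right]; rewrite leNgt; apply/negP => h4.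
    by apply: nB; split => //; lra.
  + case: (lerP (- Im z) (- b')) => h3; [by left|right]; rewrite leNgt; apply/negP => h4.
    by apply: nB; split => //; lra.
  + case: (lerP (Re z) a) => h3; [by left|right]; rewrite leNgt; apply/negP => h4.
    by apply: nB; split => //; lra.
  + case: (lerP (- Re z) (- a')) => h3; [by left|right]; rewrite leNgt; apply/negP => h4.
    by apply: nB; split => //; lra.
Qed.

(** The coordinate [v] is oriented so that the exterior of the square lies above each side; there
    every positive height is free, and [1] is taken. *)
Definition outer_sides (r : R) : seq side :=
  [:: ((false, false), (- r, r), (r, 1)); ((false, true), (- r, r), (r, 1));
      ((true, false), (- r, r), (r, 1)); ((true, true), (- r, r), (r, 1))].

Lemma cap_outer (r : R) : 0 < r -> cap (outer_box r) (outer_sides r).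
Proof.
move=> r0; split; first exact: open_outer_box.
- move=> [z|//] _ clB nB.
  have [h1 h2] : `|Re z| <= r /\ `|Im z| <= r.
    split; rewrite leNgt; apply/negP => h; apply: nB => w [<-]; by [left|right].
  have [h3|h3] : r <= `|Re z| \/ r <= `|Im z|.
    apply: contrapT => /not_orP [/negP]; rewrite -ltNge => k1 /negP; rewrite -ltNge => k2.
    have /clB [y [hw [w hw2 E]]] : nbhs (Some z : T) (Some @` [set w :
      R[i] | `|Re w| < r /\ `|Im w| < r]).
      apply/nbhs_some; exists (Num.min (r - `|Re z|) (r - `|Im z|));
        first by rewrite lt_min !subr_gt0 k1.
      move=> w; rewrite !lt_min => /andP[l1 _] /andP[_ l2]; exists w => //.
      have := ler_distD (Re z) (Re w) 0; have := ler_distD (Im z) (Im w) 0.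
      by rewrite !subr0 /=; split; lra.
    by case: hw2 => /= ? ?; case: (hw w (esym E)); lra.
  - have {}h3 : `|Re z| = r by apply/eqP; rewrite eq_le h1.
    have [z0|z0] := ltrP (Re z) 0.
      exists ((true, true), (- r, r), (r, 1)); first by rewrite !inE eqxx !orbT.
      move: h2; rewrite ler_norml => /andP[? ?]; split => //.
      by rewrite /coord /= -h3 ltr0_norm.
    exists ((true, false), (- r, r), (r, 1)); first by rewrite !inE eqxx !orbT.
    move: h2; rewrite ler_norml => /andP[? ?]; split => //.
    by rewrite /coord /= -h3 ger0_norm.
  - have {}h3 : `|Im z| = r by apply/eqP; rewrite eq_le h2.
    have [z0|z0] := ltrP (Im z) 0.
      exists ((false, true), (- r, r), (r, 1)); first by rewrite !inE eqxx !orbT.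
      move: h1; rewrite ler_norml => /andP[? ?]; split => //.
      by rewrite /coord /= -h3 ltr0_norm.
    exists ((false, false), (- r, r), (r, 1)); first by rewrite !inE eqxx.
    move: h1; rewrite ler_norml => /andP[? ?]; split => //.
    by rewrite /coord /= -h3 ger0_norm.
- move=> s [z|//] + _ nB.
  have [h1 h2] : `|Re z| <= r /\ `|Im z| <= r.
    split; rewrite leNgt; apply/negP => h; apply: nB => w [<-]; by [left|right].
  move: h1 h2; rewrite !ler_norml => /andP[? ?] /andP[? ?].
  rewrite !inE => /or4P[] /eqP -> /=; (split; first exact: ltr01);
    rewrite /off_box /coord /= => _ _; left; lra.
Qed.

Lemma cap_ex (x : T) (Q : set T) : closed Q -> ~ Q x ->
  exists B l, [/\ cap B l, B x & closure B `&` Q = set0].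
Proof.
move=> cQ nQ; have cx : closed [set x] by exact: accessible_closed_set1 (hausdorff_accessible hT) x.
have [|C [oC xC CQ]] := open_shrink hT cT cx (closed_openC cQ); first by move=> y ->.
have nC : nbhs x C by apply: open_nbhs_nbhs; split => //; exact: xC.
have clB B : B `<=` C -> closure B `&` Q = set0.
  by move=> BC; apply/disjoints_subset; apply: subset_trans CQ; exact: closureS.
case: x nQ cx xC nC => [z|] nQ cx xC nC.
  move/nbhs_some: nC => [e e0 eC].
  pose B := [set x : T | exists2 w : R[i], x = Some w &
    [/\ Re z - e < Re w, Re w < Re z + e, Im z - e < Im w & Im w < Im z + e]].
  exists B, (box_sides (Re z - e) (Re z + e) (Im z - e) (Im z + e)); split.
  - by apply: cap_box; lra.
  - by exists z => //; split; lra.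
  - apply: clB => _ [w -> [h1 h2 h3 h4]]; apply: eC; rewrite ltr_distl; apply/andP; split; lra.
move/nbhs_none: nC => [CN [r rC]].
exists (outer_box (Num.max r 1)), (outer_sides (Num.max r 1)); split.
- by apply: cap_outer; rewrite lt_max ltr01 orbT.
- by [].
- by apply: clB => -[w|//] /(_ w erefl); rewrite !gt_max => -[/andP[? _]|/andP[? _]]; apply: rC;
  [left|right].
Qed.

(** The points reachable by chains of step [e] form a clopen part of [A]: whatever is near a
    reachable point is reachable, and whatever is near an unreachable one is not. *)
Lemma chain_ex (s : side) (A : set T) (x y : T) (e : R) :
  connected A -> ~ A None -> A x -> A y -> 0 < e ->
  exists l, [/\ path (near_points e) (coord s x) l, last (coord s x) l = coord s y &
    forall c, c \in coord s x :: l -> exists2 u, A u & c = coord s u].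
Proof.
move=> cA nA Ax Ay e0.
pose good y l := [/\ path (near_points e) (coord s x) l, last (coord s x) l = coord s y &
    forall c, c \in coord s x :: l -> exists2 u, A u & c = coord s u].
pose B := [set y | A y /\ exists l, good y l].
have near_nbhs (u : T) : u <> None ->
    nbhs u [set w : T | w <> None /\ near_points e (coord s u) (coord s w)].
  case: u => // z _; apply/nbhs_some; exists e => // w; rewrite distrC => h1; rewrite distrC => h2;
    split => //.
  by rewrite near_coord /= h1 h2.
have nsym p q : near_points e p q = near_points e q p.
  by rewrite /near_points !(distrC p.1) !(distrC p.2).
have ext (u w : T) : B u -> A w -> near_points e (coord s u) (coord s w) -> B w.
  move=> [Au [l [l1 l2 l3]]] Aw uw; split => //; exists (rcons l (coord s w)); split.
  - by rewrite rcons_path l1 l2.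
  - by rewrite last_rcons.
  - move=> c; rewrite -rcons_cons mem_rcons inE => /orP[/eqP ->|/l3 //]; by exists w.
have Bx : B x.
  split => //; exists [::]; split => // c; rewrite inE => /eqP ->; by exists x.
suff AB : A `<=` B by have [_] := AB y Ay.
have nN (u : T) : A u -> u <> None by move=> Au uN; apply: nA; rewrite -uN.
have BE1 : B = A `&` \bigcup_(u in B) [set w :
  T | w <> None /\ near_points e (coord s u) (coord s w)]°.
  apply/seteqP; split => [u Bu|w [Aw [u Bu /interior_subset [_ uw]]]]; last exact: ext uw.
  split; first by case: Bu.
  by exists u => //; apply: near_nbhs; apply: nN; case: Bu.
have BE2 : A `\` B = A `&` \bigcup_(u in A `\` B) [set w :
  T | w <> None /\ near_points e (coord s u) (coord s w)]°.
  apply/seteqP; split => [u [Au nBu]|w [Aw [u [Au nBu] /interior_subset [_ uw]]]].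
    by split => //; exists u => //; apply: near_nbhs; exact: nN.
  split => // Bw; apply: nBu; apply: ext Bw Au _; by rewrite nsym.
suff <- : B = A by [].
apply: cA; first by exists x.
  eexists; last exact: BE1.
  by apply: bigcup_open => u _; exact: open_interior.
exists (~` \bigcup_(u in A `\` B) [set w :
  T | w <> None /\ near_points e (coord s u) (coord s w)]°).
  by apply: open_closedC; apply: bigcup_open => u _; exact: open_interior.
rewrite [LHS](_ : B = A `\` (A `\` B)); last first.
  by rewrite setDD; apply/esym/setIidPr => u [].
set G := \bigcup_(_ in _) _ in BE2 *; rewrite (_ : A `\` (A `\` B) = A `\` (A `&` G)).
  by rewrite setDIr setDv set0U setDE.
by congr (A `\` _).
Qed.

(** Pairs of points coming arbitrarily close would have a common limit. Infinity is excluded from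
    [A], so this limit is a finite point and coordinates control convergence to it. *)
Lemma separation_radius (A B : set T) : closed A -> closed B -> A `&` B = set0 -> ~ A None ->
  exists2 e : R, 0 < e & forall x y, A x -> B y -> y <> None ->
    `|Re (affix x) - Re (affix y)| < e -> e <= `|Im (affix x) - Im (affix y)|.
Proof.
move=> clA clB AB nA; apply: contrapT => nex.
have /choice [p pP] : forall n : nat, exists p : T * T, [/\ A p.1, B p.2, p.2 <> None,
    `|Re (affix p.1) - Re (affix p.2)| < n.+1%:R^-1 & `|Im (affix p.1) - Im (affix p.2)| <
      n.+1%:R^-1].
  move=> n; apply: contrapT => nexp; apply: nex; exists n.+1%:R^-1; first by rewrite invr_gt0.
  move=> x y Ax By yN h; rewrite leNgt; apply/negP => h2; apply: nexp; by exists (x, y).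
have [U [uU ooU]] := ultraFilterLemma eventually_filter.
have [x hx] := ultra_lim cT (fun n => (p n).1) uU.
have Ax : A x by apply: (ultra_cvg_closed uU clA hx); apply: filterS filterT => n _; case: (pP n).
have xN : x <> None by move=> xN; apply: nA; rewrite -xN.
suff Bx : B x by rewrite -[False]/(set0 x) -AB.
apply: (ultra_cvg_closed uU clB (h := fun n => (p n).2)); last first.
  by apply: filterS filterT => n _; case: (pP n).
move=> V; rewrite {1}(affixK xN) => /nbhs_some [e e0 eV].
suff : U [set n | V (p n).2] by [].
have e2 : 0 < e / 2 by rewrite divr_gt0.
pose m := (Num.truncn (e / 2)^-1).
have Um : U [set n | (m <= n)%N] by apply: ooU; exists m.
apply: filterS (ultraI uU Um (cvg_near hx xN e2)) => n [/= mn [h1 h2 h3]].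
have [Ap Bp pN k1 k2] := pP n.
have ne : n.+1%:R^-1 <= e / 2.
  have mm : (e / 2)^-1 < m.+1%:R by exact: truncnS_gt.
  rewrite -[leRHS]invrK lef_pV2 ?posrE ?invr_gt0 //; apply: (le_trans (ltW mm)).
  by rewrite ler_nat.
have {}k1 := lt_le_trans k1 ne; have {}k2 := lt_le_trans k2 ne.
rewrite (affixK pN); apply: eV.
  have := ler_distD (Re (affix (p n).1)) (Re (affix (p n).2)) (Re (affix x));
    rewrite (distrC _ (Re (affix (p n).1))); lra.
have := ler_distD (Im (affix (p n).1)) (Im (affix (p n).2)) (Im (affix x));
  rewrite (distrC _ (Im (affix (p n).1))); lra.
Qed.

Lemma linked_continua (s : side) (A B : set T) (x y x' y' : T) :
  closed A -> closed B -> connected A -> connected B -> A `&` B = set0 ->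
  ~ A None -> ~ B None -> 0 < s.2.2 ->
  (forall u, A u -> off_box s u) -> (forall u, B u -> off_box s u) ->
  A x -> A x' -> B y -> B y' -> on_side s x -> on_side s x' -> on_side s y -> on_side s y' ->
  (coord s x).1 < (coord s y).1 -> (coord s y).1 < (coord s x').1 ->
  (coord s x').1 < (coord s y').1 -> False.
Proof.
move=> cA cB conA conB AB nA nB h0 oA oB Ax Ax' By By' sx sx' sy sy' xy yx' x'y'.
have [e e0 eP] := separation_radius cA cB AB nA.
(* Chains of step [r] produce points within [4 r <= e] of each other, and [r <= s.2.2] keeps a step
   from jumping over the box. *)
pose r := Num.min (e / 4) s.2.2.
have r0 : 0 < r by rewrite lt_min h0 divr_gt0.
have rh : r <= s.2.2 by rewrite ge_min lexx orbT.
have re : 4%:R * r <= e by rewrite mulrC -ler_pdivlMr // ge_min lexx.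
have [l [l1 l2 l3]] := chain_ex s conA nA Ax Ax' r0.
have [m [m1 m2 m3]] := chain_ex s conB nB By By' r0.
have E u : on_side s u -> coord s u = ((coord s u).1, s.2.1).
  by move=> [_ _ <-]; case: (coord s u).
have adm (C : set T) (q : R * R) k : (forall u, C u -> off_box s u) ->
    (forall c, c \in q :: k -> exists2 u, C u & c = coord s u) ->
    admissible s.1.2.1 s.1.2.2 s.2.1 s.2.2 (q :: k).
  by move=> oC kC c /kC [u Cu ->]; exact: oC.
have aA := adm _ _ _ oA l3; have aB := adm _ _ _ oB m3.
have [sx1 _ _] := sx; have [_ sy2 _] := sy'.
rewrite (E x sx) (E x' sx') in l1 l2 l3 aA; rewrite (E y sy) (E y' sy') in m1 m2 m3 aB.
have [c [p [/l3 [u Au ->] /m3 [v Bv ->]]]] :=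
  linked_chains r0 rh sx1 xy yx' x'y' sy2 l1 m1 l2 m2 aA aB.
have vN : v <> None by move=> vN; apply: nB; rewrite -vN.
rewrite near_coord => /andP[k1 k2]; rewrite distrC in k1; rewrite distrC in k2.
have := eP u v Au Bv vN (lt_le_trans k1 re); lra.
Qed.
End Boxes.

(** * Collapse of planar limit continua *)

Lemma pigeonhole3 (I : finType) (J : eqType) (f : I -> J) (s : seq J) (A : {set I}) :
  {in A, forall i, f i \in s} -> (2 * size s < #|A|)%N ->
  exists i1 i2 i3, [/\ i1 != i2, i1 != i3, i2 != i3, f i1 = f i2 & f i1 = f i3].
Proof.
elim: s A => [|v s IH] A fA sA.
  have /card_gt0P [i iA] : (0 < #|A|)%N by apply: leq_ltn_trans sA.
  by have := fA i iA.
have [h|h] := ltnP 2 #|[set i in A | f i == v]|.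
  have [i1 [i2 [i3 [[a1 a2 a3] [n1 n2 n3]]]]] := card_gt2P h.
  move: a1 a2 a3; rewrite !inE => /andP[_ /eqP e1] /andP[_ /eqP e2] /andP[_ /eqP e3].
  by exists i1, i2, i3; split; rewrite ?e1 ?e2 ?e3 // eq_sym.
apply: (IH [set i in A | f i != v]).
  move=> i; rewrite inE => /andP[iA fv]; have := fA i iA.
  by rewrite inE (negbTE fv).
have E : (#|A| = #|[set i in A | f i == v]| + #|[set i in A | f i != v]|)%N.
  rewrite -(cardsID [set i | f i == v] A); congr (_ + _)%N; apply: eq_card => i; rewrite !inE //.
  by rewrite andbC.
by move: sA; rewrite E /= mulnS -addnS => sA; lia.
Qed.

Lemma sort3 (R : realFieldType) (I : eqType) (f : I -> R) (i1 i2 i3 : I) :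
  (f i1 != f i2)%R -> (f i1 != f i3)%R -> (f i2 != f i3)%R ->
  exists a b c, [/\ a \in [:: i1; i2; i3], b \in [:: i1; i2; i3], c \in [:: i1; i2; i3],
    (f a < f b)%R & (f b < f c)%R].
Proof.
rewrite !neq_lt => /orP[h1|h1] /orP[h2|h2] /orP[h3|h3].
- by exists i1, i2, i3; rewrite !inE !eqxx ?orbT.
- by exists i1, i3, i2; rewrite !inE !eqxx ?orbT.
- by exists i1, i2, i3; rewrite !inE !eqxx ?orbT; split => //; lra.
- by exists i3, i1, i2; rewrite !inE !eqxx ?orbT.
- by exists i2, i1, i3; rewrite !inE !eqxx ?orbT.
- by exists i2, i1, i3; rewrite !inE !eqxx ?orbT; split => //; lra.
- by exists i2, i3, i1; rewrite !inE !eqxx ?orbT.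
- by exists i3, i2, i1; rewrite !inE !eqxx ?orbT.
Qed.

Section Planar.
Variable R : realType.
Local Notation T := (Chat R).
Let hT := @hausdorff_Chat R.
Let cT := @compact_Chat R.

Lemma coord_inj (s : side R) (x y : T) : x <> None -> y <> None ->
  coord s x = coord s y -> x = y.
Proof.
case: x => // -[a b] _; case: y => // -[a' b'] _; rewrite /coord /=.
case: s => -[[sw sg] _] _ /=; case: sw; case: sg => -[->].
- by move=> /oppr_inj ->.
- by move=> ->.
- by move=> /oppr_inj ->.
- by move=> ->.
Qed.

Lemma disjoint_neighborhoods (n : nat) (d : 'I_n -> set T) :
  (forall i, closed (d i)) -> (forall i j, i != j -> d i `&` d j = set0) ->
  exists P : 'I_n -> set T, [/\ forall i, open (P i), forall i, d i `<=` P i &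
    forall i j, i != j -> closure (P i) `&` closure (P j) = set0].
Proof.
move=> cd dd.
have /choice [A AP] : forall ij : 'I_n * 'I_n, exists A : set T * set T, ij.1 != ij.2 ->
    [/\ open A.1, open A.2, d ij.1 `<=` A.1, d ij.2 `<=` A.2 & A.1 `&` A.2 = set0].
  move=> [i j]; case: (eqVneq i j) => [?|ij]; first by exists (set0, set0).
  by have [ O [ O' ?]] := normal_sep hT cT (cd i) (cd j) (dd i j ij); exists (O, O').
pose Q i := [set x | forall j, i != j -> (A (i, j)).1 x /\ (A (j, i)).2 x].
have /choice [P PP] : forall i, exists P : set T, [/\ open P, d i `<=` P & closure P `<=` Q i].
  move=> i; have : set_nbhs (d i) (Q i).
    apply: (@filter_forall _ _ (fun j x =>
      i != j -> (A (i, j)).1 x /\ (A (j, i)).2 x) (set_nbhs (d i))).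
    move=> j; case: (eqVneq i j) => [->|ij]; first by apply: nearW => x; rewrite ?eqxx.
    have [ o1 _ d1 _ _] := AP (i, j) ij; have [|_ o2 _ d2 _] := AP (j, i); first by rewrite eq_sym.
    apply/set_nbhsP; exists ((A (i, j)).1 `&` (A (j, i)).2); split; first exact: openI.
      by move=> x dx; split; [exact: d1|exact: d2].
    by move=> x [].
  move=> /set_nbhsP [C [oC dC CQ]].
  have [P [oP dP PC]] := open_shrink hT cT (cd i) oC dC.
  by exists P; split => //; exact: subset_trans PC CQ.
exists P; split => [i|i|i j ij]; [by case: (PP i)|by case: (PP i)|].
apply/seteqP; split => // x [clPi clPj].
have [_ _ Qi] := PP i; have [_ _ Qj] := PP j.
have [a1 _] := Qi x clPi j ij; have [|_ a2] := Qj x clPj i; first by rewrite eq_sym.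
by have [_ _ _ _ <-] := AP (i, j) ij.
Qed.

(** Finitely many caps cover the compact set [Z]; the closure of their union is the union of their
    closures, so its boundary lies on the sides of the caps. *)
Lemma cap_cover (Q Z : set T) : closed Q -> closed Z -> Z `&` Q = set0 ->
  exists (W : set T) (l : seq (side R)), [/\ open W, Z `<=` W, closure W `&` Q = set0,
    forall x : T, x <> None -> closure W x -> ~ W x -> exists2 s, s \in l & on_side s x &
    forall s x, s \in l -> x <> None -> ~ W x -> (0 < s.2.2)%R /\ off_box s x].
Proof.
move=> cQ cZ ZQ.
have /choice [p pP] : forall x : T, exists p : set T * seq (side R),
    Z x -> [/\ cap p.1 p.2, p.1 x & closure p.1 `&` Q = set0].
  move=> x; case: (pselect (Z x)) => [Zx|?]; last by exists (set0, [::]).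
  have [|B [l h]] := cap_ex (x := x) cQ; last by exists (B, l).
  by move=> Qx; rewrite -[False]/(set0 x) -ZQ.
have := closed_cpt cT cZ; rewrite compact_cover => /(_ T Z (fun x => (p x).1)).
case=> [x /pP [[]] //|x Zx|F FZ ZF]; first by exists x => //; case: (pP x Zx).
have {}FZ x : x \in F -> Z x by move=> /FZ /set_mem.
have clW : closure (cover [set` F] (fun x => (p x).1)) `<=` \bigcup_(x in [set` F]) closure (p x).1.
  have clG : closed (\bigcup_(x in [set` F]) closure (p x).1).
    by apply: closed_bigcup => [|x _]; [exact: finite_fset|exact: closed_closure].
  rewrite [X in _ `<=` X](closure_id _).1 //; apply: closureS.
  by move=> x [y Fy py]; exists y => //; exact: subset_closure.
exists (cover [set` F] (fun x => (p x).1)), (flatten [seq (p x).2 | x <- F]); split.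
- by apply: bigcup_open => x /FZ /pP [[]].
- exact: ZF.
- apply/seteqP; split => // x [/clW [y Fy cly] Qx].
  by have [_ _ <-] := pP y (FZ y Fy).
- move=> x xN /clW [y Fy cly] nW; have [[_ H _] _ _] := pP y (FZ y Fy).
  have [|s sl ss] := H x xN cly; first by move=> py; apply: nW; exists y.
  by exists s => //; apply/flatten_mapP; exists y.
- move=> s x /flatten_mapP [y yF sl] xN nW; have [[_ _ H] _ _] := pP y (FZ y yF).
  by apply: H => // py; apply: nW; exists y.
Qed.

Section Collapse.
Variables (L F : set T) (D : set (set T)).
Hypotheses (cL : compact L) (mD : monotone_decomposition L D) (nc : nicely_connected L D).
Variables (I : Type) (U : set_system I) (M : I -> set T).
Hypotheses (uU : UltraFilter U) (clM : forall i, closed (M i)) (cM : forall i, connected (M i)).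
Hypotheses (ML : forall i, M i `<=` L) (QF : ulim U M `<=` F°).
Hypothesis distinct : forall C, connected C -> C `<=` L `&` F -> U [set i | M i `&` C = set0].

(** Otherwise the connected limit would be a finite disjoint union of closed sets, at least two of
    them nonempty. *)
Lemma ulim_meets_infinite d : D d -> d `&` ulim U M !=set0 -> ~ (ulim U M `<=` d) ->
  infinite_set (meeting D (ulim U M)).
Proof.
move=> Dd dQ nQ fin; apply: nQ.
set Q := ulim U M in dQ fin *.
have QL : Q `<=` L.
  by apply: (ulim_closed uU (cpt_closed hT cL)); apply: filterS filterT => i _; exact: ML.
pose S' := \bigcup_(e in meeting D Q `\ d) e.
apply: (@connected_closed2 _ Q d S').
- by apply: (ulim_connected hT cT uU); apply: filterS filterT => i _; exact: cM.
- by apply: (mono_closed mD).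
- apply: closed_bigcup => [|e [[De _] _]]; last by apply: (mono_closed mD).
  exact: sub_finite_set fin.
- move=> x Qx; have [e De ex] := mono_cover mD (QL x Qx).
  case: (pselect (e = d)) => [<-|ed]; [by left|right].
  by exists e => //; split => //; split => //; exists x.
- apply/seteqP; split => // x [[Qx dx] [e [[De _] ed] ex]].
  by apply: ed; apply: (mono_eq mD De Dd ex).
- by rewrite setIC.
Qed.

(** By [distinct] no connected subset of [L] inside [F] can meet almost all [M j]. The connected set
    [N i] that [nc] attaches to an element meeting [Q] does meet them, so it has to leave [F]
    through the boundary of [W]. Exits of three [N i] on one side [s], attached to [M j], form a
    continuum [X j]; their limits, attached to [Q], form a continuum [Y]. Both touch [s] near the
    same three points, yet they are disjoint. *)
Lemma planar_collapse d : ~ ulim U M None -> D d -> d `&` ulim U M !=set0 -> ulim U M `<=` d.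
Proof.
move=> QN Dd [z [dz Qz]]; apply: contrapT => nQd.
have clL : closed L by exact: cpt_closed.
pose Q := ulim U M.
have clQ : closed Q by exact: closed_ulim.
have QL : Q `<=` L by apply: (ulim_closed uU clL); apply: filterS filterT => i _; exact: ML.
have cQ : connected Q.
  by apply: (ulim_connected hT cT uU); apply: filterS filterT => i _; exact: cM.
have infD := ulim_meets_infinite Dd (ex_intro _ z (conj dz Qz)) nQd.
have [||W [l [oW ZW WQ Wside Woff]]] := @cap_cover Q (~` F° `|` [set None]) clQ.
- apply: closedU; first by apply: open_closedC; exact: open_interior.
  exact: accessible_closed_set1 (hausdorff_accessible hT) _.
- apply/seteqP; split => // x [[nF|->] Qx]; last exact: QN.
  by apply: nF; exact: QF.
have WN : W None by apply: ZW; right.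
have nWF x : ~ W x -> F x.
  move=> nW; apply: interior_subset; apply: contrapT => nF; apply: nW; apply: ZW; by left.
have MW : U [set j | M j `<=` ~` closure W].
  apply: (ulim_open cT uU); first exact/closed_openC/closed_closure.
  by move=> x Qx clx; rewrite -[False]/(set0 x) -WQ.
have MF : U [set j | M j `<=` L `&` F].
  apply: filterS MW => j MW x Mx; split; first exact: ML Mx.
  by apply: nWF => Wx; apply: (MW x Mx); exact: subset_closure.
(* More than twice the number of sides, so that three elements share a side. *)
pose m := (2 * size l).+1.
have [B BD Bm] := infinite_set_fset m infD.
pose dd (i : 'I_m) : set T := nth set0 (enum_fset B) i.
have ddB i : dd i \in B by apply: mem_nth; apply: leq_trans Bm.
have ddM i : meeting D Q (dd i) by apply: BD; exact: ddB.
have ddinj i j : i != j -> dd i `&` dd j = set0.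
  move=> ij; apply/seteqP; split => // x [di dj].
  have [Di _] := ddM i; have [Dj _] := ddM j.
  have := mono_eq mD Di Dj di dj => /eqP; rewrite nth_uniq ?fset_uniq //; last 2 first.
  - by apply: leq_trans Bm.
  - by apply: leq_trans Bm.
  by move=> /eqP /val_inj eij; rewrite eij eqxx in ij.
have ddcl i : closed (dd i) by have [Di _] := ddM i; apply: (mono_closed mD).
have [P [oP dP PP]] := disjoint_neighborhoods ddcl ddinj.
have /choice [N NP] : forall i, exists N, [/\ closed N, connected N, N `<=` L,
    N `<=` closure (P i) & U [set j | M j `&` N !=set0]].
  move=> i; have [Di [u [du Qu]]] := ddM i.
  have nQdi : ~ (ulim U M `<=` dd i).
    move=> Qdi; apply: nQd; suff <- : dd i = d by [].
    by apply: (mono_eq mD Di Dd (Qdi z Qz)).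
  have [N [V [[cN NL Nu oV Vu] UN]]] := nc uU ML cM Qu Di du nQdi (oP i) (dP i).
  exists (closure N); split; [exact: closed_closure|exact: connected_closure| | |].
  - rewrite (closure_id L).1 //; apply: closureS => x /NL [] //.
  - by apply: closureS => x /NL [].
  - apply: filterS (ultraI uU UN (Qu V oV Vu)) => j [MN [y [My Vy]]].
    by exists y; split => //; apply: subset_closure; apply: MN.
have NW i : N i `&` W !=set0.
  apply: contrapT => NW; have [clN cN NL _ UN] := NP i.
  have NF : N i `<=` L `&` F.
    move=> x Nx; split; first exact: NL.
    by apply: nWF => Wx; apply: NW; exists x.
  have [j [[y MNy] MN0]] := ultra_ex uU (ultraI uU UN (distinct cN NF)).
  by rewrite -[False]/(set0 y) -MN0.
have /choice [w wP] : forall ij : 'I_m * I, exists w :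
  T, M ij.2 `&` N ij.1 !=set0 -> (M ij.2 `&` N ij.1) w.
  by move=> ij; case: (pselect (M ij.2 `&` N ij.1 !=set0)) => [[w ?]|?]; [exists w|exists None].
pose e i j := connected_component (N i `\` W) (w (i, j)).
have good i : U [set j | M j (w (i, j)) /\ N i (w (i, j)) /\ ~ W (w (i, j))].
  have [_ _ _ _ UN] := NP i; apply: filterS (ultraI uU UN MW) => j [MN MWj].
  have [Mw Nw] := wP (i, j) MN; split => //; split => // Ww.
  by apply: (MWj _ Mw); exact: subset_closure.
have /choice [xs xsP] : forall ij : 'I_m * I, exists xs : T * side R,
    N ij.1 (w ij) -> ~ W (w ij) -> [/\ e ij.1 ij.2 xs.1, xs.2 \in l & on_side xs.2 xs.1].
  move=> [i j] /=; case: (pselect (N i (w (i, j)))) => [Nw|?];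
    last by exists (None, ((false, false), (0, 0), (0, 0)))%R.
  case: (pselect (W (w (i, j)))) => [?|nWw];
    first by exists (None, ((false, false), (0, 0), (0, 0)))%R.
  have [clN cN _ _ _] := NP i.
  have [x [ex clx]] := boundary_bumping hT cT clN cN oW (NW i) Nw nWw.
  have [_ nWx] := connected_component_sub ex.
  have [|s sl sx] := Wside x _ clx nWx; first by move=> xN; apply: nWx; rewrite xN.
  by exists (x, s).
pose x i j := (xs (i, j)).1.
have goodx i : U [set j | [/\ M j (w (i, j)), e i j (w (i, j)), e i j (x i j),
    (xs (i, j)).2 \in l & on_side (xs (i, j)).2 (x i j)]].
  apply: filterS (good i) => j [Mw [Nw nWw]]; have [h1 h2 h3] := xsP (i, j) Nw nWw.
  by split => //; apply: connected_component_refl.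
have /choice [sd sdP] : forall i, exists s, s \in l /\ U [set j | (xs (i, j)).2 = s].
  move=> i; have [||s sl Us] := @ultra_finite _ _ uU _ [set s | s \in l] (fun j => (xs (i, j)).2).
  - exact: finite_seq.
  - by apply: filterS (goodx i) => j [].
  - by exists s.
have [||i1 [i2 [i3 [n12 n13 n23 s12 s13]]]] := @pigeonhole3 _ _ sd l [set: 'I_m].
- by move=> i _; case: (sdP i).
- by rewrite cardsT card_ord.
pose s := sd i1.
have sl : s \in l by case: (sdP i1).
have sdE i : i \in [:: i1; i2; i3] -> sd i = s.
  by rewrite !inE => /or3P[] /eqP ->; [by []|rewrite /s s12|rewrite /s s13].
have eN i j : e i j `<=` N i `\` W by exact: connected_component_sub.
have eL i j : e i j `<=` L `\` W.
  by move=> u /eN [Nu nW]; split => //; have [_ _ NL _ _] := NP i; exact: NL.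
have /choice [y yP] : forall i, exists y : T, x i @ U --> y by move=> i; exact: ultra_lim.
have clLW : closed (L `\` W) by rewrite setDE; apply: closedI => //; exact: open_closedC.
have xLW i : U [set j | (L `\` W) (x i j)].
  by apply: filterS (goodx i) => j [_ _ ex _ _]; exact: eL ex.
have yLW i : (L `\` W) (y i) by exact: (ultra_cvg_closed uU clLW (yP i) (xLW i)).
have nNone u : (L `\` W) u -> u <> None by move=> [_ nW] uN; apply: nW; rewrite uN.
have yN i : N i (y i).
  have [clN _ _ _ _] := NP i; apply: (ultra_cvg_closed uU clN (yP i)).
  by apply: filterS (goodx i) => j [_ _ ex _ _]; case: (eN _ _ _ ex).
have onx i : i \in [:: i1; i2; i3] -> U [set j | on_side s (x i j)].
  move=> ii; have [_ Us] := sdP i; apply: filterS (ultraI uU (goodx i) Us) => j [[_ _ _ _ h] hs].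
  by rewrite hs (sdE i ii) in h.
have nearx i (c : R) : (0 < c)%R -> U [set j | near_points c (coord s (x i j)) (coord s (y i))].
  move=> c0; apply: filterS (cvg_near (yP i) (nNone _ (yLW i)) c0) => j [_ h1 h2].
  by rewrite /= near_coord h1 h2.
have ony i : i \in [:: i1; i2; i3] -> on_side s (y i).
  move=> ii; suff H (c : R) : (0 < c)%R ->
      [/\ (s.1.2.1 - c <= (coord s (y i)).1)%R, ((coord s (y i)).1 <= s.1.2.2 + c)%R,
        (s.2.1 - c <= (coord s (y i)).2)%R & ((coord s (y i)).2 <= s.2.1 + c)%R].
    split.
    - by apply/ler_addgt0Pr => c c0; have [? _ _ _] := H c c0; lra.
    - by apply/ler_addgt0Pr => c c0; have [_ ? _ _] := H c c0; lra.
    - apply/eqP; rewrite eq_le; apply/andP; split; apply/ler_addgt0Pr => c c0;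
      have [_ _ ? ?] := H c c0; lra.
  move=> c0; have [j [[h1 h2 h3] /near_pointsP [k1 k2 k3 k4]]] :=
    ultra_ex uU (ultraI uU (onx i ii) (nearx i c c0)).
  by split; lra.
pose E i := ulim U (e i).
have cE i : connected (E i).
  by apply: (ulim_connected hT cT uU); apply: filterS filterT => j _; exact: component_connected.
have ELW i : E i `<=` L `\` W.
  by apply: (ulim_closed uU clLW); apply: filterS filterT => j _; exact: eL.
have Ey i : E i (y i) by apply: (ulim_mem uU (yP i)); apply: filterS (goodx i) => j [].
have EQ i : Q `&` E i !=set0.
  have [v wv] := ultra_lim cT (fun j => w (i, j)) uU.
  by exists v; split; apply: (ulim_mem uU wv); apply: filterS (goodx i) => j [].
have QLW : Q `<=` L `\` W.
  move=> u Qu; split; first exact: QL.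
  by move=> Wu; rewrite -[False]/(set0 u) -WQ; split => //; exact: subset_closure.
pose Y := Q `|` E i1 `|` E i2 `|` E i3.
have clY : closed Y by do !apply: closedU => //; exact: closed_ulim.
have YLW : Y `<=` L `\` W by move=> u [[[/QLW|/ELW]|/ELW]|/ELW].
have conY : connected Y.
  apply: connectedU => //; last first.
    apply: connectedU => //; last by apply: connectedU.
    by have [u [Qu Eu]] := EQ i2; exists u; split => //; left.
  by have [u [Qu Eu]] := EQ i3; exists u; split => //; left; left.
pose X j := M j `|` e i1 j `|` e i2 j `|` e i3 j.
pose C := connected_component (L `&` F) z.
have LWF : L `\` W `<=` L `&` F by move=> u [Lu nWu]; split => //; exact: nWF.
have Cz : C z by apply: connected_component_refl; apply: LWF; exact: QLW.
have YC : Y `<=` C.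
  apply: subset_component => //; first exact: subset_trans YLW LWF.
  by exists z; split => //; left; left; left.
have allx : U [set j | forall i, i \in [:: i1; i2;
  i3] -> [/\ M j (w (i, j)), e i j (w (i, j)), e i j (x i j) &
    on_side s (x i j)]].
  have H i : i \in [:: i1; i2; i3] ->
    U [set j | [/\ M j (w (i, j)), e i j (w (i, j)), e i j (x i j) &
    on_side s (x i j)]].
    by move=> ii; apply: filterS (ultraI uU (goodx i) (onx i ii)) => j [[? ? ? _ _] ?].
  have m1 : i1 \in [:: i1; i2; i3] by rewrite !inE eqxx.
  have m2 : i2 \in [:: i1; i2; i3] by rewrite !inE eqxx orbT.
  have m3 : i3 \in [:: i1; i2; i3] by rewrite !inE eqxx !orbT.
  apply: filterS (ultraI uU (H i1 m1) (ultraI uU (H i2 m2) (H i3 m3))) => j [h1 [h2 h3]] i.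
  by rewrite !inE => /or3P[] /eqP ->.
(* [Y] lies in one component [C] of the part of [L] in [F]. If [X j] met [Y] it would lie in [C]
   too, but [M j] misses [C]. *)
have XP : U [set j | [/\ closed (X j), connected (X j), X j `<=` L `\` W & X j `&` Y = set0]].
  apply: filterS (ultraI uU allx (ultraI uU (distinct (@component_connected _ _ _)
    (@connected_component_sub _ _ z)) (ultraI uU MW MF))) => j [ax [MC [MWj MFj]]].
  have m1 := ax i1; have m2 := ax i2; have m3 := ax i3.
  have {m1}[M1 e1 _ _] := m1 (mem_head _ _).
  have {m2}[M2 e2 _ _] : [/\ M j (w (i2, j)), e i2 j (w (i2, j)), e i2 j (x i2 j) & on_side s (x i2
    j)] by apply: m2; rewrite !inE eqxx orbT.
  have {m3}[M3 e3 _ _] : [/\ M j (w (i3, j)), e i3 j (w (i3, j)), e i3 j (x i3 j) & on_side s (x i3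
    j)] by apply: m3; rewrite !inE eqxx !orbT.
  have cle i : closed (e i j).
    apply: component_closed; rewrite setDE; apply: closedI; last exact: open_closedC.
    by have [] := NP i.
  have ce i : connected (e i j) by exact: component_connected.
  have cX : connected (X j).
    apply: connectedU => //; last first.
      apply: connectedU => //; last by apply: connectedU => //; exists (w (i1, j)).
      by exists (w (i2, j)); split => //; left.
    by exists (w (i3, j)); split => //; left; left.
  have XLW : X j `<=` L `\` W.
    move=> u [[[Mu|/eL //]|/eL //]|/eL //].
    split; first exact: ML Mu.
    by move=> Wu; apply: (MWj u Mu); exact: subset_closure.
  split => //; first by do !apply: closedU.
  apply: contrapT => /eqP/set0P [u [Xu Yu]].
  have XC : X j `<=` C.
    apply: subset_component => //; first exact: subset_trans XLW LWF.
    by exists u; split => //; exact: YC.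
  rewrite -[False]/(set0 (w (i1, j))) -MC; split => //; apply: XC; by left; left; left.
have [s0 offs] : (0 < s.2.2)%R /\ forall u, (L `\` W) u -> off_box s u.
  have [? _] := Woff s z sl (nNone _ (QLW z Qz)) (QLW z Qz).2.
  by split => // u LWu; have [] := Woff s u sl (nNone _ LWu) LWu.2.
pose f i := (coord s (y i)).1.
(* The limit exits are different because the [N i] lie in disjoint closures of the [P i]. *)
have fneq i i' : i \in [:: i1; i2; i3] -> i' \in [:: i1; i2; i3] -> i != i' -> (f i != f i')%R.
  move=> ii ii' nii; apply/eqP => ff.
  have E0 : coord s (y i) = coord s (y i').
    have [_ _ a1] := ony i ii; have [_ _ a2] := ony i' ii'.
    by move: ff a1 a2; rewrite /f; case: (coord s (y i)) => a b;
      case: (coord s (y i')) => a' b' /= -> -> ->.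
  have Ey' : y i = y i' by apply: coord_inj E0; exact: nNone (yLW _).
  have [_ _ _ N1 _] := NP i; have [_ _ _ N2 _] := NP i'.
  rewrite -[False]/(set0 (y i)) -(PP i i' nii); split; first exact: N1.
  by rewrite Ey'; exact: N2.
have m1 : i1 \in [:: i1; i2; i3] by rewrite !inE eqxx.
have m2 : i2 \in [:: i1; i2; i3] by rewrite !inE eqxx orbT.
have m3 : i3 \in [:: i1; i2; i3] by rewrite !inE eqxx !orbT.
have [a [b [c [am bm cm fab fbc]]]] :=
  sort3 (fneq i1 i2 m1 m2 n12) (fneq i1 i3 m1 m3 n13) (fneq i2 i3 m2 m3 n23).
have g1 : (0 < f b - f a)%R by rewrite subr_gt0.
have g2 : (0 < f c - f b)%R by rewrite subr_gt0.
have nab := ultraI uU (ultraI uU (nearx a _ g1) (nearx b _ g2)) (ultraI uU (nearx c _ g2) (nearx b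
  _ g1)).
have [j [[axj [clX conX XLW XY]] [[/near_pointsP [a1 a2 _ _] /near_pointsP [b1 b2 _ _]]
  [/near_pointsP [c1 c2 _ _] /near_pointsP [b3 b4 _ _]]]]] :=
  ultra_ex uU (ultraI uU (ultraI uU allx XP) nab).
have Xx i : i \in [:: i1; i2; i3] -> X j (x i j).
  move=> ii; have [_ _ + _] := axj i ii.
  by move: ii; rewrite !inE => /or3P[] /eqP -> ?; [left; left; right|left; right|right].
have Yy i : i \in [:: i1; i2; i3] -> Y (y i).
  by rewrite !inE => /or3P[] /eqP ->; [left; left; right|left; right|right].
have sx i : i \in [:: i1; i2; i3] -> on_side s (x i j) by move=> ii; have [] := axj i ii.
have XN : ~ X j None by move=> /XLW [_]; apply.
have YN : ~ Y None by move=> /YLW [_]; apply.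
have offX u : X j u -> off_box s u by move=> /XLW; exact: offs.
have offY u : Y u -> off_box s u by move=> /YLW; exact: offs.
(* Three exits are needed because [x b j] may fall on either side of [y b]. In increasing order
   along [s] one finds [y a], [x b j], [y b], [x c j] in the first case and [x a j], [y b], [x b j],
   [y c] in the second. *)
have [g|g|g] := ltrgtP (coord s (x b j)).1 (f b).
- apply: (@linked_continua _ s Y (X j) (y a) (x b j) (y b) (x c j)) => //.
  + by rewrite setIC.
  + exact: Yy.
  + exact: Yy.
  + exact: Xx.
  + exact: Xx.
  + exact: ony.
  + exact: ony.
  + exact: sx.
  + exact: sx.
  + rewrite /f in a1 a2 b1 b2 b3 b4 c1 c2 g1 g2 fab fbc *; lra.
  + rewrite /f in a1 a2 b1 b2 b3 b4 c1 c2 g1 g2 fab fbc *; lra.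
- apply: (@linked_continua _ s (X j) Y (x a j) (y b) (x b j) (y c)) => //.
  + exact: Xx.
  + exact: Xx.
  + exact: Yy.
  + exact: Yy.
  + exact: sx.
  + exact: sx.
  + exact: ony.
  + exact: ony.
  + rewrite /f in a1 a2 b1 b2 b3 b4 c1 c2 g1 g2 fab fbc *; lra.
  + rewrite /f in a1 a2 b1 b2 b3 b4 c1 c2 g1 g2 fab fbc *; lra.
- have E0 : coord s (x b j) = coord s (y b).
    have [_ _ k1] := sx b bm; have [_ _ k2] := ony b bm.
    by move: g k1 k2; rewrite /f; case: (coord s (x b j)) => u v;
      case: (coord s (y b)) => u' v' /= -> -> ->.
  have Eq : x b j = y b.
    by apply: coord_inj E0; [exact: nNone (XLW _ (Xx b bm))|exact: nNone (yLW b)].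
  by rewrite -[False]/(set0 (y b)) -XY; split; [rewrite -Eq; exact: Xx|exact: Yy].
Qed.
End Collapse.
End Planar.

(** * Metrizability of the hyperspace *)

Section SaturatedTopology.
Variable R : realType.

(* The saturated open sets form the topology of the quotient by [D], pulled back to the sphere:
   it is normal, though not Hausdorff. *)
Definition sat_space (D : set (set (Chat R))) : Type := Chat R.

Definition saturated (D : set (set (Chat R))) (A : set (Chat R)) :=
  forall d, D d -> d `&` A !=set0 -> d `<=` A.

Variable D : set (set (Chat R)).

Definition sat_open : set_system (sat_space D) := [set O : set (Chat R) | open O /\ saturated D O].

Lemma sat_openT : sat_open setT.
Proof. by split; [exact: openT|move=> d _ _ x]. Qed.

Lemma sat_openI : setI_closed sat_open.
Proof.
move=> A B [oA sA] [oB sB]; split; first exact: openI.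
move=> d Dd [x [dx [Ax Bx]]] y dy; split; [apply: (sA d)|apply: (sB d)] => //; by exists x.
Qed.

Lemma sat_open_bigcup (I : Type) (f : I -> set (sat_space D)) :
  (forall i, sat_open (f i)) -> sat_open (\bigcup_i f i).
Proof.
move=> of_; split; first by apply: bigcup_open => i _; case: (of_ i).
move=> d Dd [x [dx [i _ fx]]] y dy; exists i => //.
by have [_ /(_ d Dd)] := of_ i; apply => //; exists x.
Qed.

HB.instance Definition _ := Choice.copy (sat_space D) (Chat R).
HB.instance Definition _ := isOpenTopological.Build (sat_space D) sat_openT sat_openI
  sat_open_bigcup.
End SaturatedTopology.

Section Metrization.
Variable R : realType.
Local Notation T := (Chat R).
Let hT := @hausdorff_Chat R.
Let cT := @compact_Chat R.
Variables (K : set T) (D : set (set T)).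
Hypotheses (cK : compact K) (mD : monotone_decomposition K D).

(** The largest saturated subset of [O]; upper semicontinuity makes it open when [O] is. *)
Definition sat_interior (O : set T) : set T := [set x | O x /\ forall d, D d -> d x -> d `<=` O].

Lemma sat_interior_open O : open O -> open (sat_interior O).
Proof.
move=> oO; rewrite openE => x [Ox xO].
have clK : closed K by exact: cpt_closed.
case: (pselect (K x)) => [Kx|nKx].
  have [d Dd dx] := mono_cover mD Kx.
  have [V [oV dV VO]] := mono_usc mD Dd oO (xO d Dd dx).
  rewrite /interior nbhsE; exists (V `&` O); first by split; [exact: openI|split => //; exact: dV].
  by move=> y [Vy Oy]; split => // e De ey; apply: VO => //; exists y.
rewrite /interior nbhsE; exists (O `&` ~` K).
  by split => //; apply: openI => //; exact: closed_openC.
by move=> y [Oy nKy]; split => // e De ey; case: nKy; apply: (mono_subset mD De).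
Qed.

Lemma sat_interior_saturated O : saturated D (sat_interior O).
Proof.
move=> d Dd [x [dx [Ox xO]]] y dy; have dO := xO d Dd dx; split; first exact: dO.
by move=> e De ey; rewrite -(mono_eq mD Dd De dy ey).
Qed.

Lemma sat_interior_sub O d : D d -> d `<=` O -> d `<=` sat_interior O.
Proof.
move=> Dd dO x dx; split; first exact: dO.
by move=> e De ex; rewrite -(mono_eq mD Dd De dx ex).
Qed.

Lemma saturatedC A : saturated D A -> saturated D (~` A).
Proof.
move=> sA d Dd [x [dx nAx]] y dy Ay; apply: nAx.
by apply: (sA d) => //; exists y.
Qed.

Lemma saturated_sub_interior A O : saturated D A -> A `<=` O -> A `<=` sat_interior O.
Proof.
move=> sA AO x Ax; split; first exact: AO.
by move=> d Dd dx y dy; apply: AO; apply: (sA d) => //; exists x.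
Qed.

Lemma sat_closedP (A : set (sat_space D)) : closed A <-> closed (A : set T) /\ saturated D A.
Proof.
split=> [/closed_openC [oA sA]|[cA sA]].
  by split; [rewrite -[A]setCK; exact: open_closedC|rewrite -[A]setCK; exact: saturatedC].
rewrite -[A]setCK; apply: open_closedC; split; first exact: closed_openC.
exact: saturatedC.
Qed.

Lemma sat_normal : normal_space (sat_space D).
Proof.
apply/(@normal_openP R) => A B /sat_closedP [cA sA] /sat_closedP [cB sB] AB.
have [ O [ O' [oO oO' AO BO' OO']]] := normal_sep hT cT cA cB AB.
exists (sat_interior O), (sat_interior O'); split.
- by split; [exact: sat_interior_open|exact: sat_interior_saturated].
- by split; [exact: sat_interior_open|exact: sat_interior_saturated].
- exact: saturated_sub_interior.
- exact: saturated_sub_interior.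
- by apply/seteqP; split => // x [[ Ox _] [ O'x _]]; rewrite -OO'.
Qed.

(** A Urysohn function of the quotient, read on the sphere. *)
Definition separating (A B : set T) (h : T -> R) := [/\ continuous h,
  forall x, (0 <= h x <= 1)%R, forall d x y, D d -> d x -> d y -> h x = h y,
  forall d x, D d -> d `<=` A -> d x -> h x = 0%R
  & forall d x, D d -> ~ d `<=` B -> d x -> h x = 1%R].

(** [S] is found before [A] and [B], which in the application are finite unions of basic open sets
    squeezed between [d] and [S] and between [d] and [O]. The function is Urysohn's in the saturated
    topology, for the complements of the saturated interiors of [S'] and of [O]. *)
Lemma separating_ex d O : D d -> open O -> d `<=` O -> exists S : set T,
  [/\ open S, d `<=` S & forall A B, A `<=` S -> d `<=` O -> sat_interior O `<=` B ->
    exists h, separating A B h].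
Proof.
move=> Dd oO dO.
have cd := mono_closed mD Dd.
have oSO := sat_interior_open oO.
have dSO := sat_interior_sub Dd dO.
have [|S [ S' [oS oS' dS BS' SS']]] := normal_sep hT cT cd (open_closedC oSO).
  by apply/seteqP; split => // x [/dSO].
exists S; split => // A B AS _ OB.
pose A' : set (sat_space D) := ~` sat_interior S'.
pose B' : set (sat_space D) := ~` sat_interior O.
have cA' : closed A'.
  apply/sat_closedP; split; last exact/saturatedC/sat_interior_saturated.
  by apply: open_closedC; exact: sat_interior_open.
have cB' : closed B'.
  by apply/sat_closedP; split; [exact: open_closedC|exact/saturatedC/sat_interior_saturated].
have AB' : A' `&` B' = set0.
  apply/seteqP; split => // x [nA Bx]; apply: nA.
  by apply: (saturated_sub_interior _ BS') => //; exact/saturatedC/sat_interior_saturated.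
have /(@normal_separatorP R) /(_ A' B' cA' cB' AB') := sat_normal.
move=> /(@uniform_separatorP _ R) [h [ch h01 hA hB]].
have opq (V : set R) : open V -> sat_open (D := D) (h @^-1` V).
  by move=> oV; have /continuousP := ch; exact.
exists h; split.
- by apply/continuousP => V oV; case: (opq V oV).
- by move=> x; have /= := h01 (h x) (ex_intro2 _ _ x I erefl); rewrite in_itv.
- move=> e x y De ex ey; apply: contrapT => hxy.
  have oV : open [set r : R | r != h y] by exact: open_neq.
  have [_ /(_ e De)] := opq _ oV => /(_ _ y ey) /=.
  by rewrite eqxx => H; have : false by apply: H; exists x; split => //=; apply/eqP.
- move=> e x De eA ex; apply: hA; exists x => //; move=> [S'x _].
  by rewrite -[False]/(set0 x) -SS'; split => //; apply: AS; exact: eA.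
- move=> e x De eB ex; apply: hB; exists x => //= Sx; apply: eB.
  apply: subset_trans OB; apply: (sat_interior_saturated De); by exists x.
Qed.

End Metrization.

(** * A countable base of the sphere and the metric built from it *)

Section Base.
Local Open Scope ring_scope.
Variable R : realType.
Local Notation T := (Chat R).
Local Notation Re := complex.Re.
Local Notation Im := complex.Im.
Definition base_index := (rat * rat * rat + rat)%type.

Definition base (b : base_index) : set T := match b with
  | inl (p, q, r) => [set x : T | if x is Some w
      then `|Re w - ratr p| < ratr r /\ `|Im w - ratr q| < ratr r else False]
  | inr r => [set x : T | if x is Some w then ratr r < `|Re w| \/ ratr r < `|Im w| else True]
  end.

Lemma open_base b : open (base b).
Proof.
rewrite openE; case: b => [[[p q] r]|r] [w|] //=.
- move=> [h1 h2]; rewrite /interior; apply/nbhs_some.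
  exists (Num.min (ratr r - `|Re w - ratr p|) (ratr r - `|Im w - ratr q|)).
    by rewrite lt_min !subr_gt0 h1.
  move=> v; rewrite !lt_min => /andP[k1 _] /andP[_ k2] /=.
  have := ler_distD (Re w) (Re v) (ratr p); have := ler_distD (Im w) (Im v) (ratr q).
  by split; lra.
- move=> h; rewrite /interior; apply/nbhs_some; case: h => h.
    exists (`|Re w| - ratr r); first by rewrite subr_gt0.
    by move=> v k _ /=; left; have := lerB_dist (Re w) (Re v); rewrite distrC; lra.
  exists (`|Im w| - ratr r); first by rewrite subr_gt0.
  by move=> v _ k /=; right; have := lerB_dist (Im w) (Im v); rewrite distrC; lra.
- by move=> _; rewrite /interior; apply/nbhs_none; split => //; exists (ratr r).
Qed.

Lemma base_nbhs (x : T) (V : set T) : nbhs x V -> exists2 b, base b x & base b `<=` V.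
Proof.
case: x => [w|] /=.
  move=> /nbhs_some [e e0 eV].
  have e2 : 0 < e / 2 by rewrite divr_gt0.
  have [r] := rat_in_itvoo e2; rewrite in_itv /= => /andP[r0 re].
  have app (a : R) : exists p : rat, `|a - ratr p| < ratr r.
    have /rat_in_itvoo [p] : a - ratr r < a + ratr r by lra.
    by rewrite in_itv /= => /andP[h1 h2]; exists p; rewrite ltr_norml; apply/andP; lra.
  have [p hp] := app (Re w); have [q hq] := app (Im w).
  exists (inl (p, q, r)) => // -[v|] //= [h1 h2]; apply: eV.
    by have := ler_distD (ratr p) (Re v) (Re w); rewrite [X in (_ <= _ + X)%R]distrC; lra.
  by have := ler_distD (ratr q) (Im v) (Im w); rewrite [X in (_ <= _ + X)%R]distrC; lra.
move=> /nbhs_none [VN [M MV]].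
have /rat_in_itvoo [r] : M < M + 1 by rewrite ltrDl.
rewrite in_itv /= => /andP[Mr _].
exists (inr r) => // -[v|] //= h; apply: MV.
by case: h => h; [left|right]; exact: lt_trans h.
Qed.

Definition base_union (s : seq base_index) : set T := \bigcup_(b in [set` s]) base b.

Lemma open_base_union s : open (base_union s).
Proof. by apply: bigcup_open => b _; exact: open_base. Qed.

Lemma base_union_cover (A O : set T) : closed A -> open O -> A `<=` O ->
  exists s, A `<=` base_union s /\ base_union s `<=` O.
Proof.
move=> cA oO AO; have := closed_cpt (@compact_Chat R) cA; rewrite compact_cover.
move=> /(_ base_index [set b | base b `<=` O] base (fun b _ => @open_base b)).
case=> [x Ax|D' D'O cov].
  have [b bx bO] : exists2 b, base b x & base b `<=` O.
    by apply: base_nbhs; apply: open_nbhs_nbhs; split => //; exact: AO.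
  by exists b.
exists (enum_fset D'); split; first by move=> x /cov.
by move=> x [b bD]; exact: (set_mem (D'O b bD)).
Qed.
End Base.

Section Metric.
Variable R : realType.
Local Notation T := (Chat R).
Let hT := @hausdorff_Chat R.
Let cT := @compact_Chat R.
Variables (K : set T) (D : set (set T)).
Hypotheses (cK : compact K) (mD : monotone_decomposition K D).
Local Notation sep := (separating D).

(** One function per pair of finite unions of basic open sets suffices, the pairs being coded by
    integers. With [set0] and [setT] the separation clauses are vacuous and only continuity, bounds
    and constancy on elements remain, so a code without a separating function can receive the zero
    function. *)
Lemma separating_family : exists h : nat -> T -> R, (forall n, sep set0 setT (h n)) /\
  forall d O, D d -> open O -> d `<=` O -> exists n, (forall x, d x -> h n x = 0%R) /\
    forall e x, D e -> e x -> ~ e `<=` O -> h n x = 1%R.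
Proof.
have sep0 : sep set0 setT (fun=> 0%R).
  split => //; [by move=> x; exact: cst_continuous|by move=> x; rewrite lexx ler01|].
  by move=> d x _ nd; case: nd.
have sepW A B h : sep A B h -> sep set0 setT h.
  case=> h1 h2 h3 h4 h5; split => // d x Dd dA dx.
    by have := dA x dx.
  by case: dA.
pose code (s t : seq base_index) := choice.pickle (s, t).
have /choice [h hP] : forall n : nat, exists h, sep set0 setT h /\
    forall s t, code s t = n ->
    (exists h, sep (base_union (R := R) s) (base_union (R := R) t) h) ->
    sep (base_union (R := R) s) (base_union (R := R) t) h.
  move=> n; case E : (choice.unpickle n : option (seq base_index * seq base_index)) => [[s t]|];
    last first.
    exists (fun=> 0%R); split => // s t st; by move: E; rewrite -st /code choice.pickleK.
  case: (pselect (exists h, sep (base_union (R := R) s) (base_union (R := R) t) h)) => [[h hh]|no].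
    exists h; split; first exact: sepW hh.
    by move=> s' t' st _; move: E; rewrite -st /code choice.pickleK => -[-> ->].
  exists (fun=> 0%R); split => // s' t' st; move: E;
    rewrite -st /code choice.pickleK => -[-> ->] yes.
  by case: no.
exists h; split; first by move=> n; case: (hP n).
move=> d O Dd oO dO.
have cd := mono_closed mD Dd.
have [t [dt tO]] := base_union_cover cd oO dO.
have [S [oS dS SP]] := separating_ex cK mD Dd (@open_base_union R t) dt.
have [s [ds sS]] := base_union_cover cd oS dS.
have [_ /(_ s t erefl) hst] := hP (code s t).
have [] := hst; first by apply: (SP _ _ sS dt) => x [].
move=> _ _ _ h0 h1; exists (code s t); split; first by move=> x dx; exact: (h0 d).
by move=> e x De ex eO; apply: (h1 e) => // et; apply: eO; exact: subset_trans tO.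
Qed.

(** The distance is the supremum of the weighted differences [2^-n |h_n - h_n|] at chosen points of
    the two elements. A function separating [d] from an open set makes a small ball fit into it;
    conversely, finitely many differences are small near [x] by continuity and the others by their
    weights. *)
Lemma hyper_metrizable : exists dist : set T -> set T -> R, metric_on D dist /\
  forall W, hyper_open K D W <-> mopen D dist W.
Proof.
have [h [hs hd]] := separating_family.
pose p (d : set T) : T := get d.
have dp d : D d -> d (p d) by move=> Dd; have [x dx] := mono_nonempty mD Dd; exact: (getI dx).
pose v n d e : R := (2^-1 ^+ n * `|h n (p d) - h n (p e)|)%R.
pose S d e := [set r | exists n, r = v n d e].
have q0 n : (0 < 2^-1 ^+ n :> R)%R by rewrite exprn_gt0.
have q1 n : (2^-1 ^+ n <= 1 :> R)%R by rewrite exprn_ile1 ?invr_ge0 // invf_le1 // ler1n.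
have v0 n d e : (0 <= v n d e)%R by rewrite mulr_ge0 // ltW.
have h01 n x : (0 <= h n x <= 1)%R by case: (hs n).
have hle n x y : (`|h n x - h n y| <= 1)%R.
  by have /andP[a1 a2] := h01 n x; have /andP[b1 b2] := h01 n y; rewrite ler_norml; lra.
have vle n d e : (v n d e <= 2^-1 ^+ n)%R by rewrite ler_piMr // ltW.
have hasS d e : has_sup (S d e).
  by split; [exists (v 0%N d e), 0%N|exists 1%R => _ [n ->]; exact: le_trans (vle _ _ _) (q1 n)].
pose dist d e := sup (S d e).
have vdist n d e : (v n d e <= dist d e)%R by apply: sup_upper_bound => //; exists n.
have distle d e c : (forall n, v n d e <= c)%R -> (dist d e <= c)%R.
  by move=> hc; apply: ge_sup; [case: (hasS d e)|move=> _ [n ->]].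
have dist0 d e : (0 <= dist d e)%R by exact: le_trans (vdist 0%N d e).
have hconst n d x y : D d -> d x -> d y -> h n x = h n y by case: (hs n) => _ _ H _ _; exact: H.
have sym d e : dist d e = dist e d.
  by congr sup; apply/seteqP; split => _ [n ->]; exists n; rewrite /v distrC.
exists dist; split.
  split => //.
  - move=> d e Dd De; split => [E|->]; last first.
      apply: le_anti; rewrite dist0 andbT; apply: distle => n.
      by rewrite /v subrr normr0 mulr0.
    apply: contrapT => de.
    have op : open (~` [set p e]).
      by apply: closed_openC; exact: accessible_closed_set1 (hausdorff_accessible hT) _.
    have [|n [hd0 he1]] := hd d _ Dd op.
      by move=> x dx xe; apply: de; apply: (mono_eq mD Dd De dx); rewrite xe; exact: dp.
    have := vdist n d e; rewrite E /v hd0; last exact: dp.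
    rewrite (he1 e) //; first by rewrite sub0r normrN1 mulr1 leNgt q0.
      exact: dp.
    by move=> H; apply: (H (p e) (dp e De)).
  - move=> a b c Da Db Dc; apply: distle => n.
    apply: le_trans (lerD (vdist n a b) (vdist n b c)).
    by rewrite /v -mulrDr; apply: ler_wpM2l; [exact: ltW|exact: ler_distD].
move=> W; split => [[WD [V [oV VE]]]|[WD oW]]; split => //.
  move=> d Wd; have Dd := WD _ Wd.
  have WV e : D e -> e `<=` V -> W e.
    move=> De eV; have ep := dp e De.
    have : (V `&` K) (p e) by split; [exact: eV|exact: (mono_subset mD De)].
    by rewrite -VE => -[e' We' e'p]; rewrite (mono_eq mD De (WD _ We') ep e'p).
  have dV : d `<=` V.
    by move=> x dx; have : (V `&` K) x by [rewrite -VE; exists d|]; case.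
  have [n [hn0 hn1]] := hd d V Dd oV dV.
  exists (2^-1 ^+ n)%R => // e [De de]; apply: (WV e De); apply: contrapT => eV.
  move: (le_lt_trans (vdist n d e) de); rewrite /v hn0; last exact: dp.
  by rewrite (hn1 e) ?sub0r ?normrN1 ?mulr1 ?ltxx //; exact: dp.
(* Adding all points outside [K] leaves the trace on [K] unchanged, and the complement of [K] is
   already open. *)
exists [set y | K y -> exists2 d, W d & d y].
have clK : closed K by exact: cpt_closed.
split; last first.
  apply/seteqP; split => [x [d Wd dx]|x [Wx Kx]]; last by have [d Wd dx] := Wx Kx; exists d.
  by split; [move=> _; exists d|apply: (mono_subset mD (WD _ Wd))].
rewrite openE => x Vx; case: (pselect (K x)) => Kx; last first.
  rewrite /interior nbhsE; exists (~` K); last by move=> y nKy /nKy.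
  by split => //; exact: closed_openC.
have [d Wd dx] := Vx Kx; have Dd := WD _ Wd; have [r r0 rW] := oW d Wd.
have near m : \forall y \near x, forall n, (n < m)%N -> (`|h n x - h n y| < r / 2)%R.
  elim: m => [|m IH]; first by apply: (@filterS _ (nbhs x) _ setT) => [y _ n|];
    [rewrite ltn0|exact: filterT].
  have r2 : (0 < r / 2)%R by rewrite divr_gt0.
  have hm : \forall y \near x, (`|h m x - h m y| < r / 2)%R.
    have [cm _ _ _ _] := hs m; exact: (cvgr_dist_lt _ _ (cm x)).
  apply: filterS2 IH hm => y H1 H2 n; rewrite ltnS leq_eqVlt => /orP[/eqP ->//|]; exact: H1.
have [m mr] : exists m, (2^-1 ^+ m < r :> R)%R.
  have ri : (0 <= r^-1)%R by rewrite invr_ge0 ltW.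
  exists (Num.bound r^-1); rewrite exprVn invf_plt ?posrE ?exprn_gt0 //.
  apply: lt_trans (archi_boundP ri) _; by rewrite -natrX ltr_nat ltn_expl.
rewrite /interior; apply: filterS (near m) => y hy Ky.
have [e De ey] := mono_cover mD Ky; exists e => //; apply: rW; split => //.
(* A bound strictly below [r] is needed, as a supremum inherits only non-strict inequalities. *)
apply: (@le_lt_trans _ _ (Num.max (r / 2) (2^-1 ^+ m)))%R; last first.
  by rewrite gt_max mr andbT ltr_pdivrMr // ltr_pMr // ltr1n.
apply: distle => n; rewrite le_max; have [nm|mn] := ltnP n m.
  apply/orP; left; apply: le_trans (ltW (hy n nm)).
  by rewrite /v (hconst n d _ x Dd (dp d Dd) dx) (hconst n e _ y De (dp e De) ey) ler_piMl.
apply/orP; right; apply: le_trans (vle _ _ _) _.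
by rewrite ler_wiXn2l ?invr_ge0 // invf_le1 // ler1n.
Qed.
End Metric.

(** * Rational maps *)

Section RationalMaps.
Local Open Scope ring_scope.
Variable R : realType.
Local Notation C := R[i].
Local Notation T := (Chat R).
Local Notation N := (@Normc.normc R).

Lemma normc0 : N 0 = 0.
Proof. exact: Normc.normc0. Qed.

Lemma normc1 : N 1 = 1.
Proof. exact: Normc.normc1. Qed.

Lemma normcM (x y : C) : N (x * y) = N x * N y.
Proof. exact: Normc.normcM. Qed.

Lemma normcV (x : C) : N x^-1 = (N x)^-1.
Proof. exact: Normc.normcV. Qed.

Lemma normcN (x : C) : N (- x) = N x.
Proof. by rewrite -mulN1r normcM /= oppr0 sqrrN expr1n expr0n /= addr0 sqrtr1 mul1r. Qed.

Lemma le_normcD (x y : C) : N (x + y) <= N x + N y.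
Proof. rewrite -lecR rmorphD; exact: (ler_normD (x : R[i]) y). Qed.

Lemma normc_ge0 (z : C) : 0 <= N z.
Proof. by case: z => a b; exact: sqrtr_ge0. Qed.

Lemma normc_gt0 (z : C) : (0 < N z) = (z != 0).
Proof.
rewrite lt0r normc_ge0 andbT; congr (~~ _); apply/eqP/eqP => [/Normc.eq0_normc //|->].
exact: normc0.
Qed.

Lemma normc_sub (x y : C) : N (x - y) = N (y - x).
Proof. by rewrite -normcN opprB. Qed.

Lemma normc_le_sub (x y : C) : N x <= N (x - y) + N y.
Proof. by rewrite -{1}(subrK y x); exact: le_normcD. Qed.

Lemma nbhs_someN (z : C) (P : set T) : nbhs (Some z : T) P <->
  exists2 e : R, 0 < e & forall w, N (w - z) < e -> P (Some w).
Proof.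
have reB (w : C) : complex.Re (w - z) = complex.Re w - complex.Re z by case: (w); case: (z).
have imB (w : C) : complex.Im (w - z) = complex.Im w - complex.Im z by case: (w); case: (z).
split=> [/nbhs_some [e e0 eP]|[e e0 eP]].
  exists e => // w wz; apply: eP; rewrite -?reB -?imB; apply: le_lt_trans wz; rewrite -lecR.
    exact: normc_ge_Re.
  exact: normc_Im.
apply/nbhs_some; exists (e / 2); first by rewrite divr_gt0.
move=> w h1 h2; apply: eP; have : N (w - z) <= `|complex.Re (w - z)| + `|complex.Im (w - z)|.
  by rewrite -lecR; exact: normc_ReIm.
by rewrite reB imB; lra.
Qed.

Lemma nbhs_noneN (P : set T) : nbhs (None : T) P <->
  P None /\ exists2 M : R, 0 < M & forall w, M < N w -> P (Some w).
Proof.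
split=> [/nbhs_none [PN [r rP]]|[PN [M M0 MP]]].
  split => //; exists (2 * `|r| + 1); first by rewrite ltr_wpDl // mulr_ge0.
  move=> w hw; apply: rP.
  have h : N w <= `|complex.Re w| + `|complex.Im w| by rewrite -lecR; exact: normc_ReIm.
  have := ler_norm r; case: (ltP r `|complex.Re w|) => h1; first by left.
  case: (ltP r `|complex.Im w|) => h2; first by right.
  by lra.
apply/nbhs_none; split => //; exists M => w h; apply: MP; case: h => h; apply: (lt_le_trans h);
  rewrite -lecR.
  exact: normc_ge_Re.
exact: normc_Im.
Qed.

(* The point of the sphere with homogeneous coordinates [a : b]. *)
Definition hpoint (a b : C) : T := if b == 0 then None else Some (a / b).

Definition nz (a b : C) := (a != 0) || (b != 0).

Lemma hpoint_eq (a b c d : C) : nz a b -> nz c d -> (hpoint a b = hpoint c d <-> a * d = b * c).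
Proof.
rewrite /nz /hpoint; have [->|b0] := eqVneq b 0; have [->|d0] := eqVneq d 0; rewrite ?orbF ?orbT /=.
- by rewrite mulr0 mul0r.
- move=> a0 _; split => // /eqP; by rewrite mul0r mulf_eq0 (negbTE a0) (negbTE d0).
- move=> _ c0; split => // /eqP; by rewrite mulr0 eq_sym mulf_eq0 (negbTE c0) (negbTE b0).
- move=> _ _; split => [[/eqP]|E].
    by rewrite eqr_div // => /eqP ->; rewrite mulrC.
  by congr Some; apply/eqP; rewrite eqr_div // E mulrC.
Qed.

Lemma hpoint_scale (a b c : C) : c != 0 -> hpoint (c * a) (c * b) = hpoint a b.
Proof.
move=> c0; rewrite /hpoint mulf_eq0 (negbTE c0) /=; case: eqP => // _.
by rewrite -mulf_div divff // mul1r.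
Qed.

Lemma hpoint_near (a0 b0 : C) (V : set T) : nz a0 b0 -> nbhs (hpoint a0 b0) V ->
  exists2 e : R, 0 < e & forall a b, N (a - a0) < e -> N (b - b0) < e -> V (hpoint a b).
Proof.
rewrite /nz /hpoint; have [->|bn] := eqVneq b0 0; rewrite ?orbF ?orbT /=.
  move=> an /nbhs_noneN [VN [M M0 MV]].
  have A0 : 0 < N a0 by rewrite normc_gt0.
  exists (Num.min (N a0 / 2) (N a0 / (2 * M))).
    by rewrite lt_min !divr_gt0 // mulr_gt0.
  move=> a b; rewrite !lt_min subr0 => /andP[h1 _] /andP[_ h2].
  case: eqVneq => // bn; apply: MV.
  have B0 : 0 < N b by rewrite normc_gt0.
  have := normc_le_sub a0 a; rewrite normc_sub => h3.
  rewrite normcM normcV ltr_pdivlMr //.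
  have : M * N b < N a0 / 2.
    by move: h2; rewrite ltr_pdivlMr ?mulr_gt0 // ltr_pdivlMr //; lra.
  by lra.
move=> _ /nbhs_someN [d d0 dV].
have B0 : 0 < N b0 by rewrite normc_gt0.
have A0 := normc_ge0 a0.
(* Chosen so that the numerator of [a / b - a0 / b0] is at most [d |b0| (|b0| / 2)], while
   [|b| > |b0| / 2]. *)
pose K := 2 * (N a0 + N b0).
have K0 : 0 < K by rewrite mulr_gt0 // ltr_wpDl.
exists (Num.min (N b0 / 2) (d * (N b0 * N b0) / K)).
  by rewrite lt_min !divr_gt0 // !mulr_gt0.
move=> a b; rewrite !lt_min => /andP[_ h1] /andP[h2 h3].
have hb := normc_le_sub b0 b; rewrite normc_sub in hb.
have Bb : N b0 / 2 < N b by lra.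
have bn' : b != 0 by rewrite -normc_gt0; lra.
rewrite (negbTE bn'); apply: dV.
have -> : a / b - a0 / b0 = ((a - a0) * b0 - a0 * (b - b0)) / (b * b0) by field; rewrite bn bn'.
rewrite normcM normcV normcM ltr_pdivrMr; last by rewrite mulr_gt0 // normc_gt0.
have t : N ((a - a0) * b0 - a0 * (b - b0)) <= N (a - a0) * N b0 + N a0 * N (b - b0).
  by apply: le_trans (le_normcD _ _) _; rewrite normcN !normcM.
apply: (le_lt_trans t).
rewrite ltr_pdivlMr // in h1; rewrite ltr_pdivlMr // in h3.
have k1 : N (a - a0) * K * N b0 <= d * (N b0 * N b0) * N b0 by rewrite ler_wpM2r ?normc_ge0 // ltW.
have k2 : N (b - b0) * K * N a0 <= d * (N b0 * N b0) * N a0 by rewrite ler_wpM2r ?normc_ge0 // ltW.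
have k3 : (N (a - a0) * N b0 + N a0 * N (b - b0)) * K <= d * (N b0 * N b0) * (N a0 + N b0) by lra.
have k4 : d * (N b0 * N b0) * (N a0 + N b0) = (d * N b0 * (N b0 / 2)) * K by rewrite /K; field.
rewrite k4 ler_pM2r // in k3; apply: (le_lt_trans k3).
by rewrite -mulrA ltr_pM2l // mulrC ltr_pM2r.
Qed.

(** One keeps a nonzero coordinate fixed, [b0] if possible and else [a0], and solves for the
    other. *)
Lemma hpoint_lift (a0 b0 : C) (e : R) : nz a0 b0 -> 0 < e ->
  nbhs (hpoint a0 b0) [set w : T | exists a b, [/\ w = hpoint a b, nz a b, N (a - a0) < e & N (b -
    b0) < e]].
Proof.
move=> n0 e0; move: (n0); rewrite /nz {1}/hpoint; have [E|bn] := eqVneq b0 0;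
  rewrite ?orbF ?orbT /=.
  move=> an; apply/nbhs_noneN; have A0 : 0 < N a0 by rewrite normc_gt0.
  split.
    by exists a0, 0; rewrite /hpoint eqxx /nz an E !subrr normc0.
  exists (N a0 / e); first by rewrite divr_gt0.
  move=> w hw; have w0 : w != 0 by rewrite -normc_gt0; apply: lt_trans hw; rewrite divr_gt0.
  exists a0, (a0 / w); rewrite /nz an E subrr normc0 subr0; split => //.
    rewrite /hpoint mulf_eq0 invr_eq0 (negbTE an) (negbTE w0) /=; congr Some.
    by rewrite invf_div mulrCA divff // mulr1.
  by rewrite normcM normcV ltr_pdivrMr ?normc_gt0 // mulrC -ltr_pdivrMr.
move=> _; apply/nbhs_someN; have B0 : 0 < N b0 by rewrite normc_gt0.
exists (e / N b0); first by rewrite divr_gt0.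
move=> w hw; exists (w * b0), b0; rewrite /nz bn orbT subrr normc0; split => //.
  by rewrite /hpoint (negbTE bn) mulfK.
have -> : w * b0 - a0 = (w - a0 / b0) * b0 by rewrite mulrBl divfK.
by rewrite normcM -ltr_pdivlMr.
Qed.

Lemma horner_continuous (P : {poly C}) (z : C) (e : R) : 0 < e ->
  exists2 d : R, 0 < d & forall w, N (w - z) < d -> N (P.[w] - P.[z]) < e.
Proof.
elim/poly_ind: P e => [|P c IH] e e0.
  by exists 1 => // w _; rewrite !horner0 subrr normc0.
have z1 : 0 < N z + 1 by rewrite ltr_wpDl // normc_ge0.
have p1 : 0 < N P.[z] + 1 by rewrite ltr_wpDl // normc_ge0.
have [|{}d d0 {}dP] := IH (Num.min 1 (e / 2 / (N z + 1))).
  by rewrite lt_min ltr01 !divr_gt0.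
exists (Num.min (Num.min d 1) (e / 2 / (N P.[z] + 1))); first by rewrite !lt_min d0 ltr01 !divr_gt0.
move=> w; rewrite !lt_min => /andP[/andP[h1 h2] h3].
have := dP w h1; rewrite lt_min => /andP[k1 k2].
rewrite !hornerMXaddC.
have -> : P.[w] * w + c - (P.[z] * z + c) = (P.[w] - P.[z]) * w + P.[z] * (w - z) by ring.
apply: (le_lt_trans (le_normcD _ _)); rewrite !normcM.
have wz := normc_le_sub w z.
have a1 : N (P.[w] - P.[z]) * N w <= N (P.[w] - P.[z]) * (N z + 1) by rewrite ler_wpM2l ?normc_ge0
  //; lra.
have a2 : N P.[z] * N (w - z) <= (N P.[z] + 1) * N (w - z) by rewrite ler_wpM2r ?normc_ge0 //; lra.
rewrite ltr_pdivlMr // in k2; rewrite ltr_pdivlMr // mulrC in h3.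
by rewrite [ltRHS]splitr; apply: (le_lt_trans (lerD a1 a2)); exact: ltrD.
Qed.

(** A further factor [X - z] multiplies the constant coefficient by [|z|] in modulus and a bound on
    all coefficients by at most [1 + |z|], which is at most [|z| (1 + 1/d)] when [d <= |z|]. *)
Lemma coef_bound (s : seq C) (c : C) (d : R) : 0 < d -> (forall z, z \in s -> d <= N z) ->
  forall k, N (c *: \prod_(z <- s) ('X - z%:P))`_k <=
            N (c *: \prod_(z <- s) ('X - z%:P))`_0 * (1 + d^-1) ^+ size s.
Proof.
move=> d0; set P := fun s => c *: \prod_(z <- s) ('X - z%:P).
have B1 : 1 <= 1 + d^-1 by rewrite lerDl invr_ge0 ltW.
elim: s => [|z s IH] ds k.
  rewrite big_nil expr0 mulr1 !coefZ !coef1 /=; case: k => [|k] //=.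
  by rewrite mulr0 normc0 normc_ge0.
have {}IH := IH (fun y ys => ds y (mem_behead (s := z :: s) ys)).
have E : P (z :: s) = P s * ('X - z%:P) by rewrite /P big_cons -scalerAl mulrC.
rewrite -/(P (z :: s)) E.
have c0 : N (P s * ('X - z%:P))`_0 = N z * N (P s)`_0.
  by rewrite mulrBr coefB coefMX coefMC /= sub0r normcN normcM mulrC.
have zd : d <= N z by apply: ds; rewrite mem_head.
have z0 : 0 < N z by apply: lt_le_trans zd.
set a := N (P s)`_0; set b := (1 + d^-1) ^+ size s.
have a0 : 0 <= a by exact: normc_ge0.
have b1 : 1 <= b by rewrite exprn_ege1.
rewrite c0 -/a mulrBr coefB coefMX coefMC.
apply: (le_trans (le_normcD _ _)); rewrite normcN normcM.
have h1 : N (if k == 0%N then 0 else (P s)`_k.-1) <= a * b.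
  by case: ifP => _; [rewrite normc0 mulr_ge0 // (le_trans ler01)|exact: IH].
have h2 : N (P s)`_k * N z <= a * b * N z by rewrite ler_wpM2r ?normc_ge0 //; exact: IH.
apply: (le_trans (lerD h1 h2)).
rewrite /= exprS -/b.
have h3 : a * b <= a * b * (N z * d^-1).
  rewrite ler_peMr ?mulr_ge0 ?(le_trans ler01 b1) // ler_pdivlMr // mul1r //.
apply: (le_trans (lerD h3 (lexx _))).
by rewrite le_eqVlt; apply/orP; left; apply/eqP; ring.
Qed.

(** The contrapositive of [coef_bound]; it turns the openness of rational maps into an estimate on
    coefficients. *)
Lemma small_root (G : {poly C}) (d : R) m n : 0 < d -> (size G <= n.+1)%N ->
  N G`_0 * (1 + d^-1) ^+ n < N G`_m -> exists2 z, root G z & N z < d.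
Proof.
move=> d0 sG Gm; have [s Gs] := closed_field_poly_normal G.
have B1 : 1 <= 1 + d^-1 by rewrite lerDl invr_ge0 ltW.
have G0 : G != 0 by apply/eqP => G0; move: Gm; rewrite G0 !coef0 normc0 mul0r ltxx.
have lG : lead_coef G != 0 by rewrite lead_coef_eq0.
have [[z /andP[zs zd]]|no] := pselect (exists z, (z \in s) && (N z < d)).
  exists z => //; rewrite Gs rootZ // root_prod_XsubC //.
have ds z : z \in s -> d <= N z.
  by move=> zs; rewrite leNgt; apply/negP => zd; apply: no; exists z; rewrite zs zd.
have ss : (size s <= n)%N.
  by move: sG; rewrite Gs size_scale // size_prod_XsubC.
have := coef_bound (lead_coef G) d0 ds m; rewrite -Gs => h.
exfalso; move: Gm; apply/negP; rewrite -leNgt; apply: (le_trans h).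
by rewrite ler_wpM2l ?normc_ge0 // ler_weXn2l.
Qed.

(** No fibre equation [b P = a Q] holds identically, so the map is not constant. *)
Definition independent (P Q : {poly C}) := forall a b, nz a b -> b *: P - a *: Q != 0.

(** For [[a : b]] near [[a0 : b0]], the polynomial [b P - a Q] recentred at [z0] has a small
    constant coefficient, while its coefficient of some degree [m] stays away from [0]; [small_root]
    then solves the equation near [z0]. *)
Lemma hpoint_open (P Q : {poly C}) (z0 : C) (d : R) : independent P Q ->
  nz P.[z0] Q.[z0] -> 0 < d -> nbhs (hpoint P.[z0] Q.[z0])
    [set w : T | exists a b z, [/\ w = hpoint a b, nz a b, N (z - z0) < d & root (b *: P - a *: Q)
      z]].
Proof.
move=> ind n0 d0; set a0 := P.[z0]; set b0 := Q.[z0].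
pose sh (F : {poly C}) := F \Po ('X + z0%:P).
pose G a b := sh (b *: P - a *: Q).
have GE a b k : (G a b)`_k = b * (sh P)`_k - a * (sh Q)`_k.
  by rewrite /G /sh comp_polyB !comp_polyZ coefB !coefZ.
have G00 : (G a0 b0)`_0 = 0.
  rewrite -horner_coef0 /G /sh horner_comp !hornerE -/a0 -/b0.
  by rewrite mulrC subrr.
have [m Gm] : exists m, (G a0 b0)`_m != 0.
  have G0 : G a0 b0 != 0 by rewrite /G /sh comp_poly2_eq0 ?size_XaddC //; exact: ind.
  by exists (size (G a0 b0)).-1; rewrite -lead_coefE lead_coef_eq0.
pose n := maxn (size P) (size Q).
have sG a b : (size (G a b) <= n.+1)%N.
  rewrite /G /sh size_comp_poly2 ?size_XaddC // (leq_trans (size_polyD _ _)) // size_polyN.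
  rewrite geq_max !(leq_trans (size_scale_leq _ _)) //.
    by rewrite (leq_trans _ (leqnSn _)) // leq_max leqnn orbT.
  by rewrite (leq_trans _ (leqnSn _)) // leq_max leqnn.
pose K k := N (sh P)`_k + N (sh Q)`_k.
have K0 k : 0 <= K k by rewrite addr_ge0 // normc_ge0.
have diff a b k e : N (a - a0) < e -> N (b - b0) < e -> N ((G a b)`_k - (G a0 b0)`_k) <= e * K k.
  move=> h1 h2; have -> : (G a b)`_k - (G a0 b0)`_k = (b - b0) * (sh P)`_k - (a - a0) * (sh Q)`_k.
    by rewrite !GE; ring.
  apply: (le_trans (le_normcD _ _)); rewrite normcN !normcM /K mulrDr.
  by apply: lerD; rewrite ler_wpM2r ?normc_ge0 // ltW.
pose B := (1 + d^-1) ^+ n.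
have B0 : 0 < B by rewrite exprn_gt0 // ltr_wpDr // invr_ge0 ltW.
pose c := N (G a0 b0)`_m.
have c0 : 0 < c by rewrite normc_gt0.
(* With [e = c / S] one has [e K_0 B + e K_m + e = c], which leaves [|G_0| B < |G_m|]. *)
pose S := K 0%N * B + K m + 1.
have S0 : 0 < S by rewrite ltr_wpDl // addr_ge0 // mulr_ge0 // ltW.
pose e := c / S.
have e0 : 0 < e by rewrite divr_gt0.
apply: filterS (hpoint_lift n0 e0) => w [a [b [wE nab ha hb]]].
have h0 := diff a b 0%N e ha hb; rewrite G00 subr0 in h0.
have hm := diff a b m e ha hb; rewrite normc_sub in hm.
have [|z rz zd] := @small_root (G a b) d m n d0 (sG a b).
  rewrite -/B; have t := normc_le_sub (G a0 b0)`_m (G a b)`_m; rewrite -/c in t.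
  have u : N (G a b)`_0 * B <= e * K 0%N * B by rewrite ler_wpM2r // ltW.
  have eS : e * S = c by rewrite /e divfK // gt_eqF.
  have v : e * (K 0%N * B) + e * K m + e = c by rewrite -eS /S; ring.
  by rewrite -mulrA in u; lra.
exists a, b, (z + z0); split => //; first by rewrite addrK.
by move: rz; rewrite /G /sh /root horner_comp !hornerE.
Qed.

(* [(P, Q)] are homogeneous coordinates of the map in the chart [Some z], and [(P', Q')] in
   the chart at infinity, whose coordinate is [u = 1 / z]. *)
Definition inv_chart (u : C) : T := if u == 0 then None else Some u^-1.

Lemma rational_charts (f : T -> T) : rational_map f -> exists P Q P' Q' : {poly C},
  [/\ independent P Q, independent P' Q',
     forall a b, nz a b ->
       (exists z, root (b *: P - a *: Q) z) \/ root (b *: P' - a *: Q') 0,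
     forall z, nz P.[z] Q.[z] /\ f (Some z) = hpoint P.[z] Q.[z]
   & forall u, nz P'.[u] Q'.[u] /\ f (inv_chart u) = hpoint P'.[u] Q'.[u]].
Proof.
move=> [p [q [cpq spq fz fN]]].
set n := (maxn (size p) (size q)).-1.
have n1 : n.+1 = maxn (size p) (size q) by rewrite prednK // (ltn_trans _ spq).
(* The reversal [u^n r(1/u)], with the degree [n] of the map as common exponent, so that both
   homogeneous coordinates change by the same factor. *)
pose rv (r : {poly C}) := \poly_(i < n.+1) r`_(n - i).
have sp : (size p <= n.+1)%N by rewrite n1 leq_maxl.
have sq : (size q <= n.+1)%N by rewrite n1 leq_maxr.
have rvE (r : {poly C}) u : (size r <= n.+1)%N -> u != 0 -> (rv r).[u] = u ^+ n * r.[u^-1].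
  move=> sr u0; rewrite horner_poly (horner_coef_wide _ sr) mulr_sumr.
  rewrite (reindex_inj rev_ord_inj); apply: eq_bigr => i _ /=.
  rewrite subSS subKn; last by rewrite -ltnS.
  rewrite mulrCA; congr (_ * _); rewrite exprVn -expfB_cond ?(negbTE u0) ?add0n //.
  by rewrite -ltnS.
have ind : independent p q.
  move=> a b nab; apply/eqP => E.
  have [b0|b0] := eqVneq b 0.
    move: nab E; rewrite /nz b0 eqxx orbF scale0r sub0r => a0 /eqP.
    rewrite oppr_eq0 scaler_eq0 (negbTE a0) /= => /eqP q0.
    by move: cpq spq; rewrite q0 coprimep0 size_poly0 maxn0 -size_poly_eq1 => /eqP ->.
  have pE : p = (a / b) *: q.
    apply/(scalerI b0); rewrite scalerA mulrCA divff // mulr1.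
    by apply/eqP; rewrite -subr_eq0 E.
  have qp : q %| p by rewrite pE -mul_polyC dvdp_mull.
  have := cpq; rewrite coprimep_sym => /coprimepP /(_ q (dvdpp q) qp).
  rewrite -size_poly_eq1 => /eqP q1; move: spq.
  by rewrite (maxn_idPr _) q1 // pE -q1 size_scale_leq.
have nzz z : nz p.[z] q.[z].
  apply/orP; case: (boolP (q.[z] == 0)) => [q0|]; [left|by right].
  by apply: (@coprimep_root _ q p) => //; rewrite coprimep_sym.
exists p, q, (rv p), (rv q); split => //.
- move=> a b nab; apply/eqP => E; have /eqP := ind a b nab; apply.
  apply/polyP => i; rewrite coefB !coefZ coef0.
  have [ni|ni] := leqP n.+1 i.
    by rewrite !nth_default ?(leq_trans _ ni) // !mulr0 subrr.
  have := congr1 (fun r : {poly C} => r`_(n - i)) E.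
  rewrite coefB !coefZ coef0 !coef_poly ltnS leq_subr subKn //; by rewrite -ltnS.
(* A fibre polynomial without roots is a nonzero constant; since [n > 0] its coefficient of degree
   [n] vanishes, and infinity lies in the fibre. *)
- move=> a b nab; have [/closed_rootP|] := boolP (size (b *: p - a *: q) != 1); first by left.
  rewrite negbK => /eqP s1; right; rewrite /root !hornerE !horner_coef0 !coef_poly /= subn0.
  have := congr1 (fun r : {poly C} => r`_n) (size1_polyC (eq_leq s1)).
  rewrite coefB !coefZ coefC => ->; case: (n) n1 spq => [<-|//].
  by rewrite ltnn.
- move=> u; rewrite /inv_chart; have [->|u0] := eqVneq u 0.
    have r0 (r : {poly C}) : (rv r).[0] = r`_n by rewrite horner_coef0 coef_poly /= subn0.
    rewrite !r0 fN /nz /hpoint; case: (ltngtP (size q) (size p)) => h.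
    + have np : n = (size p).-1 by rewrite /n (maxn_idPl (ltnW h)).
      have qn : q`_n = 0 by rewrite nth_default // np; case: (size p) h.
      rewrite qn eqxx orbF; split => //; rewrite np -lead_coefE lead_coef_eq0 -size_poly_gt0.
      exact: leq_ltn_trans h.
    + have nq : n = (size q).-1 by rewrite /n (maxn_idPr (ltnW h)).
      have pn : p`_n = 0 by rewrite nth_default // nq; case: (size q) h.
      have qn : q`_n != 0.
        rewrite nq -lead_coefE lead_coef_eq0 -size_poly_gt0; exact: leq_ltn_trans h.
      by rewrite pn qn orbT (negbTE qn) mul0r.
    + have np : n = (size p).-1 by rewrite /n h maxnn.
      have nq : n = (size q).-1 by rewrite /n h maxnn.
      have qn : q`_n != 0.
        by rewrite nq -lead_coefE lead_coef_eq0 -size_poly_gt0 h; move: spq; rewrite h maxnn;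
          apply: ltnW.
      by rewrite qn orbT (negbTE qn) {1}np nq -!lead_coefE.
  rewrite !rvE // /nz !mulf_eq0 expf_eq0 (negbTE u0) andbF /=; split; first exact: nzz.
  by rewrite hpoint_scale ?expf_neq0 // fz.
Qed.

Lemma root_sub_eq (p q : {poly C}) a b z : root (b *: p - a *: q) z <-> p.[z] * b = q.[z] * a.
Proof.
by rewrite /root !hornerE subr_eq0 mulrC [a * _]mulrC; split => [/eqP|->].
Qed.

Variable f : T -> T.
Hypothesis rf : rational_map f.

Lemma rational_continuous : continuous f.
Proof.
have [P [Q [P' [Q' [_ _ _ fz fu]]]]] := rational_charts rf.
move=> [z|] V.
  have [n0 ->] := fz z => /(hpoint_near n0) [e e0 eV].
  have [d d0 dP] := horner_continuous P z e0; have [d' d'0 dQ] := horner_continuous Q z e0.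
  apply/nbhs_someN; exists (Num.min d d'); first by rewrite lt_min d0.
  move=> w; rewrite lt_min => /andP[h h']; rewrite /= (fz w).2; apply: eV; [exact: dP|exact: dQ].
have -> : (None : T) = inv_chart 0 by rewrite /inv_chart eqxx.
have [n0 ->] := fu 0 => /(hpoint_near n0) [e e0 eV].
have [d d0 dP] := horner_continuous P' 0 e0; have [d' d'0 dQ] := horner_continuous Q' 0 e0.
have near u : N u < Num.min d d' -> V (f (inv_chart u)).
  rewrite lt_min => /andP[h h']; rewrite /= (fu u).2.
  by apply: eV; [apply: dP|apply: dQ]; rewrite subr0.
have dd : 0 < Num.min d d' by rewrite lt_min d0.
rewrite {1}/inv_chart eqxx; apply/nbhs_noneN; split.
  by have := near 0; rewrite normc0 /inv_chart eqxx; exact.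
exists (Num.min d d')^-1; first by rewrite invr_gt0.
move=> w hw; have N0 : 0 < N w by apply: lt_trans hw; rewrite invr_gt0.
have w0 : w != 0 by rewrite -normc_gt0.
have : N w^-1 < Num.min d d' by rewrite normcV invf_plt.
by move=> /near; rewrite /inv_chart invr_eq0 (negbTE w0) invrK.
Qed.

Lemma rational_open (x : T) (V : set T) : nbhs x V -> nbhs (f x) (f @` V).
Proof.
have [P [Q [P' [Q' [iP iP' surj fz fu]]]]] := rational_charts rf.
case: x => [z|].
  move=> /nbhs_someN [d d0 dV]; have [n0 ->] := fz z.
  apply: filterS (hpoint_open iP n0 d0) => w [a [b [z' [-> nab zd rt]]]].
  exists (Some z'); first exact: dV.
  by have [nz' ->] := fz z'; apply/hpoint_eq => //; exact/root_sub_eq.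
move=> /nbhs_noneN [VN [M M0 MV]].
have -> : (None : T) = inv_chart 0 by rewrite /inv_chart eqxx.
have [n0 ->] := fu 0.
have d0 : 0 < M^-1 by rewrite invr_gt0.
apply: filterS (hpoint_open iP' n0 d0) => w [a [b [u [-> nab zd rt]]]].
exists (inv_chart u); last first.
  by have [nz' ->] := fu u; apply/hpoint_eq => //; exact/root_sub_eq.
rewrite /inv_chart; have [//|u0] := eqVneq u 0; apply: MV.
by rewrite normcV -[M]invrK ltf_pV2 ?posrE ?normc_gt0 //; rewrite subr0 in zd.
Qed.

(** Slot [0] is for infinity and slot [k + 1] for the [k]-th root of the fibre polynomial; a slot
    whose candidate is not in the fibre receives some preimage [g y]. The number of slots is the
    same for all [y], so a slot can be fixed along an ultrafilter. *)
Lemma rational_fibers : exists (n : nat) (e : 'I_n -> T -> T),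
  (forall k y, f (e k y) = y) /\ (forall x, exists k, e k (f x) = x).
Proof.
have [P [Q [P' [Q' [iP iP' surj fz fu]]]]] := rational_charts rf.
have hp y : exists ab : C * C, nz ab.1 ab.2 /\ y = hpoint ab.1 ab.2.
  case: y => [w|]; [exists (w, 1)|exists (1, 0)]; rewrite /nz /hpoint oner_eq0 ?eqxx //=.
  by rewrite orbT divr1.
set n := maxn (size P) (size Q).
have /choice [s sP] : forall y, exists s : seq C, (size s <= n)%N /\
    forall z, f (Some z) = y -> z \in s.
  move=> y; have [[a b] /= [nab ->]] := hp y.
  have [s sE] := closed_field_poly_normal (b *: P - a *: Q).
  have G0 := iP _ _ nab; rewrite -lead_coef_eq0 in G0.
  exists s; split.
    have : leq (size (b *: P - a *: Q)) n.
      rewrite (leq_trans (size_polyD _ _)) // size_polyN geq_max.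
      by rewrite !(leq_trans (size_scale_leq _ _)) // leq_max leqnn ?orbT.
    by rewrite sE size_scale // size_prod_XsubC; exact: ltnW.
  move=> z; have [nz' ->] := fz z => /hpoint_eq -/(_ nz' nab) E.
  rewrite -root_prod_XsubC -(rootZ _ _ G0) -sE.
  exact/root_sub_eq.
have /choice [g gP] : forall y, exists x, f x = y.
  move=> y; have [[a b] /= [nab ->]] := hp y.
  case: (surj a b nab) => [[z rz]|rz].
    by exists (Some z); rewrite (fz z).2; apply/(hpoint_eq (fz z).1 nab)/root_sub_eq.
  by exists (inv_chart 0); rewrite (fu 0).2; apply/(hpoint_eq (fu 0).1 nab)/root_sub_eq.
pose e0 k y : T := if k is k'.+1 then Some (nth 0 (s y) k') else None.
exists n.+1, (fun k y => if pselect (f (e0 k y) = y) then e0 k y else g y); split.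
  by move=> k y; case: (pselect (f (e0 k y) = y)) => [E|_ /=]; [rewrite /= E|exact: gP].
case=> [z|]; last by exists ord0; rewrite /=; case: (pselect (f None = f None)).
have [sn /(_ z erefl) zs] := sP (f (Some z)).
have kn : ((index z (s (f (Some z)))).+1 < n.+1)%N by rewrite ltnS (leq_trans _ sn) // index_mem.
by exists (Ordinal kn); rewrite /= nth_index //; case: (pselect (f (Some z) = f (Some z))).
Qed.
End RationalMaps.

(** * Pulling back and pushing forward *)

Section FiniteOpenMap.
Variable R : realType.
Local Notation T := (Chat R).
Let hT := @hausdorff_Chat R.
Let cT := @compact_Chat R.
Variables (f : T -> T) (n : nat) (e : 'I_n -> T -> T).
Hypotheses (cf : continuous f) (opf : forall (x : T) V, nbhs x V -> nbhs (f x) (f @` V)).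
Hypotheses (fe : forall k y, f (e k y) = y) (ef : forall x, exists k, e k (f x) = x).

Lemma open_image O : open O -> open (f @` O).
Proof.
rewrite !openE => oO _ [x Ox <-]; apply: opf; exact: oO.
Qed.

Lemma closed_image C : closed C -> closed (f @` C).
Proof.
move=> cC; apply: (cpt_closed hT); apply: continuous_compact; last exact: closed_cpt.
exact: continuous_subspaceT.
Qed.

Lemma open_preimage O : open O -> open (f @^-1` O).
Proof. by move=> oO; apply: open_comp => // x _; exact: cf. Qed.

Lemma closed_preimage C : closed C -> closed (f @^-1` C).
Proof. by move=> cC; apply: closed_comp => // x _; exact: cf. Qed.

Lemma connected_image C : connected C -> connected (f @` C).
Proof. by move=> cC; apply: connected_continuous_connected => //; exact: continuous_subspaceT. Qed.

(** The image of the piece is the trace on [M] of [f @] C[and also that of]f @[O]; as [f] is closed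
    and open, it is clopen in the connected set [M]. *)
Lemma clopen_piece_onto M C O : connected M -> closed C -> open O ->
  f @^-1` M `&` C = f @^-1` M `&` O -> f @^-1` M `&` C !=set0 -> M `<=` f @` (f @^-1` M `&` C).
Proof.
move=> cM cC oO CO [x [Mx Cx]].
have EC : f @` (f @^-1` M `&` C) = M `&` f @` C.
  apply/seteqP; split => [_ [u [Mu Cu] <-]|y [My [u Cu uE]]]; first by split => //; exists u.
  by exists u => //; split => //; rewrite /preimage /= uE.
have EO : f @` (f @^-1` M `&` C) = M `&` f @` O.
  rewrite CO; apply/seteqP; split => [_ [u [Mu Cu] <-]|y [My [u Cu uE]]]; first by split => //;
    exists u.
  by exists u => //; split => //; rewrite /preimage /= uE.
suff -> : f @` (f @^-1` M `&` C) = M by [].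
apply: cM; first by exists (f x), x.
  by exists (f @` O) => //; exact: open_image.
by exists (f @` C) => //; exact: closed_image.
Qed.

(* Every clopen piece of the preimage of a connected set covers it, so a piece containing [x]
   with the fewest points above [f x] cannot be split. *)
Lemma component_clopen_preimage M x : connected M -> M (f x) -> exists C O,
  [/\ closed C, open O, connected_component (f @^-1` M) x = f @^-1` M `&` C
    & connected_component (f @^-1` M) x = f @^-1` M `&` O].
Proof.
move=> cM Mx.
pose idx (A : set T) := [set k : 'I_n | `[< A (e k (f x)) >]]%SET.
pose P m := `[< exists C O, [/\ closed C, open O, f @^-1` M `&` C = f @^-1` M `&` O,
  (f @^-1` M `&` C) x & #|idx (f @^-1` M `&` C)| = m] >].
have exP : exists m, P m.
  exists #|idx (f @^-1` M `&` setT)|; apply/asboolP; by exists setT, setT; split => //;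
    exact: openT.
case: (ex_minnP exP) => m /asboolP [C [ O [cC oO CO [_ Cx] Cm]]] min.
pose A := f @^-1` M `&` C.
have piece C' O' : closed C' -> open O' -> A `&` C' = A `&` O' -> A `&` C' !=set0 ->
    A `\` C' !=set0 -> ~ C' x.
  move=> cC' oO' CO' AC' nAC' C'x.
  have E1 : f @^-1` M `&` (C `&` C') = f @^-1` M `&` (O `&` O') by rewrite !setIA -CO -/A CO'.
  have E2 : f @^-1` M `&` (C `&` ~` O') = f @^-1` M `&` (O `&` ~` C').
    rewrite !setIA -CO -/A; apply/seteqP; split => u [Au h]; split => // h'; apply: h.
      by have : (A `&` C') u by []; rewrite CO' => -[].
    by have : (A `&` O') u by []; rewrite -CO' => -[].
  have := clopen_piece_onto cM (closedI cC (open_closedC oO')) (openI oO (closed_openC cC')) E2.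
  have N2 : f @^-1` M `&` (C `&` ~` O') !=set0.
    case: nAC' => u [Au nC]; exists u; rewrite setIA; split => // O'u; apply: nC.
    by have : (A `&` O') u by []; rewrite -CO' => -[].
  move=> /(_ N2 (f x) Mx) [v [Mv [Cv nOv]] vx].
  have : (m <= #|idx (f @^-1` M `&` (C `&` C'))|)%N.
    apply: min; apply/asboolP; exists (C `&` C'), (O `&` O'); split => //.
    - exact: closedI.
    - exact: openI.
  apply/negP; rewrite -ltnNge -Cm; apply: proper_card; apply/properP; split.
    by apply/fintype.subsetP => k; rewrite !inE => /asboolP [Mk [Ck _]]; apply/asboolP.
  have [k kv] := ef v; exists k; rewrite !inE; first by apply/asboolP; rewrite -vx kv.
  apply/asboolP; rewrite -vx kv => -[_ [_ C'v]].
  by have : (A `&` C') v by []; rewrite CO' => -[].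
have cA : connected A.
  apply: contrapT => /not_connected [S [ O' [cS oO' SO AS nAS]]].
  case: (pselect (S x)) => Sx; first exact: (piece S O').
  have AO : A `&` ~` O' = A `&` ~` S.
    apply/seteqP; split => u [Au h]; split => // h'; apply: h.
      by have : (A `&` S) u by []; rewrite SO => -[].
    by have : (A `&` O') u by []; rewrite -SO => -[].
  apply: (piece (~` O') (~` S)) => //.
  - exact: open_closedC.
  - exact: closed_openC.
  - by rewrite AO.
  - by rewrite setDE setCK -SO.
  - by move=> O'x; apply: Sx; have : (A `&` O') x by []; rewrite -SO => -[].
have E : connected_component (f @^-1` M) x = A.
  apply/seteqP; split; last first.
    by apply: connected_component_max => // u [].
  have sub : connected_component (f @^-1` M) x `<=` f @^-1` M := @connected_component_sub _ _ _.
  have Xx : connected_component (f @^-1` M) x x by exact: connected_component_refl.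
  have : connected_component (f @^-1` M) x `<=` C.
    apply: (@connected_closed2 _ _ C (~` O)) => //.
    - exact: component_connected.
    - exact: open_closedC.
    - move=> u /sub Mu; case: (pselect (O u)) => Ou; [left|by right].
      by have : (f @^-1` M `&` O) u by []; rewrite -CO => -[].
    - apply/seteqP; split => // u [[/sub Mu Cu] nO].
      by apply: nO; have : (f @^-1` M `&` C) u by []; rewrite CO => -[].
    - by exists x.
  by move=> sC u Xu; split; [exact: sub|exact: sC].
by exists C, O; rewrite E -CO.
Qed.

Lemma component_preimage_onto M x : connected M -> M (f x) ->
  f @` connected_component (f @^-1` M) x = M.
Proof.
move=> cM Mx; have [C [ O [cC oO E E']]] := component_clopen_preimage cM Mx.
apply/seteqP; split => [_ [u /connected_component_sub Mu <-] //|].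
rewrite E; apply: (clopen_piece_onto (O := O)) => //; first by rewrite -E -E'.
by exists x; rewrite -E; exact: connected_component_refl.
Qed.

(** If no branch converged to [x] along [U], some neighbourhood of [x] would be missed by all
    branches at almost every [i], although openness puts a point above [a i] into it. *)
Lemma lift_limit (I : Type) (U : set_system I) (a : I -> T) (x : T) : UltraFilter U ->
  a @ U --> f x -> exists k, (e k \o a) @ U --> x.
Proof.
move=> uU ax; apply: contrapT => no.
have /choice [V VP] : forall k, exists V, nbhs x V /\ ~ U [set i | V (e k (a i))].
  move=> k; apply: contrapT => nV; apply: no; exists k => V xV; apply: contrapT => nU.
  by apply: nV; exists V.
have nV : nbhs x [set u | forall k, V k u].
  by apply: (@filter_forall _ _ _ (nbhs x) (nbhs_filter x)) => k; case: (VP k).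
have nVk : U [set i | forall k, ~ V k (e k (a i))].
  by apply: filter_forall => k; apply: (ultra_notP uU); case: (VP k).
have [i [[u Vu uE] nVi]] := ultra_ex uU (ultraI uU (ax _ (opf nV)) nVk).
by have [k ku] := ef u; apply: (nVi k); rewrite -uE ku.
Qed.

Lemma cvg_image (I : Type) (U : set_system I) (a : I -> T) (x : T) : UltraFilter U ->
  a @ U --> x -> (f \o a) @ U --> f x.
Proof. by move=> uU ax V Vfx; exact: (ax _ (cf Vfx)). Qed.

Lemma ulim_image (I : Type) (U : set_system I) (H : I -> set T) : UltraFilter U ->
  ulim U (fun i => f @` H i) = f @` ulim U H.
Proof.
move=> uU; apply/seteqP; split => [y Hy|_ [x Hx <-]].
  have [J [V [phi [w [uV phiE Hw wy]]]]] := ulim_select uU Hy.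
  have /choice [v vP] : forall j, exists v, (f @` H (phi j)) (w j) -> H (phi j) v /\ f v = w j.
    move=> j; case: (pselect ((f @` H (phi j)) (w j))) => [[v Hv vw]|?]; first by exists v.
    by exists (w j).
  have [x vx] := ultra_lim cT v uV.
  have fv : V [set j | f (v j) = w j] by apply: filterS Hw => j /(vP j) [].
  exists x.
    rewrite -(ulim_map H phiE); apply: (ulim_mem uV vx).
    by apply: filterS Hw => j /(vP j) [].
  apply: (@cvg_unique _ hT (w @ V)) => //.
  move=> W /(cvg_image uV vx) fW; rewrite /nbhs /= in fW *.
  by apply: filterS (ultraI uV fv fW) => j [/= <-].
move=> V oV Vfx; have := Hx _ (open_preimage oV) Vfx; apply: filterS => i [u [Hu Vu]].
by exists (f u); split => //; exists u.
Qed.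

Variable K : set T.
Hypothesis cK : compact K.
Let L := f @^-1` K.

Lemma compact_preimage : compact L.
Proof. by apply: (closed_cpt cT); apply: closed_preimage; exact: cpt_closed. Qed.

(** * Pulling a decomposition back to the preimage *)

Section PulledBack.
Variable DK : set (set T).
Hypothesis mDK : monotone_decomposition K DK.
Let E := preimage_decomposition f DK.
Let same x x' := exists2 d, DK d & d (f x) /\ d (f x').

Lemma preimage_fiber x d : DK d -> d (f x) ->
  fiber_component L same x = connected_component (f @^-1` d) x.
Proof.
move=> Dd dx; congr connected_component; apply/seteqP; split => [y [Ly [d' Dd' [d'x d'y]]]|y dy].
  by rewrite (mono_eq mDK Dd Dd' dx d'x).
by split; [apply: (mono_subset mDK Dd)|exists d].
Qed.

Lemma preimage_monotone : monotone_decomposition L E.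
Proof.
have -> : E = [set c | exists2 x, L x & c = fiber_component L same x].
  apply/seteqP; split => [_ [d [x [Dd dx ->]]]|_ [x Lx ->]].
    by exists x; [exact: (mono_subset mDK Dd)|rewrite (preimage_fiber Dd dx)].
  have [d Dd dx] := mono_cover mDK Lx; exists d, x; split => //.
  by rewrite (preimage_fiber Dd dx).
apply: component_decomposition.
- exact: compact_preimage.
- by move=> x Lx; have [d Dd dx] := mono_cover mDK Lx; exists d.
- by move=> x y _ _ [d Dd [dx dy]]; exists d.
- move=> x y z _ _ _ [d Dd [dx dy]] [d' Dd' [d'y d'z]]; exists d => //; split => //.
  by rewrite (mono_eq mDK Dd Dd' dy d'y).
- move=> I U a b x y uU Uab ax by_.
  have Lx : L x.
    apply: (ultra_cvg_closed uU _ ax); first exact: (closed_preimage (cpt_closed hT cK)).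
    by apply: filterS Uab => i [].
  have [d Dd dx] := mono_cover mDK Lx; exists d => //; split => //.
  apply: (mono_limit mDK uU _ (cvg_image uU ax) (cvg_image uU by_) Dd dx).
  by apply: filterS Uab => i [_ _].
Qed.

(** As [c] is clopen over [d], a neighbourhood [O0] of [d] has its preimage split into a part in
    [W1] around [c] and a part in [U2] around the rest. [nc] gives [N0] inside [O0] for the images
    of the [H i], and the component through [z] of the preimage of [N1] serves: a point [u] of [H i]
    close to [z] has a component that covers [N1] without leaving [W1], so it reaches [c] and joins
    [u] to [z]. *)
Lemma preimage_nicely_connected : nicely_connected K DK -> nicely_connected L E.
Proof.
move=> nc I U H z c O uU HL cH Hz [d [x [Dd dx cE]]] cz nHc oO cO.
have cE' : c = connected_component (f @^-1` d) z.
  by rewrite cE; apply: same_connected_component; rewrite -cE.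
have dz : d (f z) by move: cz; rewrite cE => /connected_component_sub.
have cond := mono_connected mDK Dd.
have [C [ O' [cC oO' EC EO]]] := component_clopen_preimage cond dz.
rewrite -cE' in EC EO.
have cld := closed_preimage (mono_closed mDK Dd).
have clc : closed c by rewrite EC; exact: closedI.
have [||U1 [U2 [oU1 oU2 cU1 dU2 U12]]] := normal_sep hT cT clc (B := f @^-1` d `\` O').
- by apply: closedI => //; exact: open_closedC.
- by apply/seteqP; split => // u [cu [_ nO']]; apply: nO'; move: cu; rewrite EO => -[].
pose W1 := U1 `&` O.
have oW1 : open W1 by exact: openI.
have cW1 : c `<=` W1 by move=> u cu; split; [exact: cU1|exact: cO].
have W12 : W1 `&` U2 = set0.
  by apply/seteqP; split => // u [[U1u _] U2u]; rewrite -U12.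
have overd u : d (f u) -> W1 u -> c u.
  move=> du Wu; rewrite EO; split => //; apply: contrapT => nO.
  by rewrite -[False]/(set0 u) -W12; split => //; exact: dU2.
pose O0 := ~` (f @` ~` (W1 `|` U2)).
have oO0 : open O0.
  by apply: closed_openC; apply: closed_image; apply: open_closedC; exact: openU.
have dO0 : d `<=` O0.
  move=> v du [u nu uE]; rewrite -uE in du; apply: nu.
  by case: (pselect (O' u)) => Ou; [left; apply: cW1; rewrite EO|right; apply: dU2].
have pO0 u : O0 (f u) -> W1 u \/ U2 u.
  by move=> Ou; apply: contrapT => nu; apply: Ou; exists u.
(* If the images collapsed into [d], the limit of the [H i], connected and passing through [z],
   would lie in [c]. *)
have nHd : ~ (ulim U (fun i => f @` H i) `<=` d).
  rewrite (ulim_image _ uU) => QD; apply: nHc; rewrite cE'.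
  apply: connected_component_max => //; first by move=> u Hu; apply: QD; exists u.
  by apply: (ulim_connected hT cT uU); apply: filterS filterT => i _; exact: cH.
have [|||N0 [V0 [[cN0 N0K N0z oV0 V0z] UN]]] :=
  nc I U (fun i => f @` H i) (f z) d O0 uU _ _ _ Dd dz nHd oO0 dO0.
- by move=> i _ [u Hu <-]; exact: HL Hu.
- by move=> i; exact: connected_image.
- by rewrite (ulim_image _ uU); exists z.
pose N1 := N0 `|` d.
have cN1 : connected N1 by apply: connectedU => //; exists (f z).
have N1O : f @^-1` N1 `<=` W1 `|` U2.
  by move=> u [Nu|du]; apply: pO0; [have [] := N0K _ Nu|exact: dO0].
have N1z : N1 (f z) by right.
have inW u v : N1 (f u) -> W1 v -> connected_component (f @^-1` N1) u v ->
    connected_component (f @^-1` N1) u `<=` W1.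
  move=> Nu Wv uv; apply: (@connected_open2 _ _ W1 U2) => //.
  - exact: component_connected.
  - by apply: subset_trans N1O; exact: connected_component_sub.
  - by rewrite -setIA W12 setI0.
  - by exists v.
exists (connected_component (f @^-1` N1) z), (f @^-1` V0 `&` W1); split; first split.
- exact: component_connected.
- move=> u zu; split; last first.
    have zz : connected_component (f @^-1` N1) z z by exact: connected_component_refl.
    by case: (inW z z N1z (cW1 _ cz) zz u zu).
  by have [Nu|du] := connected_component_sub zu; [have [] := N0K _ Nu|exact: (mono_subset mDK Dd)].
- exact: connected_component_refl.
- by apply: openI => //; exact: open_preimage.
- by split => //; exact: cW1.
apply: filterS UN => i HN u [Hu [V0u Wu]].
have Nu : N1 (f u) by left; apply: HN; split => //; exists u.
have uu : connected_component (f @^-1` N1) u u by exact: connected_component_refl.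
have : N1 (f z) by [].
rewrite -{1}(component_preimage_onto cN1 Nu) => -[v uv vz].
have cv : c v by apply: overd; [rewrite vz|exact: (inW u u)].
have zv : connected_component (f @^-1` N1) z v.
  apply: (connected_component_max (B := c)) => //;
    last by apply: (mono_connected preimage_monotone); exists d, x.
  by move=> y; rewrite cE => /connected_component_sub; right.
by apply: (connected_component_trans zv); exact: connected_component_sym.
Qed.
End PulledBack.

(** * Pushing a decomposition of the preimage forward *)

Section PushedForward.
Variable D : set (set T).
Hypotheses (mD : monotone_decomposition L D) (ncD : nicely_connected L D).

Definition same_above (y y' : T) := forall d, D d ->
  (exists2 x, d x & f x = y) <-> (exists2 x, d x & f x = y').

(** The [a i] are lifted by a branch converging to [x], the [b i] by a branch into the same element
    of [D], fixed along [U] because there are finitely many; [mono_limit] puts both limits into one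
    element. *)
Lemma same_above_limit (I : Type) (U : set_system I) (a b : I -> T) (y y' : T) d :
  UltraFilter U -> U [set i | [/\ K (a i), K (b i) & same_above (a i) (b i)]] ->
  a @ U --> y -> b @ U --> y' -> D d -> (exists2 x, d x & f x = y) -> exists2 x, d x & f x = y'.
Proof.
move=> uU Uab ay by' Dd [x dx xy]; rewrite -xy in ay.
have [k kx] := lift_limit uU ay.
have /choice [l lP] : forall i, exists l : 'I_n, [/\ K (a i), K (b i) & same_above (a i) (b i)] ->
    exists2 d', D d' & d' (e k (a i)) /\ d' (e l (b i)).
  move=> i; case: (pselect [/\ K (a i), K (b i) & same_above (a i) (b i)]) => [[Ka Kb sab]|no];
    last by exists k.
  have [d' Dd' d'k] : exists2 d', D d' & d' (e k (a i)).
    by apply: (mono_cover mD); rewrite /L /= fe.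
  have [|v d'v vb] := (sab d' Dd').1; first by exists (e k (a i)).
  by have [l lv] := ef v; exists l => _; exists d' => //; rewrite -vb lv.
have [l0 _ Ul] := ultra_finite uU (A := [set: 'I_n]) finite_finset (h := l) filterT.
have [x' lx'] := ultra_lim cT (e l0 \o b) uU.
exists x'.
  apply: (mono_limit mD uU _ kx lx' Dd dx).
  by apply: filterS (ultraI uU Uab Ul) => i [/lP [d' Dd' [h1 h2]] /= <-]; exists d'.
apply: (@cvg_unique _ hT (b @ U)) => //.
move=> W /(cvg_image uU lx') fW; rewrite /nbhs /= in fW *.
by apply: filterS fW => i /=; rewrite fe.
Qed.

Lemma same_above_closed (I : Type) (U : set_system I) (a b : I -> T) (y y' : T) :
  UltraFilter U -> U [set i | [/\ K (a i), K (b i) & same_above (a i) (b i)]] ->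
  a @ U --> y -> b @ U --> y' -> same_above y y'.
Proof.
move=> uU Uab ay by' d Dd; split; first exact: (same_above_limit uU Uab).
apply: (same_above_limit uU _ by' ay Dd); apply: filterS Uab => i [Ka Kb sab]; split => //.
by move=> d' Dd'; split => /(sab d' Dd').
Qed.

Let G := [set c | exists2 y, K y & c = fiber_component K same_above y].

Lemma same_above_sym y y' : same_above y y' -> same_above y' y.
Proof. by move=> h d Dd; split => /(h d Dd). Qed.

Lemma same_above_trans y y' y'' : same_above y y' -> same_above y' y'' -> same_above y y''.
Proof. by move=> h h' d Dd; split => [/(h d Dd)/(h' d Dd)//|/(h' d Dd)/(h d Dd)]. Qed.

Lemma image_monotone : monotone_decomposition K G.
Proof.
apply: component_decomposition => //.
- by move=> y y' _ _; exact: same_above_sym.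
- by move=> y y' y'' _ _ _; exact: same_above_trans.
- exact: same_above_closed.
Qed.

(** The component through [e k (w i)] covers [H i], so its limit covers the limit of the [H i].
    Conversely each point above that limit lies in the limit for some [k]. Hence an element
    occurring above one point of the limit contains the limit for some [k] and occurs above all
    points. *)
Lemma same_above_ulim (I : Type) (U : set_system I) (H : I -> set T) (w : I -> T) :
  UltraFilter U -> (forall i, H i `<=` K) -> (forall i, connected (H i)) -> U [set i | H i (w i)] ->
  (forall k, exists2 d, D d & ulim U (fun i =>
    connected_component (f @^-1` (H i)) (e k (w i))) `<=` d) ->
  forall y y', ulim U H y -> ulim U H y' -> same_above y y'.
Proof.
move=> uU HK cH Hw Hd.
have sub y y' d : ulim U H y -> ulim U H y' -> D d -> (exists2 x, d x & f x = y) ->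
    exists2 x, d x & f x = y'.
  move=> Hy Hy' Dd [x dx xy].
  pose M k i := connected_component (f @^-1` (H i)) (e k (w i)).
  have imM k : f @` ulim U (M k) = ulim U H.
    rewrite -(ulim_image _ uU); apply/seteqP.
    by split; apply: (ulim_subset); apply: filterS Hw => i Hwi;
      rewrite /= /M component_preimage_onto // fe.
  have [J [V [phi [v [uV phiE Hv vy]]]]] := ulim_select uU Hy.
  rewrite -xy in vy; have [l lx] := lift_limit uV vy.
  have Vw : V [set j | H (phi j) (w (phi j))] by move: Hw; rewrite -phiE.
  have /choice [k kP] : forall j, exists k, H (phi j) (w (phi j)) /\ H (phi j) (v j) ->
      M k (phi j) (e l (v j)).
    move=> j; case: (pselect (H (phi j) (w (phi j)) /\ H (phi j) (v j))) => [[Hwj Hvj]|?];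
      last by exists l.
    have Hl : H (phi j) (f (e l (v j))) by rewrite fe.
    have := component_preimage_onto (cH (phi j)) Hl.
    move=> /seteqP [_ /(_ _ Hwj)] [u lu uw].
    have [k ku] := ef u; exists k => _; rewrite /M -uw ku; exact: connected_component_sym.
  have [k0 _ Uk] := ultra_finite uV (A := [set: 'I_n]) finite_finset (h := k) filterT.
  have Qx : ulim U (M k0) x.
    rewrite -(ulim_map _ phiE); apply: (ulim_mem uV lx).
    by apply: filterS (ultraI uV (ultraI uV Vw Hv) Uk) => j [/kP + /= kk]; rewrite kk.
  have [d0 Dd0 Qd0] := Hd k0.
  have dE : d = d0 by apply: (mono_eq mD Dd Dd0 dx); exact: Qd0.
  by move: Hy'; rewrite -(imM k0) => -[x' Qx' <-]; exists x' => //; rewrite dE; exact: Qd0.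
by move=> y y' Hy Hy' d Dd; split; exact: sub.
Qed.

(** Two nested neighbourhoods of [g] are used: components are compared inside the larger one, [F],
    while the continua are confined to the smaller one, [F1], so that their limits remain interior
    to [F]. *)
Lemma image_nicely_connected : nicely_connected K G.
Proof.
move=> I U H z g O uU HK cH Hz Gg gz nHg oO gO; apply: contrapT => no.
have mG := image_monotone; have clK : closed K by exact: cpt_closed.
have clg := mono_closed mG Gg.
have [C [oC gC CO]] := open_shrink hT cT clg oO gO.
have [C1 [oC1 gC1 C1C]] := open_shrink hT cT clg oC gC.
pose F := closure C; pose F1 := closure C1.
have CF : C `<=` F by exact: subset_closure.
have Kz : K z by apply: (mono_subset mG Gg).
have KFz : (K `&` F) z by split => //; apply: CF; exact: gC.
pose N := connected_component (K `&` F) z.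
have clN : closed N by apply: component_closed; apply: closedI => //; exact: closed_closure.
(* If the parts of the [H i] outside [N] did not accumulate at [z], then [N] itself would be the
   connected set sought. *)
have Hz' : ulim U (fun i => H i `\` N) z.
  move=> V oV Vz; apply: contrapT => nU; apply: no; exists N, V; split.
    split => //; [exact: component_connected| |exact: connected_component_refl].
    by move=> u /connected_component_sub [Ku Fu]; split => //; exact: CO.
  apply: filterS (ultra_notP uU nU) => i nH u [Hu Vu]; apply: contrapT => nN.
  by apply: nH; exists u.
have [J [V [phi [w [uV phiE Hw wz]]]]] := ulim_select uU Hz'.
pose Hc j := closure (H (phi j)).
have HcK j : Hc j `<=` K by rewrite /Hc closureE => u; apply; split => //; exact: HK.
have nHc : ~ (ulim V Hc `<=` g).
  move=> Hcg; apply: nHg; rewrite -(ulim_map H phiE).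
  apply: subset_trans Hcg; apply: ulim_subset; apply: filterS filterT => j _.
  exact: subset_closure.
have Hcw : V [set j | [/\ closed (Hc j), connected (Hc j) & Hc j (w j)]].
  apply: filterS Hw => j [Hw _]; split; first exact: closed_closure.
    exact: connected_closure.
  exact: subset_closure.
have gF1 : g `<=` F1°.
  by move=> u gu; rewrite /interior nbhsE; exists C1; [split => //;
    exact: gC1|exact: subset_closure].
have := ulim_shrink hT cT uV Hcw wz gz nHc (@closed_closure _ C1) gF1.
pose H' j := connected_component (Hc j `&` F1) (w j).
rewrite -/F1 -/(H') => -[VH' H'z nH'].
have clH' j : closed (H' j).
  by apply: component_closed; apply: closedI; exact: closed_closure.
have cH' j : connected (H' j) by exact: component_connected.
have H'sub j : H' j `<=` K `&` F1.
  by move=> u /connected_component_sub [/HcK ? ?].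
have H'K j : H' j `<=` K by move=> u /H'sub [].
(* If every lift collapsed into an element of [D], the limit of the [H' j] would lie in one class
   and so in [g], against [nH']; hence some lift does not collapse. *)
case: (pselect (forall k, exists2 d, D d &
    ulim V (fun i => connected_component (f @^-1` (H' i)) (e k (w i))) `<=` d)) => [all1|].
  have same := same_above_ulim uV H'K cH' VH' all1.
  apply: nH'; have [y Ky gE] := Gg.
  have -> : g = fiber_component K same_above z.
    by apply/esym; rewrite gE; apply: (fiber_component_eq (R := R)) => //;
      [move=> *; exact: same_above_sym|move=> ? ? ? _ _ _; exact: same_above_trans|rewrite -gE].
  apply: connected_component_max => //; last first.
    by apply: (ulim_connected hT cT uV); apply: filterS filterT => j _; exact: cH'.
  move=> u Hu; split; last exact: same.
  by apply: (ulim_closed uV clK _ Hu); apply: filterS filterT => j _; exact: H'K.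
move=> /existsNP [k nk].
(* At most one element of [D] contains infinity, and the limit of this lift is not inside it. *)
have [x0 Qx0 nx0] : exists2 x0, ulim V (fun i =>
  connected_component (f @^-1` (H' i)) (e k (w i))) x0 &
    forall d, D d -> d x0 -> ~ d None.
  case: (pselect (L None)) => LN; last first.
    have [x kx] := ultra_lim cT (e k \o w) uV; exists x.
      apply: (ulim_mem uV kx); apply: filterS VH' => j H'w.
      by apply: connected_component_refl; rewrite /preimage /= fe.
    by move=> d Dd _ dN; apply: LN; exact: (mono_subset mD Dd).
  have [d Dd dN] := mono_cover mD LN; apply: contrapT => no0; apply: nk; exists d => // x Qx.
  apply: contrapT => ndx; apply: no0; exists x => // d' Dd' d'x d'N; apply: ndx.
  by rewrite (mono_eq mD Dd Dd' dN d'N).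
pose M j := connected_component (f @^-1` (H' j)) (e k (w j)).
have clM j : closed (M j) by apply: component_closed; exact: closed_preimage.
have MH j : M j `<=` f @^-1` (H' j) by exact: connected_component_sub.
have ML j : M j `<=` L by move=> u /MH /H'sub [].
have Lx0 : L x0.
  apply: (ulim_closed uV _ _ Qx0); first exact: closed_preimage.
  by apply: filterS filterT => j _; exact: ML.
have [d0 Dd0 d0x] := mono_cover mD Lx0.
have cd0 := mono_closed mD Dd0.
have d0N : d0 `<=` ~` [set None].
  by move=> u du uN; apply: (nx0 d0 Dd0 d0x); rewrite -uN.
have oN : open (~` [set (None : T)]).
  by apply: closed_openC; exact: accessible_closed_set1 (hausdorff_accessible hT) _.
(* A second localisation, around [d0], keeps the continua away from infinity. *)
have [B [oB d0B BN]] := open_shrink hT cT cd0 oN d0N.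
have [J2 [V2 [phi2 [v [uV2 phi2E Mv vx]]]]] := ulim_select uV Qx0.
have MV2 : V2 [set j | [/\ closed (M (phi2 j)), connected (M (phi2 j)) & M (phi2 j) (v j)]].
  by apply: filterS Mv => j Mj; split => //; exact: component_connected.
have nM : ~ (ulim V2 (M \o phi2) `<=` d0).
  by rewrite (ulim_map _ phi2E) => Md; apply: nk; exists d0.
have dB : d0 `<=` (closure B)°.
  by move=> u du; rewrite /interior nbhsE; exists B; [split => //;
    exact: d0B|exact: subset_closure].
have := ulim_shrink hT cT uV2 MV2 vx d0x nM (@closed_closure _ B) dB.
pose M' j := connected_component (M (phi2 j) `&` closure B) (v j).
rewrite -/(M') => -[VM' M'x nM'].
have M'M j : M' j `<=` M (phi2 j) by move=> u /connected_component_sub [].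
apply: nM'; apply: (planar_collapse (L := L) (F := f @^-1` F) (D := D)) => //.
- exact: compact_preimage.
- by move=> j; apply: component_closed; apply: closedI => //; exact: closed_closure.
- by move=> j; exact: component_connected.
- by move=> j; apply: subset_trans (ML (phi2 j)).
- apply: (subset_trans (B := f @^-1` F1)).
    apply: (ulim_closed uV2); first by apply: closed_preimage; exact: closed_closure.
    by apply: filterS filterT => j _ u /M'M /MH /H'sub [].
  move=> u F1u; rewrite /interior nbhsE; exists (f @^-1` C); last by move=> y /CF.
  by split; [exact: open_preimage|exact: C1C].
(* If such a [C'] met many [M' j], the component [C0] containing its image would contain the points
   [w] and their limit [z], so [C0] would be [N]; but the [w] were chosen outside [N]. *)
- move=> C' cC' C'sub; apply: contrapT => nU.
  have meet : V2 [set j | M' j `&` C' !=set0].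
    by apply: filterS (ultra_notP uV2 nU) => j nj; apply/set0P/eqP.
  have [j0 [c [_ C'c]]] := ultra_ex uV2 meet.
  pose C0 := connected_component (K `&` F) (f c).
  have clC0 : closed C0 by apply: component_closed; apply: closedI => //; exact: closed_closure.
  have fC' : f @` C' `<=` C0.
    apply: connected_component_max; [by exists c| |exact: connected_image].
    by move=> _ [u /C'sub [Ku Fu] <-].
  have wC0 : V2 [set j | H' (phi2 j) (w (phi2 j)) /\ C0 (w (phi2 j))].
    have VH2 : V2 [set j | H' (phi2 j) (w (phi2 j))] by move: VH'; rewrite -phi2E.
    apply: filterS (ultraI uV2 meet VH2) => j [[u [/M'M /MH H'u C'u]] H'w]; split => //.
    apply: (subset_component (A := K `&` F) (B := H' (phi2 j))) => //.
    - by move=> y /H'sub [Ky F1y]; split => //; apply: CF; exact: C1C.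
    - by exists (f u); split => //; apply: fC'; exists u.
  have C0z : C0 z.
    apply: (ultra_cvg_closed uV2 (h := w \o phi2) clC0); last by apply: filterS wC0 => j [].
    by move: wz; rewrite -phi2E.
  have NC0 : N = C0 by apply/esym; exact: same_connected_component.
  have Hw2 : V2 [set j | (H (phi (phi2 j)) `\` N) (w (phi2 j))] by move: Hw; rewrite -phi2E.
  have [j [[_ nN] [_ Cw]]] := ultra_ex uV2 (ultraI uV2 Hw2 wC0).
  by apply: nN; rewrite NC0.
- move=> QN; have : closure B None.
    apply: (ulim_closed uV2 (@closed_closure _ B) _ QN).
    by apply: filterS filterT => j _ u /connected_component_sub [].
  by move=> /BN; apply.
- by exists x0.
Qed.

Lemma finite_meeting c d : c `<=` L -> connected c -> finite_set (meeting D c) ->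
  D d -> d `&` c !=set0 -> c `<=` d.
Proof.
move=> cL cc fin Dd dc.
apply: (@connected_closed2 _ c d (\bigcup_(d' in meeting D c `\ d) d')) => //.
- exact: (mono_closed mD).
- apply: closed_bigcup => [|d' [[Dd' _] _]]; last exact: (mono_closed mD).
  exact: sub_finite_set fin.
- move=> x cx; have [d' Dd' d'x] := mono_cover mD (cL x cx).
  case: (pselect (d' = d)) => [<-|d'd]; [by left|right; exists d' => //; split => //].
  by split => //; exists x.
- apply/seteqP; split => // x [[cx dx] [d' [[Dd' _] d'd] d'x]]; apply: d'd.
  exact: (mono_eq mD Dd' Dd d'x).
- by rewrite setIC.
Qed.

(** As [d] lies in one class, an element of [D] occurring above some point of [d] also occurs above
    [f x], hence contains some [e k (f x)]. *)
Lemma preimage_finer (DK : set (set T)) : monotone_decomposition K DK -> finer DK G ->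
  finer (preimage_decomposition f DK) D.
Proof.
move=> mDK fin _ [d [x [Dd dx ->]]].
have [_ [y0 Ky0 ->] dG] := fin d Dd.
have Lx : L x := mono_subset mDK Dd dx.
have [d0 Dd0 d0x] := mono_cover mD Lx; exists d0 => //.
have sub : connected_component (f @^-1` d) x `<=` f @^-1` d := @connected_component_sub _ _ _.
apply: finite_meeting => //.
- by move=> u /sub; exact: (mono_subset mDK Dd).
- exact: component_connected.
- apply: (@sub_finite_set _ _ [set d' | D d' /\ exists k, d' (e k (f x))]).
    move=> d' [Dd' [u [d'u /sub du]]]; split => //.
    have [_ su] := connected_component_sub (dG _ du);
      have [_ sx] := connected_component_sub (dG _ dx).
    have [//|v d'v <-] := ((same_above_trans (same_above_sym su) sx) d' Dd').1.
      by exists u.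
    by have [k kv] := ef v; exists k; rewrite kv.
  have /choice [h hP] : forall k, exists d', D d' /\ d' (e k (f x)).
    move=> k; have Lk : L (e k (f x)) by rewrite /L /= fe.
    by have [d' Dd' d'k] := mono_cover mD Lk; exists d'.
  apply: (@sub_finite_set _ _ (h @` [set: 'I_n])); last exact/finite_image/finite_finset.
  move=> d' [Dd' [k d'k]]; exists k => //; have [Dh hk] := hP k.
  exact: (mono_eq mD Dh Dd' hk).
- by exists x; split => //; exact: connected_component_refl.
Qed.
End PushedForward.
End FiniteOpenMap.

(** * Combining the two refinements *)

Section Main.
Variable R : realType.
Local Notation T := (Chat R).

Lemma nicely_connected_hyperspace (K : set T) D : compact K -> monotone_decomposition K D ->
  nicely_connected K D -> peano_hyperspace K D.
Proof.
move=> cK mD nc; have [dist [metD hopen]] := hyper_metrizable cK mD.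
by exists dist; split => //; exact: (nicely_connected_peano cK mD hopen metD nc).
Qed.

Lemma hyperspace_nicely_connected (K : set T) D : compact K -> monotone_decomposition K D ->
  peano_hyperspace K D -> nicely_connected K D.
Proof.
by move=> cK mD [dist [metD hopen pm]]; exact: (peano_nicely_connected cK mD hopen metD pm).
Qed.

Lemma finer_antisym (K : set T) D D' : monotone_decomposition K D -> monotone_decomposition K D' ->
  finer D D' -> finer D' D -> D = D'.
Proof.
have half D1 D2 : monotone_decomposition K D1 -> finer D1 D2 -> finer D2 D1 -> D1 `<=` D2.
  move=> m1 f12 f21 d Dd; have [d' Dd' dd'] := f12 d Dd; have [d'' Dd'' d'd''] := f21 d' Dd'.
  have [x dx] := mono_nonempty m1 Dd.
  have E : d = d'' by apply: (mono_eq m1 Dd Dd'' dx); apply: d'd''; exact: dd'.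
  suff -> : d = d' by [].
  by apply/seteqP; split => //; rewrite E.
by move=> m m' f1 f2; apply/seteqP; split; exact: half.
Qed.
End Main.

Theorem theoremA (R : realType) (K : set (Chat R)) (f : Chat R -> Chat R)
  (DK DfK : set (set (Chat R))) :
  compact K -> rational_map f ->
  core_decomposition_PS K DK ->
  core_decomposition_PS (f @^-1` K) DfK ->
  (forall d, DfK d -> DK (f @` d)) /\ preimage_decomposition f DK = DfK.
Proof.
move=> cK rf [mDK pDK coreDK] [mDfK pDfK coreDfK].
have cf := rational_continuous rf; have opf := rational_open rf.
have [n [e [fe ef]]] := rational_fibers rf.
have cL := compact_preimage cf cK.
have mE := preimage_monotone cf cK mDK.
have ncDK := hyperspace_nicely_connected cK mDK pDK.
have ncDfK := hyperspace_nicely_connected cL mDfK pDfK.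
have EDfK : preimage_decomposition f DK = DfK.
  apply: (finer_antisym mE mDfK).
    apply: (preimage_finer fe ef mDfK mDK).
    apply: coreDK; first exact: (image_monotone cf opf fe ef cK mDfK).
    apply: nicely_connected_hyperspace => //; first exact: (image_monotone cf opf fe ef cK mDfK).
    exact: (image_nicely_connected cf opf fe ef cK mDfK ncDfK).
  apply: coreDfK => //; apply: nicely_connected_hyperspace => //.
  exact: (preimage_nicely_connected cf opf ef cK mDK ncDK).
split => // d; rewrite -EDfK => -[d' [x [Dd' dx ->]]].
by rewrite (component_preimage_onto cf opf ef (mono_connected mDK Dd') dx).
Qed.
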